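(* Let $k$ be an algebraically closed field of characteristic zero and let $r,s$ be positive integers with $r<s$. Put $z=1/t$, $Z=\frac{1}{\sqrt[r]{t}}$ (so $z=Z^r$, $t=Z^{-r}$) and $Z'=\frac{1}{\sqrt[s-r]{t'}}$ (so $t'=Z'^{-(s-r)}$ and $z'=1/t'=Z'^{\,s-r}$). Let $\alpha\in k((Z))$ be a formal Laurent series of order $-s$ with respect to $Z$. Consider the system of equations $$\partial_t\Big(\alpha\big(\tfrac{1}{\sqrt[r]{t}}\big)\Big)+t'=0,\qquad \alpha\big(\tfrac{1}{\sqrt[r]{t}}\big)+tt'=\beta\Big(\tfrac{1}{\sqrt[s-r]{t'}}\Big).$$ Using the first equation one finds an expression of $Z=\frac{1}{\sqrt[r]{t}}$ as a formal power series (of order $1$) in $Z'=\frac{1}{\sqrt[s-r]{t'}}$; substituting this expression into the second equation gives $\beta=\beta(Z')$, which is a formal Laurent series in $k((Z'))$ of order $-s$ with respect to $Z'$. Then for any regular formal connection $R$ on $k((Z))$ we have an isomorphism of formal connections on $k((z'))$ $$\mathcal F^{(\infty,\infty)}\Big([r]_*\big([Z\partial_Z(\alpha)]\otimes_{k((Z))}R\big)\Big)\cong[s-r]_*\Big(\big[Z'\partial_{Z'}(\beta)+\tfrac{s}{2}\big]\otimes_{k((Z'))}R\Big),$$ where the $R$ on the right means the formal connection on $k((Z'))$ obtained from $R$ by replacing the variable $Z$ with $Z'$.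
   Context: A formal connection on $k((z))$ is a pair $(M,z\partial_z)$ with $M$ a finite dimensional $k((z))$-vector space and $z\partial_z:M\to M$ a $k$-linear map with $z\partial_z(fm)=z\partial_z(f)m+f\,z\partial_z(m)$ for $f\in k((z))$, $m\in M$; similarly for any other variable. Equality of connections means isomorphism. For $f\in k((Z))$, $[f]$ is the one dimensional connection $k((Z))e$ with $Z\partial_Z(ge)=(Z\partial_Z(g)+fg)e$. (Same notation for other variables.) A connection is regular if its irregularity is $0$; equivalently, it has a lattice (over the power series ring) stable under $z\partial_z$ (with the analogous meaning in any other variable). Tensor products of connections carry the usual Leibniz action. For the inclusion $[r]:k((z))\hookrightarrow k((Z))$, $z=Z^r$, and a connection $N$ on $k((Z))$, $[r]_*N$ is $N$ regarded as a $k((z))$-vector space with $z\partial_z=\frac1r Z\partial_Z$. Similarly $[s-r]_*$ for $k((z'))\hookrightarrow k((Z'))$, $z'=Z'^{\,s-r}$, with $z'\partial_{z'}=\frac{1}{s-r}Z'\partial_{Z'}$. With $t=1/z$, one has $t\partial_t=-z\partial_z=-\frac1r Z\partial_Z$ on $k((Z))$. Local Fourier transform $\mathcal F^{(\infty,\infty)}$ (Bloch–Esnault). It sends formal connections on $k((z))$ to formal connections on $k((z'))$, where $z=1/t$, $z'=1/t'$ and $t'$ is the Fourier dual coordinate of $t$. On a connection $M$ all of whose slopes are $>1$ (as is the case here, the slopes being $s/r$) it is described as follows: $z^2\partial_z:M\to M$ is bijective, and there is an isomorphism of $k$-vector spaces $\iota:M\to\mathcal F^{(\infty,\infty)}(M)$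 with $\iota\circ z^2\partial_z=\frac1{z'}\circ\iota$ and $-\iota\circ\frac1z=z'^2\partial_{z'}\circ\iota$. That is, $\mathcal F^{(\infty,\infty)}(M)$ is the $k$-vector space $M$ on which $z'$ acts as $(z^2\partial_z)^{-1}$ (this extends by continuity for the $z$-adic topology to an action of $k((z'))$, making it finite dimensional over $k((z'))$) and on which $z'^2\partial_{z'}$ acts as multiplication by $-\frac1z$. *)

(* Defs.v *)
From HB Require Import structures.
From mathcomp Require Import all_boot all_order all_algebra.
From mathcomp Require Import mathcomp_extra boolp classical_sets functions.
From mathcomp Require Import cardinality fsbigop.
From mathcomp Require Import zify ring.

Set Implicit Arguments.
Unset Strict Implicit.
Unset Printing Implicit Defensive.

Import Order.TTheory GRing.Theory Num.Theory.
Local Open Scope ring_scope.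

Section ZSum.
Variable k : fieldType.
Implicit Types F G : int -> k.

(* Only ever used on finitely supported F. *)
Definition zsum F : k := \sum_(i \in [set: int]) F i.

Lemma eq_zsum F G : F =1 G -> zsum F = zsum G.
Proof. by move=> /funext ->. Qed.

Lemma zsum_win F (a : int) (m : nat) :
  (forall i, F i != 0 -> (a <= i) && (i < a + m%:Z)) ->
  zsum F = \sum_(j < m) F (a + j%:Z).
Proof.
move=> h; pose s := [seq a + j%:Z | j <- iota 0 m].
have us : uniq s by rewrite map_inj_uniq ?iota_uniq // => i j; lia.
have hs i : i \notin s -> F i = 0.
  apply: contraNeq => /h /andP[h1 h2].
  apply/mapP; exists (absz (i - a)); last by lia.
  by rewrite mem_iota; lia.
have -> : zsum F = \sum_(i <- s) F i.
  rewrite (@bigfs _ _ _ _ s xpredT F us) //; last by move=> i _; exact: hs.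
  by apply: eq_fsbigl; apply/seteqP; split.
by rewrite big_map -{1}[m]subn0 big_mkord.
Qed.

Definition zbound (N : nat) F := forall i, F i != 0 -> (absz i <= N)%N.

Lemma zsum_bound N F : zbound N F ->
  zsum F = \sum_(j < N.*2.+1) F (- N%:Z + j%:Z).
Proof. by move=> h; apply: zsum_win => i /h; lia. Qed.

Lemma zboundW N M F : (N <= M)%N -> zbound N F -> zbound M F.
Proof. by move=> h hF i /hF h'; apply: leq_trans h' h. Qed.

Lemma zsumD N F G : zbound N F -> zbound N G ->
  zsum (fun i => F i + G i) = zsum F + zsum G.
Proof.
move=> hF hG; rewrite (zsum_bound hF) (zsum_bound hG) -big_split /=.
apply: zsum_bound => i; apply: contraNT => hi.
have /eqP -> : F i == 0 by apply: contraNT hi => /hF.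
have /eqP -> : G i == 0 by apply: contraNT hi => /hG.
by rewrite addr0.
Qed.

Lemma zsumMl c F : zsum (fun i => c * F i) = c * zsum F.
Proof. by rewrite /zsum mulr_fsumr. Qed.

Lemma zsumMr c F : zsum (fun i => F i * c) = zsum F * c.
Proof. by rewrite /zsum mulr_fsuml. Qed.

Lemma zsum0 F : (forall i, F i = 0) -> zsum F = 0.
Proof. by move=> h; apply: fsbig1. Qed.

Lemma zsum1 F i0 : (forall i, i != i0 -> F i = 0) -> zsum F = F i0.
Proof.
move=> h; rewrite (@zsum_win _ i0 1) ?big_ord1 ?addr0 //.
by move=> i; case: (eqVneq i i0) => [->|/h ->]; rewrite ?eqxx //; lia.
Qed.

Lemma zsum_shift c F : zsum F = zsum (fun i => F (i + c)).
Proof.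
rewrite /zsum (@reindex_fsbigT _ _ _ _ _ (fun i : int => i + c)) //.
by exists (fun i => i - c) => x; rewrite ?addrK ?subrK.
Qed.

Lemma zsum_refl c F : zsum F = zsum (fun i => F (c - i)).
Proof.
rewrite /zsum (@reindex_fsbigT _ _ _ _ _ (fun i : int => c - i)) //.
by exists (fun i => c - i) => x; rewrite subKr.
Qed.

Lemma zsum_exch N (G : int -> int -> k) :
  (forall i l, G i l != 0 -> (absz i <= N)%N && (absz l <= N)%N) ->
  zsum (fun i => zsum (fun l => G i l)) = zsum (fun l => zsum (fun i => G i l)).
Proof.
move=> h.
have -> : (fun i => zsum (fun l => G i l)) =
    (fun i => \sum_(j < N.*2.+1) G i (- N%:Z + j%:Z)).
  by apply/funext => i; apply: zsum_bound => l /h /andP[].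
have -> : (fun l => zsum (fun i => G i l)) =
    (fun l => \sum_(j < N.*2.+1) G (- N%:Z + j%:Z) l).
  by apply/funext => i; apply: zsum_bound => l /h /andP[].
rewrite (@zsum_bound N); last first.
  move=> i; apply: contraNT => hi; rewrite big1 // => j _.
  by apply/eqP; apply: contraNT hi => /h /andP[].
rewrite [RHS](@zsum_bound N); last first.
  move=> i; apply: contraNT => hi; rewrite big1 // => j _.
  by apply/eqP; apply: contraNT hi => /h /andP[].
exact: exchange_big.
Qed.

Lemma zsum_mult (r : nat) F : (0 < r)%N ->
  zsum (fun i => if (r %| i)%Z then F (i %/ r)%Z else 0) = zsum F.
Proof.
move=> r0; rewrite /zsum.
pose Q : set int := [set i : int | (r %| i)%Z]%classic.
rewrite -(@fsbig_widen _ _ _ _ Q [set: int]%classic) //; last first.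
  by move=> i [_ /= /negP/negbTE ->].
rewrite (@reindex_fsbig _ _ _ _ _ (fun i : int => i * r%:Z) [set: int]%classic Q).
  apply: eq_fsbigr => i _; rewrite dvdz_mull ?mulzK //; lia.
split => [i _ /=|i j _ _ /mulIf|i /= /dvdzP[q ->]]; [exact: dvdz_mull| |by exists q].
by apply; lia.
Qed.

End ZSum.

Section LaurentSeries.
Variable k : fieldType.

(* k((X)): all the fields k((z)), k((Z)), k((z')), k((Z')) are copies of this
   one, so that renaming the variable of a series or connection is the identity. *)
Record laurent := Laurent {
  lcoef :> int -> k;
  lcoef_bounded : exists N : int, forall n, n < N -> lcoef n = 0 }.

Implicit Types (f g h : laurent).

Lemma laurentP f g : f =1 g -> f = g.
Proof.
case: f g => [f hf] [g hg] /= /funext fg; subst g.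
by congr Laurent; apply: Prop_irrelevance.
Qed.

HB.instance Definition _ := gen_eqMixin laurent.
HB.instance Definition _ := gen_choiceMixin laurent.

Lemma lbound f : exists N : nat, forall n, f n != 0 -> - N%:Z <= n.
Proof.
have [N h] := lcoef_bounded f; exists (absz N) => n fn.
by rewrite leNgt; apply: contra fn => nN; apply/eqP/h; lia.
Qed.

Fact lzero_subproof : exists N : int, forall n, n < N -> (fun=> 0 : k) n = 0.
Proof. by exists 0. Qed.
Definition lzero := Laurent lzero_subproof.

Fact lopp_subproof f : exists N : int, forall n, n < N -> - f n = 0.
Proof. by have [N h] := lcoef_bounded f; exists N => n /h ->; rewrite oppr0. Qed.
Definition lopp f := Laurent (lopp_subproof f).

Fact ladd_subproof f g : exists N : int, forall n, n < N -> f n + g n = 0.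
Proof.
have [N h] := lcoef_bounded f; have [M h'] := lcoef_bounded g.
exists (Num.min N M) => n hn.
by rewrite h ?h' ?addr0 //; lia.
Qed.
Definition ladd f g := Laurent (ladd_subproof f g).

Fact laddA : associative ladd.
Proof. by move=> f g h; apply: laurentP => n /=; rewrite addrA. Qed.
Fact laddC : commutative ladd.
Proof. by move=> f g; apply: laurentP => n /=; rewrite addrC. Qed.
Fact ladd0 : left_id lzero ladd.
Proof. by move=> f; apply: laurentP => n /=; rewrite add0r. Qed.
Fact laddN : left_inverse lzero lopp ladd.
Proof. by move=> f; apply: laurentP => n /=; rewrite addNr. Qed.

HB.instance Definition _ := GRing.isZmodule.Build laurent laddA laddC ladd0 laddN.

Fact lmono_subproof (m : int) :
  exists N : int, forall n, n < N -> (n == m)%:R = 0 :> k.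
Proof. by exists m => n nm; rewrite lt_eqF. Qed.
Definition lmono m := Laurent (lmono_subproof m).

Fact lmul_subproof f g :
  exists N : int, forall n, n < N -> zsum (fun i => f i * g (n - i)) = 0.
Proof.
have [N h] := lcoef_bounded f; have [M h'] := lcoef_bounded g.
exists (N + M) => n nNM; apply: zsum0 => i.
case: (ltP i N) => [/h ->|Ni]; first by rewrite mul0r.
by rewrite h' ?mulr0 //; lia.
Qed.
Definition lmul f g := Laurent (lmul_subproof f g).

Lemma zbound_mul f g : exists C : nat, forall n,
  zbound (absz n + C) (fun i => f i * g (n - i)).
Proof.
have [N h] := lbound f; have [M h'] := lbound g.
exists (N + M)%N => n i; rewrite mulf_eq0 negb_or => /andP[/h h1 /h' h2]; lia.
Qed.

Fact lmulC : commutative lmul.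
Proof.
move=> f g; apply: laurentP => n /=; rewrite (zsum_refl n).
by apply: eq_zsum => i; rewrite subKr mulrC.
Qed.

Fact lmul1 : left_id (lmono 0) lmul.
Proof.
move=> f; apply: laurentP => n /=; rewrite (@zsum1 _ _ 0) /= ?mul1r ?subr0 //.
by move=> i /negbTE ->; rewrite mul0r.
Qed.

Fact lmulDl : left_distributive lmul +%R.
Proof.
move=> f g h; apply: laurentP => n /=.
have [C1 b1] := zbound_mul f h; have [C2 b2] := zbound_mul g h.
rewrite -(@zsumD _ (absz n + (C1 + C2))); last 2 first.
- by apply: zboundW (b1 n); lia.
- by apply: zboundW (b2 n); lia.
by apply: eq_zsum => i; rewrite mulrDl.
Qed.

Fact lmulA : associative lmul.
Proof.
move=> f g h; apply: laurentP => n /=.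
have [A1 h1] := lbound f; have [A2 h2] := lbound g; have [A3 h3] := lbound h.
transitivity (zsum (fun l => zsum (fun i => f l * g (i - l) * h (n - i)))).
  apply: eq_zsum => l; rewrite -zsumMl (zsum_shift (- l)).
  by apply: eq_zsum => i; rewrite mulrA; congr (_ * _ * h _); lia.
rewrite (@zsum_exch _ (absz n + A1 + A2 + A3)).
  by apply: eq_zsum => i; rewrite zsumMr.
move=> l i; rewrite !mulf_eq0 !negb_or => /andP[/andP[/h1 b1 /h2 b2] /h3 b3].
by lia.
Qed.

Fact lone_neq0 : lmono 0 != 0 :> laurent.
Proof.
apply/eqP => /(congr1 (fun f : laurent => f 0)) /= /eqP.
by rewrite oner_eq0.
Qed.

HB.instance Definition _ := GRing.Zmodule_isComNzRing.Build laurent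
  lmulA lmulC lmul1 lmulDl lone_neq0.

Definition has_order f (v : int) := f v != 0 /\ forall n, n < v -> f n = 0.

Lemma order_exists f : f != 0 -> exists v, has_order f v.
Proof.
move=> f0; have [N hN] := lbound f.
have [n fn] : exists n, f n != 0.
  apply: contrapT => h; move: f0; apply/negP; rewrite negbK; apply/eqP.
  apply: laurentP => n /=; apply/eqP; apply/negPn/negP => fn; apply: h.
  by exists n.
have ex : exists j : nat, f (- N%:Z + j%:Z) != 0.
  exists (absz (n + N%:Z)); have b := hN _ fn.
  by have -> : - N%:Z + (absz (n + N%:Z))%:Z = n by lia.
case: (ex_minnP ex) => j fj jmin; exists (- N%:Z + j%:Z); split=> // i ij.
apply/eqP; apply/negPn/negP => fi; have b := hN _ fi.
have e : - N%:Z + (absz (i + N%:Z))%:Z = i by lia.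
have := jmin (absz (i + N%:Z)); rewrite e => /(_ fi); lia.
Qed.

Lemma has_orderM f g v w :
  has_order f v -> has_order g w -> has_order (f * g) (v + w).
Proof.
move=> [f0 fl] [g0 gl]; split; last first.
  move=> n hn; apply: zsum0 => i.
  case: (ltP i v) => [/fl ->|vi]; first by rewrite mul0r.
  by rewrite gl ?mulr0 //; lia.
rewrite /= (@zsum1 _ _ v); first by rewrite (_ : v + w - v = w) ?mulf_neq0 //; lia.
move=> i iv; case: (ltP i v) => [/fl ->|vi]; first by rewrite mul0r.
by rewrite gl ?mulr0 //; lia.
Qed.

Lemma has_order_uniq f v w : has_order f v -> has_order f w -> v = w.
Proof.
move=> [f0 fl] [g0 gl]; case: (ltgtP v w) => // [/gl|/fl] e.
- by rewrite e eqxx in f0.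
- by rewrite e eqxx in g0.
Qed.

Section Inverse.
Variables (f : laurent) (v : int).
Fixpoint inv_seq (n : nat) : seq k :=
  if n is m.+1 then
    rcons (inv_seq m) ((f v)^-1 *
      ((m == 0)%:R - \sum_(j < m) (inv_seq m)`_j * f (v + (m - j)%:Z)))
  else [::].
Definition inv_coef n := (inv_seq n.+1)`_n.

Lemma size_inv_seq n : size (inv_seq n) = n.
Proof. by elim: n => //= n IH; rewrite size_rcons IH. Qed.

Lemma inv_seqE n i : (i < n)%N -> (inv_seq n)`_i = inv_coef i.
Proof.
elim: n => // n IH; rewrite ltnS leq_eqVlt => /predU1P[->//|lt_in].
by rewrite -(IH lt_in) /= nth_rcons size_inv_seq lt_in.
Qed.

Lemma inv_coefE n : f v != 0 ->
  \sum_(j < n.+1) inv_coef j * f (v + (n - j)%:Z) = (n == 0)%:R.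
Proof.
move=> fv; rewrite big_ord_recr /= subnn addr0.
rewrite {2}/inv_coef /= nth_rcons size_inv_seq ltnn eqxx.
rewrite mulrAC mulVf // mul1r addrC.
under [X in _ - X]eq_bigr => j _ do rewrite inv_seqE //.
by rewrite subrK.
Qed.

Fact inv_series_subproof : exists N : int, forall n, n < N ->
  (if 0 <= n + v then inv_coef (absz (n + v)) else 0) = 0.
Proof. by exists (- v) => n hn; rewrite ifF //; lia. Qed.
Definition inv_series := Laurent inv_series_subproof.

Lemma inv_seriesE : has_order f v -> inv_series * f = 1.
Proof.
move=> [fv fl]; apply: laurentP => n.
change (zsum (fun i => inv_series i * f (n - i)) = (n == 0)%:R).
case: (ltP n 0) => n0.
  rewrite lt_eqF // zsum0 // => i /=.
  case: ifP => hi; last by rewrite mul0r.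
  by rewrite fl ?mulr0 //; lia.
case: n n0 => // n _; rewrite (@zsum_win _ _ (- v) n.+1).
  rewrite -[RHS](inv_coefE n) //; apply: eq_bigr => j _ /=.
  have jn := ltn_ord j.
  have -> : - v + j%:Z + v = j%:Z by lia.
  by rewrite /=; congr (_ * f _); lia.
move=> i /=; case: ifP => hi; last by rewrite mul0r eqxx.
move=> hp; apply/andP; split; first by lia.
rewrite ltNge; apply: contra hp => hp; rewrite fl ?mulr0 //; lia.
Qed.
End Inverse.

Lemma inv_exists f : exists g, if f == 0 then g = 0 else g * f = 1.
Proof.
case: eqVneq => [_|/order_exists[v hv]]; first by exists 0.
by exists (inv_series f v); apply: inv_seriesE.
Qed.

Definition linv f : laurent := projT1 (cid (inv_exists f)).

Fact lmulVf f : f != 0 -> linv f * f = 1.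
Proof. by rewrite /linv; case: cid => g /=; case: eqP. Qed.
Fact linv0 : linv 0 = 0.
Proof. by rewrite /linv; case: cid => g /=; rewrite eqxx. Qed.

HB.instance Definition _ := GRing.ComNzRing_isField.Build laurent lmulVf linv0.

Lemma lmulE f g n : (f * g) n = zsum (fun i => f i * g (n - i)).
Proof. by []. Qed.

Lemma laddE f g n : (f + g) n = f n + g n.
Proof. by []. Qed.

Lemma loneE n : (1 : laurent) n = (n == 0)%:R.
Proof. by []. Qed.

Lemma has_order_neq0 f v : has_order f v -> f != 0.
Proof. by move=> [+ _]; apply: contraNneq => ->. Qed.

Lemma has_order1 : has_order 1 0.
Proof.
split; first by rewrite loneE eqxx oner_neq0.
by move=> n n0; rewrite loneE lt_eqF.
Qed.

Lemma has_orderV f v : has_order f v -> has_order f^-1 (- v).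
Proof.
move=> fv; have f0 := has_order_neq0 fv.
have [w fw] := order_exists (invr_neq0 f0).
have := has_orderM fv fw; rewrite mulfV // => h.
by have -> : - v = w by have := has_order_uniq has_order1 h; lia.
Qed.

Lemma has_orderX f v (i : int) : has_order f v -> has_order (f ^ i) (i * v).
Proof.
move=> fv.
have pos (n : nat) : has_order (f ^+ n) (n%:Z * v).
  elim: n => [|n IH]; first by rewrite expr0 mul0r; exact: has_order1.
  rewrite exprS (_ : n.+1%:Z * v = v + n%:Z * v); last by lia.
  exact: has_orderM.
case: i => n; first exact: pos.
rewrite NegzE -exprnN (_ : - n.+1%:Z * v = - (n.+1%:Z * v)); last by lia.
exact/has_orderV/pos.
Qed.

Definition lX : laurent := lmono 1.

Fact lconst_subproof (c : k) : exists N : int, forall n, n < N ->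
  (if n == 0 then c else 0) = 0.
Proof. by exists 0 => n n0; rewrite lt_eqF. Qed.
Definition lconst (c : k) : laurent := Laurent (lconst_subproof c).

Lemma lconstE c n : lconst c n = if n == 0 then c else 0.
Proof. by []. Qed.

Lemma lconst1 : lconst 1 = 1.
Proof. by apply: laurentP => n; rewrite loneE lconstE; case: eqP. Qed.

Lemma lconst_mulE c f n : (lconst c * f) n = c * f n.
Proof.
rewrite lmulE (@zsum1 _ _ 0) /= ?subr0 // => i /negbTE ->.
by rewrite mul0r.
Qed.

Definition is_power_series f := forall n, n < 0 -> f n = 0.

Definition val_ge (N : nat) f := forall n, n < N%:Z -> f n = 0.

(* The derivation X d/dX. *)
Fact theta_subproof f : exists N : int, forall n, n < N -> n%:~R * f n = 0.
Proof. by have [N h] := lcoef_bounded f; exists N => n /h ->; rewrite mulr0. Qed.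
Definition theta f := Laurent (theta_subproof f).

Lemma thetaD : {morph theta : f g / f + g}.
Proof. by move=> f g; apply: laurentP => n /=; rewrite mulrDr. Qed.

Lemma thetaM f g : theta (f * g) = theta f * g + f * theta g.
Proof.
apply: laurentP => n; rewrite laddE !lmulE /= -zsumMl.
have [C1 b1] := zbound_mul (theta f) g; have [C2 b2] := zbound_mul f (theta g).
rewrite -(@zsumD _ (absz n + (C1 + C2))); last 2 first.
- by apply: zboundW (b1 n); lia.
- by apply: zboundW (b2 n); lia.
apply: eq_zsum => i; rewrite /= -{1}(subrK i n) intrD; ring.
Qed.

Lemma theta_const c : theta (lconst c) = 0.
Proof.
apply: laurentP => n /=; case: eqP => [->|]; rewrite ?mul0r ?mulr0 //.
Qed.

Lemma lconstD : {morph lconst : a b / a + b}.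
Proof. by move=> a b; apply: laurentP => n /=; case: ifP; rewrite ?addr0. Qed.

Lemma lconstM : {morph lconst : a b / a * b}.
Proof.
move=> a b; apply: laurentP => n; rewrite lconst_mulE !lconstE.
by case: ifP; rewrite ?mulr0.
Qed.

(* Substitution f(phi).  By lcompE below the default value 0 is not used when
   phi has positive order, the only case in which the substitution makes sense. *)
Definition lcomp_coef f (phi : laurent) (n : int) : k :=
  zsum (fun i => f i * (phi ^ i) n).

Definition lcomp f (phi : laurent) : laurent :=
  if pselect (exists N : int, forall n, n < N -> lcomp_coef f phi n = 0) is left h
  then Laurent h else 0.

Lemma lcompE f phi v n : has_order phi v -> 0 < v ->
  lcomp f phi n = \sum_(i \in [set: int]) f i * (phi ^ i) n.
Proof.
move=> hphi v0; rewrite /lcomp; case: pselect => // -[].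
have [N h] := lcoef_bounded f.
exists (N * v) => m mN; apply: zsum0 => i.
case: (ltP i N) => [/h ->|Ni]; first by rewrite mul0r.
have [_ ->] := has_orderX i hphi; first by rewrite mulr0.
by apply: lt_le_trans mN _; rewrite ler_pM2r.
Qed.

Section Ramification.
Variables (r : nat) (r_gt0 : (0 < r)%N).

(* f(X^r) *)
Fact expand_subproof f : exists N : int, forall n, n < N ->
  (if (r %| n)%Z then f (n %/ r)%Z else 0) = 0.
Proof.
have [N h] := lcoef_bounded f; exists (N * r%:Z) => n nN.
case: ifP => // /dvdzP[q nq]; rewrite nq mulzK; last by lia.
by apply: h; rewrite -(ltr_pM2r (_ : 0 < r%:Z)) -?nq.
Qed.
Definition expand f := Laurent (expand_subproof f).

Fact rpart_subproof (j : nat) f : exists N : int, forall n, n < N ->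
  (if (j < r)%N then f (n * r%:Z + j%:Z) else 0) = 0.
Proof.
have [N hN] := lbound f; exists (- (N + 1)%:Z) => n nN.
case: ifP => // jr.
apply/eqP; apply/negPn/negP => /hN; rewrite leNgt => /negP; apply.
have : n * r%:Z <= - (N + 1)%:Z * r%:Z - r%:Z by nia.
nia.
Qed.
Definition rpart (j : nat) f := Laurent (rpart_subproof j f).

Lemma rpartE j f n : (j < r)%N -> rpart j f n = f (n * r%:Z + j%:Z).
Proof. by rewrite /= => ->. Qed.

Lemma expandE f n (j : nat) : (j < r)%N ->
  expand f (n * r%:Z + j%:Z) = if j == 0%N then f n else 0.
Proof.
move=> jr /=; case: eqP => [->|/eqP j0].
  by rewrite addr0 dvdz_mull ?mulzK //; lia.
rewrite ifF //; apply/negbTE/negP => /dvdzP[q].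
move=> e; have : j%:Z = (q - n) * r%:Z by lia.
have [|] := leP (q - n) 0 => h; nia.
Qed.

Lemma divr_decomp (n : int) : exists q : int, exists2 j : nat,
  (j < r)%N & n = q * r%:Z + j%:Z.
Proof.
exists (n %/ r)%Z, (absz (n %% r)%Z).
  have := ltz_pmod n (_ : 0 < r%:Z); have := modz_ge0 n (_ : r%:Z != 0); lia.
rewrite {1}(divz_eq n r); have := modz_ge0 n (_ : r%:Z != 0); lia.
Qed.

Lemma expand_mulE f g n (j : nat) : (j < r)%N ->
  (expand f * g) (n * r%:Z + j%:Z) = zsum (fun i => f i * g ((n - i) * r%:Z + j%:Z)).
Proof.
move=> jr; rewrite lmulE -[RHS](@zsum_mult _ r) //; apply: eq_zsum => i /=.
case: ifP => [/dvdzP[q ->]|]; last by rewrite mul0r.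
by rewrite mulzK; [congr (_ * g _); lia|lia].
Qed.

Lemma rpart_expandM j f g : rpart j (expand f * g) = f * rpart j g.
Proof.
apply: laurentP => n; rewrite lmulE /=; case: ifP => jr.
  exact: expand_mulE.
by rewrite zsum0 // => i; rewrite mulr0.
Qed.

Lemma rpartD j : {morph rpart j : f g / f + g}.
Proof. by move=> f g; apply: laurentP => n /=; case: ifP; rewrite ?addr0. Qed.

Lemma expandD : {morph expand : f g / f + g}.
Proof. by move=> f g; apply: laurentP => n /=; case: ifP; rewrite ?addr0. Qed.

Lemma expandM : {morph expand : f g / f * g}.
Proof.
move=> f g; apply: laurentP => n; have [q [j jr ->]] := divr_decomp n.
rewrite expandE // expand_mulE //; case: eqP => [j0|/eqP/negbTE j0].
  by rewrite lmulE; apply: eq_zsum => i; rewrite expandE // j0.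
by rewrite zsum0 // => i; rewrite expandE // j0 mulr0.
Qed.

Lemma expand_const c : expand (lconst c) = lconst c.
Proof.
apply: laurentP => n; have [q [j jr ->]] := divr_decomp n.
rewrite expandE // !lconstE.
have [->|j0] := eqVneq j 0%N.
  by rewrite addr0 mulf_eq0 (_ : (r%:Z == 0) = false) ?orbF //; lia.
case: eqP => // e; exfalso; have [h|h] := ltP q 0; nia.
Qed.

Lemma expand1 : expand 1 = 1.
Proof.
by rewrite -lconst1 expand_const.
Qed.

Lemma theta_expand f : theta (expand f) = lconst r%:R * expand (theta f).
Proof.
apply: laurentP => n; rewrite lconst_mulE /=.
case: ifP => [/dvdzP[q ->]|]; last by rewrite !mulr0.
by rewrite mulzK; [rewrite intrM; ring|lia].
Qed.

Fact join_subproof (F : 'I_r -> laurent) : exists N : int, forall n, n < N ->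
  \sum_(j < r) (if (n %% r)%Z == j%:Z then F j (n %/ r)%Z else 0) = 0.
Proof.
have /choice[b hb] : forall j, exists N : nat, forall n, F j n != 0 -> - N%:Z <= n.
  by move=> j; exact: lbound.
pose C := (\max_j b j)%N; exists (- (C * r)%:Z) => n hn.
apply: big1 => j _; case: eqP => // hj.
apply/eqP; apply/negPn/negP => /hb h.
have bC : (b j <= C)%N by apply: leq_bigmax.
move: (divz_eq n r); rewrite hj => e; nia.
Qed.
Definition ljoin F := Laurent (join_subproof F).

Lemma rpart_join F (j : 'I_r) : rpart j (ljoin F) = F j.
Proof.
apply: laurentP => n; rewrite rpartE //=.
have jr := ltn_ord j.
have hm : ((n * r%:Z + j%:Z) %% r)%Z = j%:Z by rewrite modzMDl modz_small //; lia.
have hd : ((n * r%:Z + j%:Z) %/ r)%Z = n by rewrite divzMDl ?divz_small ?addr0; lia.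
rewrite hm hd (bigD1 j) //= eqxx big1 ?addr0 // => i ij.
by case: eqP => // -[] /ord_inj e; rewrite e eqxx in ij.
Qed.

Lemma rpart_inj f g : (forall j : 'I_r, rpart j f = rpart j g) -> f = g.
Proof.
move=> h; apply: laurentP => n; have [q [j jr ->]] := divr_decomp n.
by have := congr1 (fun f : laurent => f q) (h (Ordinal jr)); rewrite !rpartE.
Qed.
End Ramification.

End LaurentSeries.

Arguments lX {k}.

Lemma subn_pos (r s : nat) : (r < s)%N -> (0 < s - r)%N.
Proof. by rewrite subn_gt0. Qed.

(* The coordinate t with X = t^(-1/r). *)
Definition tvar (k : fieldType) (r : nat) : laurent k := lX ^- r.

(* The derivation d/dt for t = X^(-r), from t d/dt = - (1/r) X d/dX. *)
Definition partial_t (k : fieldType) (r : nat) (f : laurent k) : laurent k :=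
  - (tvar k r)^-1 * lconst (r%:R^-1) * theta f.

Import passmx.

Section Connections.
Variable k : fieldType.
Local Notation K := (laurent k).

Definition crd (V : vectType K) : V -> 'rV[K]_(\dim {:V}) := rVof (vbasis {:V}).
Definition uncrd (V : vectType K) : 'rV[K]_(\dim {:V}) -> V := vecof (vbasis {:V}).

Lemma crdK (V : vectType K) : cancel (@crd V) (@uncrd V).
Proof. exact/rVofK/vbasisP. Qed.
Lemma uncrdK (V : vectType K) : cancel (@uncrd V) (@crd V).
Proof. exact/vecofK/vbasisP. Qed.
HB.instance Definition _ (V : vectType K) := GRing.Linear.copy (@crd V)
  (rVof (vbasis {:V})).
HB.instance Definition _ (V : vectType K) := GRing.Linear.copy (@uncrd V)
  (vecof (vbasis {:V})).

(* conn_D is X d/dX; k acts through the constant series. *)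
Record connection := Connection {
  conn_sort :> vectType K;
  conn_D : conn_sort -> conn_sort;
  conn_D_linear : forall (c : k) u v,
    conn_D (lconst c *: u + v) = lconst c *: conn_D u + conn_D v;
  conn_D_Leibniz : forall (f : K) v,
    conn_D (f *: v) = theta f *: v + f *: conn_D v }.

Lemma conn_DD (M : connection) : {morph @conn_D M : u v / u + v}.
Proof.
by move=> u v; have := conn_D_linear 1 u v; rewrite lconst1 !scale1r.
Qed.

Lemma conn_D0 (M : connection) : conn_D (0 : M) = 0.
Proof. by apply: (addIr (conn_D 0)); rewrite -conn_DD !add0r. Qed.

Lemma conn_D_sum (M : connection) I (s : seq I) (F : I -> M) :
  conn_D (\sum_(i <- s) F i) = \sum_(i <- s) conn_D (F i).
Proof. exact: (big_morph _ (@conn_DD M) (@conn_D0 M)). Qed.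

(* An additive map satisfying the Leibniz rule is k-linear. *)
Lemma Leibniz_linear (V : vectType K) (D : V -> V) :
    {morph D : u v / u + v} ->
    (forall (f : K) v, D (f *: v) = theta f *: v + f *: D v) ->
  forall (c : k) u v, D (lconst c *: u + v) = lconst c *: D u + D v.
Proof. by move=> DD DL c u v; rewrite DD DL theta_const scale0r add0r. Qed.

Definition conn_iso (M N : connection) : Prop :=
  exists g : {linear M -> N},
    bijective g /\ forall m, g (conn_D m) = conn_D (g m).

Section Rank1.
Variable f : K.
Definition rank1_D (g : K^o) : K^o := theta g + f * g.
Fact rank1_DD : {morph rank1_D : u v / u + v}.
Proof. by move=> u v; rewrite /rank1_D thetaD mulrDr addrACA. Qed.
Fact rank1_DL (a : K) (v : K^o) :
  rank1_D (a *: v) = theta a *: v + a *: rank1_D v.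
Proof. by rewrite /rank1_D /GRing.scale /= thetaM; ring. Qed.
(* the connection [f] *)
Definition rank1 : connection :=
  Connection (Leibniz_linear rank1_DD rank1_DL) rank1_DL.
End Rank1.

(* M (x) N is modelled on matrices in the coordinates crd of M and N, with
   m (x) n = (crd m)^T *m crd n; tensor_DE below is the Leibniz rule. *)
Section Tensor.
Variables M N : connection.
Local Notation MN := 'M[K]_(\dim {:M}, \dim {:N}).

Definition tens (m : M) (n : N) : MN := (crd m)^T *m crd n.

Definition conn_mx (P : connection) : 'M[K]_(\dim {:P}) :=
  \matrix_(i, j) coord (vbasis {:P}) j (conn_D (vbasis {:P})`_i).

Definition tensor_D (A : MN) : MN :=
  map_mx (@theta k) A + ((conn_mx M)^T *m A + A *m conn_mx N).

Lemma crd_D (P : connection) (v : P) :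
  crd (conn_D v) = map_mx (@theta k) (crd v) + crd v *m conn_mx P.
Proof.
have ev : v = \sum_i crd v 0 i *: (vbasis {:P})`_i by rewrite -{1}[v]crdK.
apply/rowP => j.
rewrite [LHS]mxE {1}ev conn_D_sum linear_sum /= !mxE.
under eq_bigr => i _ do rewrite conn_D_Leibniz linearD !linearZ /=.
rewrite big_split /=; congr (_ + _).
  rewrite (bigD1 j) //= coord_free ?(basis_free (vbasisP _)) // eqxx mulr1.
  rewrite big1 ?addr0 ?mxE // => i ij.
  by rewrite coord_free ?(basis_free (vbasisP _)) // (negbTE ij) mulr0.
by apply: eq_bigr => i _; rewrite !mxE.
Qed.

Lemma theta_mx_mul (m n p : nat) (A : 'M[K]_(m, n)) (B : 'M[K]_(n, p)) :
  map_mx (@theta k) (A *m B) =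
  map_mx (@theta k) A *m B + A *m map_mx (@theta k) B.
Proof.
have t0 : @theta k 0 = 0 by apply: laurentP => i /=; rewrite mulr0.
apply/matrixP => i j; rewrite !mxE (big_morph _ (@thetaD k) t0) -big_split /=.
by apply: eq_bigr => l _; rewrite !mxE thetaM.
Qed.

Lemma tensor_DE (m : M) (n : N) :
  tensor_D (tens m n) = tens (conn_D m) n + tens m (conn_D n).
Proof.
rewrite /tensor_D /tens !crd_D theta_mx_mul linearD /= mulmxDl mulmxDr.
rewrite trmx_mul -!mulmxA map_trmx.
by rewrite -!addrA; congr (_ + _); rewrite addrCA.
Qed.

Fact tensor_DD : {morph tensor_D : u v / u + v}.
Proof.
move=> u v; have tD : map_mx (@theta k) (u + v) =
    map_mx (@theta k) u + map_mx (@theta k) v.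
  by apply/matrixP => i j; rewrite !mxE thetaD.
rewrite /tensor_D tD mulmxDr mulmxDl [X in _ + X = _]addrACA.
exact: addrACA.
Qed.
Fact tensor_DL (a : K) (v : MN) :
  tensor_D (a *: v) = theta a *: v + a *: tensor_D v.
Proof.
rewrite /tensor_D -scalemxAl -scalemxAr !scalerDr [RHS]addrA; congr (_ + _).
by apply/matrixP => i j; rewrite !mxE thetaM.
Qed.
Definition tensor : connection :=
  Connection (Leibniz_linear tensor_DD tensor_DL) tensor_DL.
End Tensor.

(* Restriction of scalars along X |-> X^r. *)
Definition pushmod (r : nat) (r_gt0 : (0 < r)%N) (M : vectType K) : Type := M.

Section PushModule.
Variables (r : nat) (r_gt0 : (0 < r)%N) (M : vectType K).
Local Notation pM := (pushmod r_gt0 M).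

HB.instance Definition _ := GRing.Zmodule.copy pM M.

Definition push_scale (a : K) (m : pM) : pM := expand r_gt0 a *: (m : M).

Fact push_scaleA a b v : push_scale a (push_scale b v) = push_scale (a * b) v.
Proof. by rewrite /push_scale expandM scalerA. Qed.
Fact push_scale1 : left_id 1 push_scale.
Proof. by move=> v; rewrite /push_scale expand1 scale1r. Qed.
Fact push_scaleDr : right_distributive push_scale +%R.
Proof. by move=> a u v; rewrite /push_scale scalerDr. Qed.
Fact push_scaleDl v : {morph push_scale^~ v : a b / a + b}.
Proof. by move=> a b; rewrite /push_scale expandD scalerDl. Qed.

HB.instance Definition _ := GRing.Zmodule_isLmodule.Build K pM
  push_scaleA push_scale1 push_scaleDr push_scaleDl.

Definition push_crd (m : pM) : 'rV[K]_(r * \dim {:M}) :=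
  mxvec (\matrix_(j < r, i < \dim {:M}) rpart r_gt0 j (crd (m : M) 0 i)).

Fact push_vect : Vector.axiom (r * \dim {:M}) pM.
Proof.
exists push_crd.
  move=> a u v; rewrite /push_crd -linearP; congr mxvec.
  apply/matrixP => j i; rewrite !mxE.
  have -> : coord (vbasis {:M}) i ((a *: u + v : pM) : M) =
      expand r_gt0 a * coord (vbasis {:M}) i (u : M) + coord (vbasis {:M}) i (v : M).
    exact: (linearP (coord (vbasis {:M}) i) (expand r_gt0 a) (u : M) (v : M)).
  by rewrite rpartD rpart_expandM.
exists (fun w => uncrd (\row_i ljoin r_gt0 (fun j => vec_mx w j i)) : M).
  move=> m; rewrite /push_crd mxvecK -[RHS](crdK (m : M)); congr uncrd.
  apply/rowP => i; rewrite mxE; apply: (rpart_inj (r_gt0 := r_gt0)) => j.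
  by rewrite rpart_join mxE.
move=> w; rewrite /push_crd uncrdK -[RHS]vec_mxK; congr mxvec.
by apply/matrixP => j i; rewrite [LHS]mxE [in LHS]mxE rpart_join.
Qed.

HB.instance Definition _ := Lmodule_hasFinDim.Build K pM push_vect.
End PushModule.

Section Push.
Hypothesis k0 : [pchar k] =i pred0.
Variables (r : nat) (r_gt0 : (0 < r)%N) (M : connection).

Definition push_D (m : pushmod r_gt0 M) : pushmod r_gt0 M :=
  lconst r%:R^-1 *: (conn_D (m : M) : pushmod r_gt0 M).

Fact push_DD : {morph push_D : u v / u + v}.
Proof.
move=> u v; rewrite /push_D -scalerDr; congr (_ *: _).
exact: (@conn_DD M u v).
Qed.

Fact push_DL (f : K) (v : pushmod r_gt0 M) :
  push_D (f *: v) = theta f *: v + f *: push_D v.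
Proof.
have r0 : r%:R != 0 :> k by have /pcharf0P -> := k0; rewrite -lt0n.
have eS (a : K) (w : pushmod r_gt0 M) : a *: w = expand r_gt0 a *: (w : M) by [].
rewrite /push_D scalerA mulrC -scalerA.
have -> : conn_D ((f *: v : pushmod r_gt0 M) : M) =
   (lconst r%:R * theta f) *: v + f *: (conn_D (v : M) : pushmod r_gt0 M)
   :> pushmod r_gt0 M.
  rewrite !eS conn_D_Leibniz theta_expand.
  by rewrite expandM expand_const.
rewrite scalerDr; congr (_ + _).
rewrite scalerA mulrA -lconstM mulVf //.
by rewrite lconst1 mul1r.
Qed.

(* [r]_* M *)
Definition pushforward : connection :=
  Connection (Leibniz_linear push_DD push_DL) push_DL.
End Push.

Section Lattices.
Variable M : vectType K.

(* finitely generated modules over the power series ring that span M *)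
Definition is_lattice (L : M -> Prop) : Prop :=
  exists n (v : n.-tuple M), <<v>>%VS = fullv /\
    forall m, L m <-> exists c : 'I_n -> K,
      (forall i, is_power_series (c i)) /\ m = \sum_i c i *: tnth v i.
End Lattices.

Definition is_regular (M : connection) : Prop :=
  exists L : M -> Prop, is_lattice L /\ forall m, L m -> L (conn_D m).

(* N is the local Fourier transform F^(oo,oo) of M.  The last clause says that
   the action of k((z')) transported to M along iota is continuous in its scalar
   argument for the z'-adic and z-adic topologies (lattices form a neighbourhood
   basis of 0 in M), i.e. that it extends the action of z' by continuity. *)
Definition is_local_fourier (M N : connection) : Prop :=
  exists iota : M -> N,
  [/\ bijective iota,
      forall (c : k) u v,
        iota (lconst c *: u + v) = lconst c *: iota u + iota v,
      forall m, iota (lX *: conn_D m) = lX^-1 *: iota m,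
      forall m, - iota (lX^-1 *: m) = lX *: conn_D (iota m) &
      forall (m : M) (L : M -> Prop), is_lattice L ->
        exists p : nat, forall (f : K) (m' : M),
          val_ge p f -> iota m' = f *: iota m -> L m'].

End Connections.

(* Main.v *)
(* Write m = s - r, X for Z', theta = X d/dX, phi = Z(X), tau = phi^(-r) (that
   is t as a series in X) and D = theta + A, where A is the constant matrix of
   the regular connection R in a suitable basis.  After the substitution
   Z = phi(X) and a gauge transformation commuting with A, the operator 1/z' on
   the left-hand side is P = X^(-m) - (theta tau)^(-1) D.  The transform is then
   the formal stationary phase expansion of the Fourier integral: an operator
     T = \sum_(i >= 0) X^i c_i(D),  c_i polynomials with c_0 = 1,
   such that
     (I)  P T = T X^(-m),
     (II) tau T = T (tau - X^m (D + sigma) / m),  sigma = (m - r) / 2.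
   Since sigma = s/2 - r, T^(-1) turns P and -tau into the operators required
   for the connection [theta beta + s/2 - r] (x) R, and the shift by r is
   absorbed by the factor X^(-r).

   Both equations are identities between the polynomials c_i, so they may be
   solved for A = 0, with scalar operators.  Equation (I) is a recursive system
   of difference equations c_i(x - m) - c_i(x) = ..., which has a solution T0,
   and T0 u solves it for every power series u.  The defect
   Delta = tau T - T (tau - X^m (theta + sigma) / m) satisfies (I) again, and a
   solution of (I) with polynomial coefficients that kills 1 vanishes, because
   a periodic polynomial is constant.  So (II) only has to hold at 1, which
   determines u; that the leading term of this last equation vanishes is where
   the value of sigma comes from. *)

From HB Require Import structures.
Require Import Defs.
From mathcomp Require Import all_boot all_order all_algebra.
From mathcomp Require Import all_fingroup boolp.
From mathcomp Require Import zify ring.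

Set Implicit Arguments.
Unset Strict Implicit.
Unset Printing Implicit Defensive.

Import Order.TTheory GRing.Theory Num.Theory.
Local Open Scope ring_scope.

(** The obstacle is that T has infinite order. As X^i c_i(D) raises orders by i, T acts on Laurent
    series as a unitriangular map: it is determined by its values on monomials, it is bijective
    because c_0 = 1, and identities between such maps may be tested on monomials. On X^l such an
    identity only involves the values c_i(l); characteristic zero provides infinitely many integers
    l, so it becomes an identity of polynomials, which can then be evaluated at the matrices A + l.
    This is why A has to be constant: D then sends v X^l to v (A + l) X^l, and c_i(D) preserves
    degrees. Regularity enters through this alone.

    Equations (I) and (II) are compatible because the pairs (P, tau) and (X^(-m), tau - X^m (D +
    sigma) / m) satisfy the same Weyl relation, with commutator -1. Hence Delta intertwines P with
    X^(-m) for every sigma, and only its value at 1 can obstruct (II). *)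

(** * Filtered spaces of Laurent series *)

(* Elements of W are Laurent series with coefficients in V; it serves for k((X))
   and for matrices over it. *)
Record series (W V : zmodType) := Series {
  cf : W -> int -> V;
  cfD : forall u w n, cf (u + w) n = cf u n + cf w n;
  cf_inj : forall u w, cf u =1 cf w -> u = w;
  cf_bounded : forall w, exists i, forall n, n < i -> cf w n = 0;
  cf_ex : forall F i, (forall n, n < i -> F n = 0) -> exists w, cf w =1 F }.

Lemma morph0 (U W : zmodType) (T : U -> W) :
  {morph T : u w / u + w} -> T 0 = 0.
Proof. by move=> TD; apply: (addIr (T 0)); rewrite -TD !add0r. Qed.

Lemma morphN (U W : zmodType) (T : U -> W) :
  {morph T : u w / u + w} -> {morph T : u / - u}.
Proof.
by move=> TD u; apply: (addIr (T u)); rewrite -TD !addNr morph0.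
Qed.

Lemma morphB (U W : zmodType) (T : U -> W) :
  {morph T : u w / u + w} -> {morph T : u w / u - w}.
Proof. by move=> TD u w; rewrite TD morphN. Qed.

Section Series.
Variables (W V : zmodType) (S : series W V).
Implicit Types (u w : W) (v : V) (i j n : int).

Lemma cf0 n : cf S 0 n = 0.
Proof. by apply: (@morph0 _ _ (cf S ^~ n)) => u w; rewrite cfD. Qed.

Lemma cfN w n : cf S (- w) n = - cf S w n.
Proof. by apply: (@morphN _ _ (cf S ^~ n)) => u x; rewrite cfD. Qed.

Lemma cfB u w n : cf S (u - w) n = cf S u n - cf S w n.
Proof. by rewrite cfD cfN. Qed.

Lemma cf_sum I (s : seq I) (F : I -> W) n :
  cf S (\sum_(i <- s) F i) n = \sum_(i <- s) cf S (F i) n.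
Proof. by apply: (big_morph (cf S ^~ n)); [move=> u w; rewrite cfD|rewrite cf0]. Qed.

Definition ge i w := forall n, n < i -> cf S w n = 0.

Lemma ge_ex w : exists i, ge i w.
Proof. exact: cf_bounded. Qed.

Lemma ge0 i : ge i 0.
Proof. by move=> n _; rewrite cf0. Qed.

Lemma geD i u w : ge i u -> ge i w -> ge i (u + w).
Proof. by move=> hu hw n ni; rewrite cfD hu ?hw ?addr0. Qed.

Lemma geN i w : ge i w -> ge i (- w).
Proof. by move=> hw n ni; rewrite cfN hw ?oppr0. Qed.

Lemma geB i u w : ge i u -> ge i w -> ge i (u - w).
Proof. by move=> hu hw; apply: geD => //; apply: geN. Qed.

Lemma geW i j w : ge j w -> i <= j -> ge i w.
Proof. by move=> hw ij n ni; apply: hw; apply: lt_le_trans ni ij. Qed.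

Lemma ge_sum I (s : seq I) (P : pred I) (F : I -> W) i :
  (forall x, P x -> ge i (F x)) -> ge i (\sum_(x <- s | P x) F x).
Proof.
move=> h; elim/big_rec: _ => [|x w Px hw]; first exact: ge0.
by apply: geD => //; apply: h.
Qed.

Lemma ge_all w : (forall i, ge i w) -> w = 0.
Proof.
by move=> h; apply: (@cf_inj _ _ S) => n; rewrite cf0 (h (n + 1)) // ltrDl.
Qed.

Lemma ge_step i w : ge i w -> cf S w i = 0 -> ge (i + 1) w.
Proof.
move=> h h0 n; rewrite ltzD1 le_eqVlt => /predU1P[->//|]; exact: h.
Qed.

(* mono i v is v X^i. *)
Fact mono_subproof i v : exists w, forall n, cf S w n = if n == i then v else 0.
Proof.
apply: (cf_ex S (F := fun n => if n == i then v else 0) (i := i)) => n ni.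
by rewrite lt_eqF.
Qed.
Definition mono i v : W := projT1 (cid (mono_subproof i v)).

Lemma cf_mono i v n : cf S (mono i v) n = if n == i then v else 0.
Proof. by rewrite /mono; case: cid => w /=. Qed.

Lemma ge_mono i v : ge i (mono i v).
Proof. by move=> n ni; rewrite cf_mono lt_eqF. Qed.

Lemma monoD i : {morph mono i : v v' / v + v'}.
Proof.
move=> v v'; apply: (@cf_inj _ _ S) => n; rewrite cfD !cf_mono.
by case: eqP; rewrite ?addr0.
Qed.

Lemma ge_rest i w : ge i w -> ge (i + 1) (w - mono i (cf S w i)).
Proof.
move=> h; apply: ge_step; first by apply: geB => //; apply: ge_mono.
by rewrite cfB cf_mono eqxx subrr.
Qed.

(* ser i F is \sum_n (F n) X^(i + n). *)
Fact ser_subproof i (F : nat -> V) :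
  exists w, forall n, cf S w n = if i <= n then F (absz (n - i)%R) else 0.
Proof.
apply: (cf_ex S (F := fun n => if i <= n then F (absz (n - i)%R) else 0) (i := i)).
by move=> n ni; rewrite ifF //; lia.
Qed.
Definition ser i F : W := projT1 (cid (ser_subproof i F)).

Lemma cf_ser i F (n : nat) : cf S (ser i F) (i + n%:Z) = F n.
Proof.
rewrite /ser; case: cid => w /= ->; rewrite ifT; last lia.
by congr F; lia.
Qed.

Lemma ge_ser i F : ge i (ser i F).
Proof. by move=> n ni; rewrite /ser; case: cid => w /= ->; rewrite ifF //; lia. Qed.

Lemma ge_eq i u w : ge i u -> ge i w ->
  (forall n : nat, cf S u (i + n%:Z) = cf S w (i + n%:Z)) -> u = w.
Proof.
move=> hu hw h; apply: (@cf_inj _ _ S) => n.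
have [ni|i_n] := ltP n i; first by rewrite hu ?hw.
by have -> : n = i + (absz (n - i)%R)%:Z by lia.
Qed.

Lemma ge_expand i w (N : nat) : ge i w ->
  ge (i + N%:Z) (w - \sum_(j < N) mono (i + j%:Z) (cf S w (i + j%:Z))).
Proof.
move=> h n hn; rewrite cfB cf_sum; have [ni|i_n] := ltP n i.
  rewrite h // sub0r big1 ?oppr0 // => j _; rewrite cf_mono ifF //; lia.
have hj : (absz (n - i)%R < N)%N by lia.
rewrite (bigD1 (Ordinal hj)) //= big1 => [|j jn].
  have e : i + (absz (n - i)%R)%:Z = n by lia.
  by rewrite addr0 cf_mono e eqxx subrr.
rewrite cf_mono ifF //; apply: contraNF jn => /eqP e.
by apply/eqP/val_inj => /=; lia.
Qed.

End Series.

Section Filtered.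
Variables (W V : zmodType) (S : series W V) (W' V' : zmodType) (S' : series W' V').

Definition filt (c : int) (T : W -> W') := forall i w, ge S i w -> ge S' (i + c) (T w).

Lemma filtW (c d : int) T : d <= c -> filt c T -> filt d T.
Proof. by move=> dc h i w /h hw; apply: (geW hw); rewrite lerD2l. Qed.

Lemma filtB c T1 T2 : filt c T1 -> filt c T2 -> filt c (fun w => T1 w - T2 w).
Proof. by move=> h1 h2 i w hw; apply: geB; [apply: h1|apply: h2]. Qed.

(* An additive filtered map is continuous, and finite sums of monomials are dense. *)
Lemma dense0 (c : int) (T : W -> W') : {morph T : u w / u + w} -> filt c T ->
  (forall i v, T (mono S i v) = 0) -> forall w, T w = 0.
Proof.
move=> TD Tf T0 w; apply: (@ge_all _ _ S') => N.
have key (j : nat) (i : int) u : ge S i u -> ge S' (i + c + j%:Z) (T u).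
  elim: j i u => [|j IH] i u hu; first by rewrite addr0; apply: Tf.
  have -> : T u = T (u - mono S i (cf S u i)) by rewrite (morphB TD) T0 subr0.
  by apply: (geW (IH _ _ (ge_rest hu))); lia.
have [i hi] := ge_ex S w.
by apply: (geW (key (absz (N - i - c)%R) _ _ hi)); lia.
Qed.

Lemma dense_eq (c d : int) (T1 T2 : W -> W') :
  {morph T1 : u w / u + w} -> {morph T2 : u w / u + w} -> filt c T1 -> filt d T2 ->
  (forall i v, T1 (mono S i v) = T2 (mono S i v)) -> T1 =1 T2.
Proof.
move=> D1 D2 f1 f2 h w; apply/eqP; rewrite -subr_eq0; apply/eqP.
apply: (@dense0 (Num.min c d) (fun w => T1 w - T2 w)) => [u x||i v].
- by rewrite D1 D2 opprD addrACA.
- by apply: filtB; [apply: filtW f1|apply: filtW f2]; lia.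
- by rewrite h subrr.
Qed.

Lemma filt_of_mono (c d : int) T : {morph T : u w / u + w} -> filt c T ->
  (forall i v, ge S' (i + d) (T (mono S i v))) -> filt d T.
Proof.
move=> TD Tf h i w hw; pose N := absz (d - c)%R.
have := Tf _ _ (@ge_expand _ _ S i w N hw); rewrite (morphB TD) => hT.
rewrite -[T w](subrK (T (\sum_(j < N) mono S (i + j%:Z) (cf S w (i + j%:Z))))).
apply: geD; first by apply: (geW hT); lia.
rewrite (big_morph _ TD (morph0 TD)); apply: ge_sum => j _.
by apply: (geW (h _ _)); lia.
Qed.

(** Terms of [w] beyond degree i + n contribute only above degree i + c + n. *)
Lemma cf_ext (c : int) T : {morph T : u w / u + w} -> filt c T ->
  forall i w (n : nat), ge S i w -> cf S' (T w) (i + c + n%:Z) =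
    \sum_(j < n.+1) cf S' (T (mono S (i + j%:Z) (cf S w (i + j%:Z)))) (i + c + n%:Z).
Proof.
move=> TD Tf i w n hw; have := Tf _ _ (@ge_expand _ _ S i w n.+1 hw).
rewrite (morphB TD) (big_morph _ TD (morph0 TD)) => /(_ (i + c + n%:Z)).
rewrite cfB cf_sum => /(_ _)/eqP; rewrite subr_eq0 => h.
by apply/eqP/h; lia.
Qed.

Section Extension.
Variables (c : int) (t : int -> V -> W').
Hypothesis tD : forall l, {morph t l : u w / u + w}.
Hypothesis tf : forall l v, ge S' (l + c) (t l v).

(** The coefficient of degree n of the future [T w]: the terms of [w] above degree n - c cannot
    reach it, so the sum is finite. The maximum with 0 makes the range empty when n - c < lo. *)
Let win (w : W) (lo n : int) : V' :=
  \sum_(j < absz (Num.max 0 (n - c - lo + 1))%R) cf S' (t (lo + j%:Z) (cf S w (lo + j%:Z))) n.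

Let winE w lo' lo n : lo' <= lo -> ge S lo w -> win w lo' n = win w lo n.
Proof.
move=> le h; rewrite /win; case: (ltP (n - c) lo) => hn.
  have -> : absz (Num.max 0 (n - c - lo + 1))%R = 0%N by lia.
  rewrite big_ord0 big1 // => j _; rewrite h ?(morph0 (tD _)) ?cf0 //.
  by have := ltn_ord j; lia.
have -> : absz (Num.max 0 (n - c - lo' + 1))%R =
  (absz (lo - lo')%R + absz (Num.max 0 (n - c - lo + 1))%R)%N by lia.
rewrite big_split_ord /= big1 ?add0r.
  apply: eq_bigr => j _.
  by have -> : lo' + (absz (lo - lo')%R + j)%N%:Z = lo + j%:Z by lia.
move=> j _; rewrite h ?(morph0 (tD _)) ?cf0 //.
by have := ltn_ord j; lia.
Qed.

Lemma extension : exists T : W -> W',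
  [/\ {morph T : u w / u + w}, filt c T & forall l v, T (mono S l v) = t l v].
Proof.
have ex w : exists y, forall lo n, ge S lo w -> cf S' y n = win w lo n.
  have [lo h] := ge_ex S w.
  have [|y hy] := cf_ex S' (F := win w lo) (i := lo + c).
    move=> n hn; rewrite /win big1 // => j _.
    by have := ltn_ord j; lia.
  exists y => lo' n h'; rewrite hy.
  transitivity (win w (Num.min lo lo') n); first by rewrite (@winE _ _ lo) //; lia.
  by apply: winE => //; lia.
exists (fun w => projT1 (cid (ex w))); split.
- move=> u w; case: cid => y1 h1; case: cid => y2 h2; case: cid => y3 h3 /=.
  have [a ha] := ge_ex S u; have [b hb] := ge_ex S w.
  have hab1 : ge S (Num.min a b) u by apply: (geW ha); lia.
  have hab2 : ge S (Num.min a b) w by apply: (geW hb); lia.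
  apply: (@cf_inj _ _ S') => n; rewrite cfD (h1 _ _ (geD hab1 hab2)) (h2 _ _ hab1).
  rewrite (h3 _ _ hab2) -big_split /=; apply: eq_bigr => j _.
  by rewrite cfD tD cfD.
- move=> i w hw; case: cid => y h /= n ni; rewrite (h _ _ hw) /win.
  by rewrite big1 // => j; have := ltn_ord j; lia.
- move=> l v; case: cid => y h /=; apply: (@cf_inj _ _ S') => n.
  rewrite (h _ _ (@ge_mono _ _ S l v)) /win; case: (ltP n (l + c)) => hn.
    rewrite [RHS]tf // big1 // => j; have := ltn_ord j; lia.
  have -> : absz (Num.max 0 (n - c - l + 1))%R = (absz (n - c - l)%R).+1 by lia.
  rewrite big_ord_recl addr0 cf_mono eqxx big1 ?addr0 // => j _.
  rewrite cf_mono ifF ?(morph0 (tD _)) ?cf0 // lift0; lia.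
Qed.
End Extension.

End Filtered.

(** * Triangular maps: inversion by successive approximation *)

Section Triangular.
Variables (W V : zmodType) (S : series W V) (W' V' : zmodType) (S' : series W' V').
Variable T : W -> W'.
Hypothesis TD : {morph T : u w / u + w}.

(* Successive approximation: the hypotheses say that T is triangular, with
   surjective diagonal part in degrees at least i0. *)
Lemma tri_surj (i0 : int) :
  (forall i w, i0 <= i -> ge S i w -> ge S' i (T w)) ->
  (forall i a, i0 <= i -> exists b, cf S' (T (mono S i b)) i = a) ->
  forall y, ge S' i0 y -> exists2 w, ge S i0 w & T w = y.
Proof.
move=> Tf Tg y hy.
have /choice[b hb] : forall ia : int * V',
    exists b, i0 <= ia.1 -> cf S' (T (mono S ia.1 b)) ia.1 = ia.2.
  move=> [i a]; case: (boolP (i0 <= i)) => [h|_]; first by have [b hb] := Tg i a h; exists b.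
  by exists 0.
have hb' i a (hi : i0 <= i) : cf S' (T (mono S i (b (i, a)))) i = a by apply: (hb (i, a)).
(* [rest j] is what is left of [y] after the images of the first j terms are subtracted; [co j] is
   the coefficient whose image kills its leading term. *)
pose co (j : nat) (z : W') := b (i0 + j%:Z, cf S' z (i0 + j%:Z)).
pose fix rest (j : nat) : W' :=
  if j is l.+1 then rest l - T (mono S (i0 + l%:Z) (co l (rest l))) else y.
have hrest j : ge S' (i0 + j%:Z) (rest j).
  elim: j => [|j IH] /=; first by rewrite addr0.
  have -> : i0 + j.+1%:Z = i0 + j%:Z + 1 by lia.
  apply: ge_step; first by apply: geB => //; apply: Tf; [lia|apply: ge_mono].
  by rewrite cfB /co hb' ?subrr //; lia.
have [w hw] : exists w, forall n, cf S w n =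
    if i0 <= n then co (absz (n - i0)%R) (rest (absz (n - i0)%R)) else 0.
  apply: (cf_ex S (F := fun n => if i0 <= n then
    co (absz (n - i0)%R) (rest (absz (n - i0)%R)) else 0) (i := i0)) => n ni.
  by rewrite ifF //; lia.
have hwi : ge S i0 w by move=> n ni; rewrite hw ifF //; lia.
exists w => //; apply/eqP; rewrite eq_sym -subr_eq0; apply/eqP.
(* Here [w'] is the tail of [w] from degree i0 + j on. Both [rest j] and [T w'] have order at least
   i0 + j, so y - T w has arbitrarily high order. *)
have part j : exists2 w', ge S (i0 + j%:Z) w' & y - T w = rest j - T w' /\
    forall n, i0 + j%:Z <= n -> cf S w' n = cf S w n.
  elim: j => [|j [w' h1 [h2 h3]]]; first by exists w; [rewrite addr0|].
  exists (w' - mono S (i0 + j%:Z) (cf S w' (i0 + j%:Z))).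
    by have -> : i0 + j.+1%:Z = i0 + j%:Z + 1 by [lia]; apply: ge_rest.
  split; last first.
    move=> n hn; rewrite cfB cf_mono ifF ?subr0; [apply: h3|]; lia.
  rewrite h2 (morphB TD) /= h3 // hw ifT; last by lia.
  have -> : absz (i0 + j%:Z - i0)%R = j by lia.
  by rewrite opprB addrA subrK.
apply: (@ge_all _ _ S') => N.
have [w' h1 [-> _]] := part (absz (N - i0)%R).
apply: (@geW _ _ S' _ (i0 + (absz (N - i0)%R)%:Z)); last lia.
by apply: geB => //; apply: Tf => //; lia.
Qed.

Hypothesis Tf : forall i w, ge S i w -> ge S' i (T w).
Variable B : int -> V -> V'.
Hypothesis TB : forall i w, ge S i w -> cf S' (T w) i = B i (cf S w i).

(** An injective diagonal part keeps the leading term alive, so [T] cannot raise the order. *)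
Lemma tri_ge : (forall i v, B i v = 0 -> v = 0) ->
  forall i w, ge S' i (T w) -> ge S i w.
Proof.
move=> Binj i w hT; have [j hj] := ge_ex S w.
have key (l : nat) : j + l%:Z <= i -> ge S (j + l%:Z) w.
  elim: l => [|l IH] hl; first by rewrite addr0.
  have -> : j + l.+1%:Z = j + l%:Z + 1 by lia.
  have hw : ge S (j + l%:Z) w by apply: IH; lia.
  by apply: ge_step => //; apply: (Binj (j + l%:Z)); rewrite -TB // hT //; lia.
have [ji|ij] := leP j i; last by apply: (geW hj); lia.
by have := key (absz (i - j)%R); have -> : j + (absz (i - j)%R)%:Z = i by [lia]; apply.
Qed.

Lemma tri_bij : (forall i v, B i v = 0 -> v = 0) -> (forall i a, exists b, B i b = a) ->
  bijective T.
Proof.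
move=> Binj Bsurj.
have inj : injective T.
  move=> u w uw; apply/eqP; rewrite -subr_eq0; apply/eqP; apply: (@ge_all _ _ S) => i.
  by apply: (tri_ge Binj); rewrite (morphB TD) uw subrr; apply: ge0.
have surj y : exists w, T w = y.
  have [i hi] := ge_ex S' y.
  have [|j a _|w _ <-] := tri_surj _ _ hi; last by exists w.
  - by move=> j w _; apply: Tf.
  - have [b hb] := Bsurj j a; exists b; rewrite TB; last exact: ge_mono.
    by rewrite cf_mono eqxx.
have /choice[g hg] := surj.
by exists g => // u; apply: inj.
Qed.
End Triangular.

(** * Laurent series and matrices of Laurent series *)

Section LaurentFacts.
Variable k : fieldType.
Local Notation K := (laurent k).
Implicit Types (f g : K).

Fact laurent_ex (F : int -> k) i :
  (forall n, n < i -> F n = 0) -> exists f : K, f =1 F.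
Proof. by move=> h; exists (Laurent (ex_intro _ i h)). Qed.

Definition LS : series K k :=
  Series (@laddE k) (@laurentP k) (@lcoef_bounded k) laurent_ex.

Lemma cfLS f n : cf LS f n = f n. Proof. by []. Qed.

Lemma ge_mul i j f g : ge LS i f -> ge LS j g -> ge LS (i + j) (f * g).
Proof.
move=> hf hg n nij; rewrite cfLS lmulE zsum0 // => l.
have [li|il] := ltP l i; first by rewrite (hf l li : f l = 0) mul0r.
by rewrite (hg _ _ : g (n - l) = 0) ?mulr0 //; lia.
Qed.

Lemma mul_lead i j f g : ge LS i f -> ge LS j g -> (f * g) (i + j) = f i * g j.
Proof.
move=> hf hg; rewrite lmulE (@zsum1 _ _ i) => [|l li].
  by congr (_ * g _); lia.
have [l_i|il] := ltP l i; first by rewrite (hf l l_i : f l = 0) mul0r.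
by rewrite (hg _ _ : g (i + j - l) = 0) ?mulr0 //; lia.
Qed.

Lemma has_order_ge f v : has_order f v -> ge LS v f.
Proof. by case. Qed.

Lemma lconst0 : lconst 0 = 0 :> K.
Proof. by apply: laurentP => n; rewrite lconstE; case: ifP. Qed.

Lemma lzeroE n : (0 : K) n = 0.
Proof. by []. Qed.

Lemma lconst_eq0 (c : k) : (lconst c == 0 :> K) = (c == 0).
Proof.
apply/eqP/eqP => [/(congr1 (fun f : K => f 0))|->]; last exact: lconst0.
by rewrite lconstE eqxx lzeroE.
Qed.

Lemma lconst_sum I (s : seq I) (F : I -> k) :
  lconst (\sum_(i <- s) F i) = \sum_(i <- s) lconst (F i).
Proof. by apply: (big_morph _ (@lconstD k)); rewrite lconst0. Qed.

Lemma lconstN (c : k) : lconst (- c) = - lconst c.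
Proof. by apply/eqP; rewrite -addr_eq0 -lconstD addNr lconst0. Qed.

Lemma lconst_nat n : lconst n%:R = n%:R :> K.
Proof. by elim: n => [|n IH]; rewrite ?lconst0 // -addn1 !natrD lconstD IH lconst1. Qed.

Lemma lconst_int n : lconst n%:~R = n%:~R :> K.
Proof. by case: n => n; rewrite ?NegzE ?mulrNz ?lconstN -!pmulrn lconst_nat. Qed.

Lemma ge_bool (b : bool) : ge LS 0 (b%:R : K).
Proof. by case: b; [exact/has_order_ge/has_order1|exact: ge0]. Qed.

Lemma lX_order : has_order (lX : K) 1.
Proof.
split; first by rewrite /= oner_neq0.
by move=> n n1 /=; rewrite lt_eqF.
Qed.

Lemma lX_neq0 : (lX : K) != 0.
Proof. exact: has_order_neq0 lX_order. Qed.

Lemma lmono_mulE i f n : (lmono k i * f) n = f (n - i).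
Proof.
rewrite lmulE (@zsum1 _ _ i) /= ?eqxx ?mul1r // => l /negbTE ->.
by rewrite mul0r.
Qed.

Lemma lXz (i : int) : lX ^ i = lmono k i.
Proof.
have pos (n : nat) : lX ^+ n = lmono k n.
  elim: n => [|n IH]; first by rewrite expr0.
  rewrite exprS IH; apply: laurentP => l; rewrite [LHS]lmono_mulE /=.
  by congr (_%:R); congr nat_of_bool; lia.
case: i => n; first exact: pos.
rewrite NegzE -exprnN pos; apply: (@mulfI _ (lmono k n.+1)).
  by rewrite -pos expf_neq0 ?lX_neq0.
rewrite mulfV -?pos ?expf_neq0 ?lX_neq0 // pos.
apply: laurentP => l; rewrite lmono_mulE loneE /=.
by congr (_%:R); congr nat_of_bool; lia.
Qed.

Lemma lXzE (i n : int) : (lX ^ i : K) n = (n == i)%:R.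
Proof. by rewrite lXz. Qed.

Lemma lX_mulE i f n : (lX ^ i * f) n = f (n - i).
Proof. by rewrite lXz lmono_mulE. Qed.

Lemma ge_lX i : ge LS i (lX ^ i : K).
Proof. by move=> n ni; rewrite lXz /= lt_eqF. Qed.

Lemma ge_lconst c : ge LS 0 (lconst c : K).
Proof. by move=> n n0; rewrite cfLS lconstE lt_eqF. Qed.

Lemma monoLS i (c : k) : mono LS i c = lconst c * lX ^ i.
Proof.
apply: laurentP => n; rewrite -[LHS]cfLS cf_mono lconst_mulE lXz /=.
by case: eqP; rewrite ?mulr1 ?mulr0.
Qed.

Lemma ge_mul0 i f g : ge LS 0 f -> ge LS i g -> ge LS i (f * g).
Proof. by move=> hf hg; have := ge_mul hf hg; rewrite add0r. Qed.

Lemma ge_const_mul i (c : k) f : ge LS i f -> ge LS i (lconst c * f).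
Proof. by apply: ge_mul0; apply: ge_lconst. Qed.

Lemma mono1 i : mono LS i 1 = lX ^ i :> K.
Proof. by rewrite monoLS lconst1 mul1r. Qed.

Lemma mono_const (c : k) : mono LS 0 c = lconst c.
Proof. by rewrite monoLS expr0z mulr1. Qed.

Lemma mono_mul i j (c d : k) : mono LS i c * mono LS j d = mono LS (i + j) (c * d).
Proof.
rewrite !monoLS lconstM expfzDr ?lX_neq0 //.
by move: (lX ^ i) (lX ^ j) => x y; ring.
Qed.

Lemma thetaE f n : theta f n = n%:~R * f n. Proof. by []. Qed.

Lemma ge_theta i f : ge LS i f -> ge LS i (theta f).
Proof. by move=> h n ni; rewrite cfLS thetaE (h n ni : f n = 0) mulr0. Qed.

Lemma theta0 : theta (0 : K) = 0.
Proof. exact: morph0 (@thetaD k). Qed.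

Lemma theta1 : theta (1 : K) = 0.
Proof. by rewrite -lconst1 theta_const. Qed.

Lemma thetaV f : f != 0 -> theta f^-1 = - (theta f / f ^+ 2).
Proof.
move=> f0; have := congr1 (@theta k) (mulfV f0).
rewrite thetaM theta1 => /eqP; rewrite addrC addr_eq0 => /eqP e.
by apply: (mulfI f0); rewrite e; field.
Qed.

Lemma thetaX f (i : int) : f != 0 -> theta (f ^ i) = i%:~R * f ^ i * (theta f / f).
Proof.
move=> f0.
have pos (n : nat) : theta (f ^+ n) = n%:R * f ^+ n * (theta f / f).
  elim: n => [|n IH]; first by rewrite expr0 theta1 !mul0r.
  by rewrite exprS thetaM IH -natr1; field.
case: i => n; first by rewrite pos pmulrn.
rewrite NegzE -exprnN thetaV ?expf_neq0 // pos mulrNz -pmulrn.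
have h : f ^+ n.+1 != 0 by rewrite expf_neq0.
by rewrite !mulNr; congr (- _); field; rewrite f0 -?exprS h.
Qed.

Lemma theta_lX i : theta (lX ^ i : K) = i%:~R * lX ^ i.
Proof.
apply: laurentP => n; rewrite thetaE -lconst_int lconst_mulE lXz /=.
by case: eqP => [->|]; rewrite ?mulr0.
Qed.

Lemma theta_mono i (c : k) : theta (mono LS i c) = mono LS i (c * i%:~R).
Proof.
apply: laurentP => n; rewrite thetaE -!cfLS !cf_mono.
by case: eqP => [->|]; rewrite ?mulr0 // mulrC.
Qed.

End LaurentFacts.
Arguments LS {k}.

Section MatrixSeries.
Variable k : fieldType.
Local Notation K := (laurent k).

Section OneSize.
Variables a b : nat.
Implicit Types w : 'M[K]_(a, b).

Definition mxcf w (n : int) : 'M[k]_(a, b) := map_mx (fun f : K => f n) w.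

Fact mxcfD u w n : mxcf (u + w) n = mxcf u n + mxcf w n.
Proof. by apply/matrixP => i j; rewrite !mxE. Qed.

Fact mxcf_inj u w : mxcf u =1 mxcf w -> u = w.
Proof.
move=> h; apply/matrixP => i j; apply: laurentP => n.
by have /matrixP/(_ i j) := h n; rewrite !mxE.
Qed.

Fact mxcf_bounded w : exists i, forall n, n < i -> mxcf w n = 0.
Proof.
have /choice[N hN] : forall ij : 'I_a * 'I_b, exists N : nat,
    forall n, w ij.1 ij.2 n != 0 -> - N%:Z <= n.
  by move=> ij; apply: lbound.
exists (- (\max_ij N ij)%N%:Z) => n hn; apply/matrixP => i j; rewrite !mxE.
apply/eqP; apply/negPn/negP => /(hN (i, j)) h.
have : (N (i, j) <= \max_ij N ij)%N by [apply: leq_bigmax]; lia.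
Qed.

Fact mxcf_ex (F : int -> 'M[k]_(a, b)) i :
  (forall n, n < i -> F n = 0) -> exists w, mxcf w =1 F.
Proof.
move=> h.
have hb p q : exists N : int, forall n, n < N -> F n p q = 0.
  by exists i => n /h ->; rewrite mxE.
exists (\matrix_(p, q) Laurent (hb p q)) => n.
by apply/matrixP => p q; rewrite !mxE.
Qed.

Definition MS : series 'M[K]_(a, b) 'M[k]_(a, b) :=
  Series mxcfD mxcf_inj mxcf_bounded mxcf_ex.

Lemma cfMS w n i j : cf MS w n i j = w i j n.
Proof. by rewrite mxE. Qed.

Lemma ge_mxP i w : ge MS i w <-> forall p q, ge LS i (w p q).
Proof.
split=> [h p q n ni|h n ni]; first by rewrite cfLS -cfMS h ?mxE.
by apply/matrixP => p q; rewrite cfMS mxE; apply: h.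
Qed.

Lemma ge_scale i j (f : K) w : ge LS i f -> ge MS j w -> ge MS (i + j) (f *: w).
Proof.
by move=> hf /ge_mxP hw; apply/ge_mxP => p q; rewrite mxE; apply: ge_mul.
Qed.

Lemma ge_scale0 i (f : K) w : ge LS 0 f -> ge MS i w -> ge MS i (f *: w).
Proof. by move=> hf hw; have := ge_scale hf hw; rewrite add0r. Qed.

Lemma cf_scale_lX i w n : cf MS (lX ^ i *: w) n = cf MS w (n - i).
Proof. by apply/matrixP => p q; rewrite !mxE lX_mulE. Qed.

Lemma cf_scale_const c w n : cf MS (lconst c *: w) n = c *: cf MS w n.
Proof. by apply/matrixP => p q; rewrite !mxE lconst_mulE. Qed.

Definition mtheta w := map_mx (@theta k) w.

Lemma mthetaD : {morph mtheta : u w / u + w}.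
Proof. by move=> u w; apply/matrixP => p q; rewrite !mxE thetaD. Qed.

Lemma mthetaZ f w : mtheta (f *: w) = theta f *: w + f *: mtheta w.
Proof. by apply/matrixP => p q; rewrite !mxE thetaM. Qed.

Lemma cf_mtheta w n : cf MS (mtheta w) n = n%:~R *: cf MS w n.
Proof. by apply/matrixP => p q; rewrite !mxE thetaE. Qed.

Lemma ge_mtheta i w : ge MS i w -> ge MS i (mtheta w).
Proof. by move=> h n ni; rewrite cf_mtheta h ?scaler0. Qed.

Definition cmx (A : 'M[k]_(a, b)) : 'M[K]_(a, b) := map_mx (@lconst k) A.

Lemma cf_cmx A n : cf MS (cmx A) n = if n == 0 then A else 0.
Proof. by apply/matrixP => p q; rewrite !mxE lconstE; case: eqP; rewrite ?mxE. Qed.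

Lemma cmxD : {morph cmx : A B / A + B}.
Proof. by move=> A B; apply/matrixP => p q; rewrite !mxE lconstD. Qed.

Lemma mtheta_cmx A : mtheta (cmx A) = 0.
Proof. by apply/matrixP => p q; rewrite !mxE theta_const. Qed.

Lemma ge_cmx A : ge MS 0 (cmx A).
Proof. by move=> n n0; rewrite cf_cmx lt_eqF. Qed.

Lemma monoMS i A : mono MS i A = lX ^ i *: cmx A.
Proof.
apply: (@cf_inj _ _ MS) => n; rewrite cf_mono cf_scale_lX cf_cmx subr_eq0.
by case: eqP.
Qed.

End OneSize.

Lemma mulmx_lead a b c i j (u : 'M[K]_(a, b)) (w : 'M[K]_(b, c)) :
  ge (MS a b) i u -> ge (MS b c) j w ->
  cf (MS a c) (u *m w) (i + j) = cf (MS a b) u i *m cf (MS b c) w j.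
Proof.
move=> /ge_mxP hu /ge_mxP hw; apply/matrixP => p q; rewrite cfMS !mxE.
rewrite -[LHS]cfLS cf_sum; apply: eq_bigr => l _.
by rewrite cfLS !mxE; apply: mul_lead.
Qed.

Lemma ge_mulmx a b c i j (u : 'M[K]_(a, b)) (w : 'M[K]_(b, c)) :
  ge (MS a b) i u -> ge (MS b c) j w -> ge (MS a c) (i + j) (u *m w).
Proof.
move=> /ge_mxP hu /ge_mxP hw; apply/ge_mxP => p q; rewrite mxE.
by apply: ge_sum => l _; apply: ge_mul.
Qed.

Lemma cf_mul_cmx a b c (u : 'M[K]_(a, b)) (A : 'M[k]_(b, c)) n :
  cf (MS a c) (u *m cmx A) n = cf (MS a b) u n *m A.
Proof.
apply/matrixP => p q; rewrite cfMS !mxE -[LHS]cfLS cf_sum.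
by apply: eq_bigr => l _; rewrite cfLS !mxE mulrC lconst_mulE mulrC.
Qed.

Lemma cf_cmx_mul a b c (A : 'M[k]_(a, b)) (u : 'M[K]_(b, c)) n :
  cf (MS a c) (cmx A *m u) n = A *m cf (MS b c) u n.
Proof.
apply/matrixP => p q; rewrite cfMS !mxE -[LHS]cfLS cf_sum.
by apply: eq_bigr => l _; rewrite cfLS !mxE lconst_mulE.
Qed.

Lemma mtheta_mul a b c (u : 'M[K]_(a, b)) (w : 'M[K]_(b, c)) :
  mtheta (u *m w) = mtheta u *m w + u *m mtheta w.
Proof. exact: theta_mx_mul. Qed.

Lemma cmxM a b c (A : 'M[k]_(a, b)) (B : 'M[k]_(b, c)) :
  cmx (A *m B) = cmx A *m cmx B.
Proof.
apply/matrixP => p q; rewrite !mxE lconst_sum.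
by apply: eq_bigr => l _; rewrite !mxE lconstM.
Qed.

Lemma cmx1 n : cmx (1%:M : 'M[k]_n) = 1%:M.
Proof.
by apply/matrixP => p q; rewrite !mxE; case: (p == q); rewrite ?lconst1 ?lconst0.
Qed.

End MatrixSeries.

(* Simplification must not unfold the arithmetic of series. *)
Local Opaque lzero lopp ladd lmul lmono lconst lX linv theta lcomp expand rpart ljoin.

(** * Substitution *)

Section Composition.
Variable k : fieldType.
Local Notation K := (laurent k).

Section Inner.
Variable phi : K.
Hypothesis phi1 : has_order phi 1.
Implicit Types f g : K.

Let phi0 : phi != 0. Proof. exact: has_order_neq0 phi1. Qed.

Lemma phiX_order i : has_order (phi ^ i) i.
Proof. by have := has_orderX i phi1; rewrite mulr1. Qed.

Lemma lcomp_zsum f n : lcomp f phi n = zsum (fun i => f i * (phi ^ i) n).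
Proof. exact: (lcompE f n phi1). Qed.

Let lcomp_bound f i n : ge LS i f ->
  zbound (absz i + absz n)%N (fun l => f l * (phi ^ l) n).
Proof.
move=> h l; have [li|il] := ltP l i.
  by rewrite (h l li : f l = 0) mul0r eqxx.
have [nl|ln] := ltP n l; last lia.
by rewrite (has_order_ge (phiX_order l) nl : (phi ^ l) n = 0) mulr0 eqxx.
Qed.

Lemma lcompD : {morph (lcomp (k := k))^~ phi : f g / f + g}.
Proof.
move=> f g; apply: laurentP => n; rewrite laddE !lcomp_zsum.
have [i hi] := ge_ex LS f; have [j hj] := ge_ex LS g.
rewrite -(@zsumD _ (absz i + absz j + absz n)%N).
- by apply: eq_zsum => l; rewrite laddE mulrDl.
- by apply: (zboundW _ (lcomp_bound hi)); lia.
- by apply: (zboundW _ (lcomp_bound hj)); lia.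
Qed.

Lemma ge_lcomp i f : ge LS i f -> ge LS i (lcomp f phi).
Proof.
move=> h n ni; rewrite cfLS lcomp_zsum zsum0 // => l.
have [li|il] := ltP l i; first by rewrite (h l li : f l = 0) mul0r.
rewrite (has_order_ge (phiX_order l) _ : (phi ^ l) n = 0) ?mulr0 //.
exact: lt_le_trans ni il.
Qed.

Lemma filt_lcomp : filt LS LS 0 ((lcomp (k := k))^~ phi).
Proof. by move=> i f /ge_lcomp; rewrite addr0. Qed.

Lemma lcomp_lead i f : ge LS i f -> lcomp f phi i = f i * (phi ^ i) i.
Proof.
move=> h; rewrite lcomp_zsum (@zsum1 _ _ i) // => l.
case: ltgtP => // [li|il] _; first by rewrite (h l li : f l = 0) mul0r.
by rewrite (has_order_ge (phiX_order l) il : (phi ^ l) i = 0) mulr0.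
Qed.

Lemma lcomp_mono c i : lcomp (mono LS i c) phi = lconst c * phi ^ i.
Proof.
have e l : (mono LS i c : K) l = if l == i then c else 0 by apply: (cf_mono LS i c l).
apply: laurentP => n; rewrite lcomp_zsum (@zsum1 _ _ i).
  by rewrite e eqxx (lconst_mulE c).
by move=> l /negbTE h; rewrite e h mul0r.
Qed.

Lemma lcomp_lXz i : lcomp (lX ^ i) phi = phi ^ i.
Proof. by rewrite -mono1 lcomp_mono lconst1 mul1r. Qed.

Lemma lcomp_const c : lcomp (lconst c) phi = lconst c.
Proof. by rewrite -mono_const lcomp_mono expr0z mulr1 mono_const. Qed.

Lemma lcomp1 : lcomp 1 phi = 1.
Proof. by rewrite -lconst1 lcomp_const. Qed.

Lemma lcompN f : lcomp (- f) phi = - lcomp f phi.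
Proof. exact: (morphN lcompD). Qed.

Lemma lcomp0 : lcomp 0 phi = 0.
Proof. exact: (morph0 lcompD). Qed.

(** Both sides are additive and filtered in each factor, so two density arguments reduce to
    monomials, where the claim is phi^(i + l) = phi^i phi^l. *)
Lemma lcompM : {morph (lcomp (k := k))^~ phi : f g / f * g}.
Proof.
move=> f g; have [j hj] := ge_ex LS g.
apply: (@dense_eq _ _ LS _ _ LS j j (fun f => lcomp (f * g) phi)
  (fun f => lcomp f phi * lcomp g phi)) => [u w|u w|i w hw|i w hw|i c] {f}.
- by rewrite mulrDl lcompD.
- by rewrite lcompD mulrDl.
- exact/ge_lcomp/ge_mul.
- exact: ge_mul (ge_lcomp hw) (ge_lcomp hj).
have hc : ge LS i (mono LS i c) := @ge_mono _ _ LS i c.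
apply: (@dense_eq _ _ LS _ _ LS i i (fun g => lcomp (mono LS i c * g) phi)
  (fun g => lcomp (mono LS i c) phi * lcomp g phi)) => [u w|u w|l w hw|l w hw|l d] {j g hj}.
- by rewrite mulrDr lcompD.
- by rewrite lcompD mulrDr.
- by rewrite addrC; apply/ge_lcomp/ge_mul.
- by rewrite addrC; apply: ge_mul (ge_lcomp hc) (ge_lcomp hw).
rewrite mono_mul !lcomp_mono lconstM expfzDr //.
by move: (phi ^ i) (phi ^ l) => x y; ring.
Qed.

Lemma lcomp_inj : injective ((lcomp (k := k))^~ phi).
Proof.
move=> f g e; apply/eqP; rewrite -subr_eq0; apply/eqP; apply: contrapT => /eqP.
move=> /order_exists[v [v0 hv]]; move: v0; rewrite -[_ v](mulfK (x := (phi ^ v) v)).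
  rewrite -lcomp_lead // (morphB lcompD) e subrr.
  by rewrite (_ : (0 : K) v = 0) // mul0r eqxx.
by case: (phiX_order v).
Qed.

Lemma lcomp_eq0 f : lcomp f phi = 0 -> f = 0.
Proof. by rewrite -{1}lcomp0 => /lcomp_inj. Qed.

Lemma lcomp_surj g : exists f, lcomp f phi = g.
Proof.
have [i hi] := ge_ex LS g.
have [|j a _|f _ <-] := @tri_surj _ _ LS _ _ LS _ lcompD i _ _ g hi; last by exists f.
- by move=> j w _; apply: ge_lcomp.
- exists (a / (phi ^ j) j); rewrite cfLS lcomp_lead; last exact: ge_mono.
  rewrite -cfLS cf_mono eqxx mulfVK //.
  by case: (phiX_order j).
Qed.

Lemma lcompV f : lcomp f^-1 phi = (lcomp f phi)^-1.
Proof.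
have [->|f0] := eqVneq f 0; first by rewrite invr0 lcomp0 invr0.
have g0 : lcomp f phi != 0 by apply: contraNneq f0 => /lcomp_eq0 ->.
by apply: (mulfI g0); rewrite -lcompM !mulfV // lcomp1.
Qed.

Lemma theta_lcomp f :
  theta (lcomp f phi) = lcomp (theta f) phi * (theta phi / phi).
Proof.
have ht : ge LS (0 : int) (theta phi / phi).
  have -> : (0 : int) = 1 + -1 by [].
  apply: ge_mul; first exact/ge_theta/has_order_ge/phi1.
  exact/has_order_ge/(has_orderV phi1).
apply: (@dense_eq _ _ LS _ _ LS 0 0 (fun f => theta (lcomp f phi))
  (fun f => lcomp (theta f) phi * (theta phi / phi))) => [u w|u w|i w hw|i w hw|i c].
- by rewrite lcompD thetaD.
- by rewrite thetaD lcompD mulrDl.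
- by rewrite addr0; apply/ge_theta/ge_lcomp.
- by apply: ge_mul => //; apply/ge_lcomp/ge_theta.
rewrite theta_mono !lcomp_mono thetaM theta_const mul0r add0r thetaX //.
by rewrite lconstM lconst_int; move: (phi ^ i) (theta phi / phi) => x y; ring.
Qed.

End Inner.

Lemma lcomp_id (f : K) : lcomp f lX = f.
Proof.
have h := lX_order k.
apply: (@dense_eq _ _ LS _ _ LS 0 0 ((lcomp (k := k))^~ lX) id) => //.
- exact: lcompD.
- exact: filt_lcomp.
- by move=> i w; rewrite addr0.
- by move=> i c; rewrite (lcomp_mono h) monoLS.
Qed.

Lemma lcomp_order (f phi : K) : has_order phi 1 -> has_order f 1 -> has_order (lcomp f phi) 1.
Proof.
move=> hp [f0 hf]; split; last exact: (ge_lcomp hp hf).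
by rewrite lcomp_lead // mulf_neq0 //; case: (phiX_order hp 1).
Qed.

Lemma lcompX (f phi : K) i : has_order phi 1 -> lcomp (f ^ i) phi = lcomp f phi ^ i.
Proof.
move=> h; have pos (n : nat) : lcomp (f ^+ n) phi = lcomp f phi ^+ n.
  by elim: n => [|j IH]; rewrite ?lcomp1 // !exprS lcompM // IH.
by case: i => n; rewrite ?NegzE -?exprnN ?lcompV // -?exprnP pos.
Qed.

Lemma lcompA (f phi psi : K) : has_order phi 1 -> has_order psi 1 ->
  lcomp (lcomp f phi) psi = lcomp f (lcomp phi psi).
Proof.
move=> h1 h2; have h3 := lcomp_order h2 h1.
apply: (@dense_eq _ _ LS _ _ LS 0 0 (fun f => lcomp (lcomp f phi) psi)
   (fun f => lcomp f (lcomp phi psi))) => [u w|u w|i w hw|i w hw|i c].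
- by rewrite !lcompD.
- by rewrite !lcompD.
- by rewrite addr0; do 2!apply: ge_lcomp => //.
- by rewrite addr0; apply: ge_lcomp.
rewrite (lcomp_mono h1) (lcomp_mono h3) (lcompM h2) (lcomp_const h2).
by rewrite (lcompX _ _ h2).
Qed.

End Composition.

(** * Logarithmic derivatives and the critical point *)

Section CharZero.
Variables (k : fieldType) (k0 : [pchar k] =i pred0).
Local Notation K := (laurent k).

Lemma natr_neq0 n : (n != 0)%N -> n%:R != 0 :> k.
Proof. by have /pcharf0P -> := k0. Qed.

Lemma intr_eq0_char (i : int) : (i%:~R == 0 :> k) = (i == 0).
Proof.
have /pcharf0P h := k0; case: i => n; first by rewrite -pmulrn h.
by rewrite NegzE mulrNz oppr_eq0 -pmulrn h oppr_eq0.
Qed.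

Lemma has_order_theta (f : K) v : v != 0 -> has_order f v -> has_order (theta f) v.
Proof.
move=> v0 [fv hg]; split; last exact: ge_theta.
by rewrite thetaE mulf_neq0 // intr_eq0_char.
Qed.

Lemma has_order_const_mul (c : k) (f : K) v :
  c != 0 -> has_order f v -> has_order (lconst c * f) v.
Proof.
move=> c0 [fv hg]; split; last exact: ge_const_mul.
by rewrite (lconst_mulE c) mulf_neq0.
Qed.

Lemma has_order_lX (i : int) : has_order (lX ^ i : K) i.
Proof. by have := has_orderX i (lX_order k); rewrite mulr1. Qed.

Lemma theta_eq0 (f : K) : theta f = 0 -> f = lconst (f 0).
Proof.
move=> h; apply: laurentP => n; rewrite lconstE; case: eqP => [->//|/eqP n0].
have := congr1 (fun g : K => g n) h; rewrite /= => /eqP.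
by rewrite mulf_eq0 intr_eq0_char (negbTE n0) => /eqP.
Qed.

(* G is (exp \int lam dX/X) to the power A. *)
Lemma gauge_const n (A : 'M[k]_n) (lam : K) : ge LS 1 lam ->
  exists G : 'M[K]_n, [/\ ge (MS k n n) 0 G, cf (MS k n n) G 0 = 1%:M,
    mtheta G = lam *: (cmx A *m G) & cmx A *m G = G *m cmx A].
Proof.
move=> hlam; pose S := MS k n n.
(* Since theta kills constants, the differential equation alone is singular in degree 0. Adding the
   constant term makes [T] bijective, and T G = 1 encodes both the equation and the normalisation
   G_0 = 1. *)
pose T (G : 'M[K]_n) := mtheta G - lam *: (cmx A *m G) + cmx (cf S G 0).
pose B (i : int) (v : 'M[k]_n) : 'M[k]_n := if i == 0 then v else i%:~R *: v.
have TD : {morph T : u w / u + w}.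
  move=> u w; rewrite /T mthetaD mulmxDr scalerDr cfD cmxD opprD.
  by rewrite [RHS]addrACA; congr (_ + _); rewrite addrACA.
have h1 i w : ge S i w -> ge S (i + 1) (lam *: (cmx A *m w)).
  move=> h; rewrite addrC; apply: ge_scale => //; rewrite -[i]add0r.
  by apply: ge_mulmx => //; apply: ge_cmx.
have h2 i w : ge S i w -> forall l, l <= i ->
    cf S (cmx (cf S w 0)) l = if l == 0 then cf S w l else 0.
  by move=> h l li; rewrite cf_cmx; case: eqP => [->|].
have Tf i w : ge S i w -> ge S i (T w).
  move=> h; apply: geD; first apply: geB; first exact: ge_mtheta.
    by apply: (geW (h1 _ _ h)); lia.
  by move=> l li; rewrite (h2 i w) // ?ltW //; case: eqP => // _; rewrite h.
have TB i w : ge S i w -> cf S (T w) i = B i (cf S w i).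
  move=> h; rewrite cfD cfB (h2 i w) // cf_mtheta (h1 _ _ h); last lia.
  rewrite subr0 /B; case: eqP => [->|]; last by rewrite addr0.
  by rewrite scale0r add0r.
have Binj i v : B i v = 0 -> v = 0.
  rewrite /B; case: eqP => // /eqP i0 /eqP; rewrite scaler_eq0 intr_eq0_char.
  by rewrite (negbTE i0) => /eqP.
have Bsurj i v : exists b, B i b = v.
  rewrite /B; case: eqP => [|/eqP i0]; first by exists v.
  by exists (i%:~R^-1 *: v); rewrite scalerA mulfV ?scale1r // intr_eq0_char.
have [T' T'K TK] := tri_bij TD Tf TB Binj Bsurj.
pose G := T' (cmx 1%:M); have TG : T G = cmx 1%:M by rewrite /G TK.
have G_ge : ge S 0 G by apply: (tri_ge TB Binj); rewrite TG; apply: ge_cmx.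
have G0 : cf S G 0 = 1%:M.
  have : cf S (T G) 0 = 1%:M by rewrite TG cf_cmx eqxx.
  by rewrite TB // /B eqxx.
exists G; split=> //.
  by move/eqP: TG; rewrite /T G0 -subr_eq0 addrK subr_eq0 => /eqP.
(* A G and G A are both mapped to A by [T], which is injective. *)
apply: (can_inj T'K); transitivity (cmx A).
  transitivity (cmx A *m T G); last by rewrite TG cmx1 mulmx1.
  rewrite /T mulmxDr mulmxBr mtheta_mul mtheta_cmx mul0mx add0r -scalemxAr.
  by rewrite cf_cmx_mul -cmxM.
transitivity (T G *m cmx A); first by rewrite TG cmx1 mul1mx.
rewrite /T mulmxDl mulmxBl mtheta_mul mtheta_cmx mulmx0 addr0 -scalemxAl.
by rewrite mulmxA cf_mul_cmx -cmxM.
Qed.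

Lemma solve_log_deriv (lam : K) : ge LS 1 lam ->
  exists u : K, has_order u 0 /\ theta u = lam * u.
Proof.
move=> hl; have [G [/ge_mxP hG G0 G1 _]] := gauge_const (1%:M : 'M_1) hl.
exists (G 0 0); split.
  split; last exact: hG.
  by have := congr1 (fun M : 'M_1 => M 0 0) G0; rewrite !mxE => ->; rewrite oner_neq0.
have := congr1 (fun M : 'M_1 => M 0 0) G1.
by rewrite cmx1 mul1mx !mxE.
Qed.

Lemma theta_lead (f : K) v : has_order f v ->
  ge LS 0 (theta f / f) /\ (theta f / f) 0 = v%:~R.
Proof.
move=> hf; have f0 := has_order_neq0 hf.
have hV := has_order_ge (has_orderV hf); have [fv hge] := hf.
have e : v - v = 0 by rewrite subrr.
split; first by rewrite -e; apply: ge_mul => //; apply: ge_theta.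
rewrite -e (mul_lead (ge_theta hge) hV) thetaE -mulrA -(mul_lead hge hV).
by rewrite mulfV // e loneE mulr1.
Qed.

End CharZero.

Section Saddle.
Variables (k : closedFieldType) (k0 : [pchar k] =i pred0).
Local Notation K := (laurent k).

(* A root q solves the linear equation theta q = - (theta p / (m p)) q, and this
   determines q ^ (- m) up to a constant factor. *)
Lemma exists_root (m : nat) (p : K) : (0 < m)%N -> has_order p (- m%:Z) ->
  exists q, has_order q 1 /\ q ^ (- m%:Z) = p.
Proof.
move=> m0 hp; have p0 := has_order_neq0 hp.
have mk : m%:R != 0 :> k by apply: natr_neq0 => //; lia.
have mK : m%:R != 0 :> K by rewrite -lconst_nat lconst_eq0.
have [h1 h2] := theta_lead hp.
(* Writing q = X u, the equation for q becomes theta u = lam u; the constant term of lam is 0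
   because p has order -m. *)
pose lam : K := lconst (- m%:R^-1) * (theta p / p) - 1.
have hlam : ge LS 1 lam.
  apply: (@ge_step _ _ LS 0).
    apply: geB; last exact/has_order_ge/has_order1.
    by rewrite -[0]addr0; apply: ge_mul => //; apply: ge_lconst.
  rewrite cfB !cfLS lconst_mulE h2 loneE eqxx mulrNz mulrNN -pmulrn mulVf //.
  by rewrite subrr.
have [u [u0 hu]] := solve_log_deriv k0 hlam.
have hq : has_order (lX * u) 1.
  by have := has_orderM (lX_order k) u0; rewrite addr0.
set q := lX * u in hq; have q0 := has_order_neq0 hq.
have un0 : u != 0 := has_order_neq0 u0.
have tq : theta q = - m%:R^-1 * (theta p / p) * q.
  rewrite /q thetaM hu (_ : theta lX = lX); last first.
    by have := theta_lX k 1; rewrite expr1z mul1r.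
  rewrite /lam lconstN (_ : lconst m%:R^-1 = m%:R^-1); first by ring.
  by apply: (mulfI mK); rewrite -{1}lconst_nat -lconstM !mulfV // lconst1.
have tc : theta (q ^ (- m%:Z) / p) = 0.
  rewrite thetaM thetaX // thetaV // tq mulrNz -pmulrn.
  by field; rewrite p0 q0 mK.
have [c [c0 hc]] : exists c, c != 0 /\ q ^ (- m%:Z) = lconst c * p.
  have e := theta_eq0 k0 tc; set c := (_ : K) 0 in e; exists c; split.
    apply/eqP => c0; move/eqP: e; rewrite c0 lconst0 mulf_eq0 invr_eq0 (negbTE p0).
    by rewrite orbF expfz_eq0 (negbTE q0) andbF.
  by rewrite -e mulfVK.
(* An m-th root d of c, so that replacing q by d q absorbs the constant. *)
have [d hd] := @solve_monicpoly k m (fun i => if i is 0%N then c else 0) m0.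
have {}hd : d ^+ m = c.
  rewrite hd; case: (m) m0 => // l _; rewrite big_ord_recl big1 ?addr0 ?mulr1 //.
  by move=> i _; rewrite mul0r.
have d0 : d != 0 by apply: contraNneq c0 => e; rewrite -hd e expr0n; case: (m) m0.
exists (lconst d * q); split; first exact: has_order_const_mul.
rewrite expfzMl hc -exprnN.
have -> : lconst c = lconst d ^+ m.
  by rewrite -hd; elim: (m) => [|l IH]; rewrite ?lconst1 // !exprS lconstM IH.
by rewrite mulrA mulVf ?mul1r // expf_neq0 // lconst_eq0.
Qed.

(** Take for phi the compositional inverse of a root q with q^(-m) = p: after substituting q, both
    sides become p. *)
Lemma exists_saddle (m : nat) (p : K) : (0 < m)%N -> has_order p (- m%:Z) ->
  exists phi, has_order phi 1 /\ lcomp p phi = lX ^ (- m%:Z).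
Proof.
move=> m0 hp; have [q [hq qp]] := exists_root m0 hp.
have [phi hphi] := lcomp_surj hq lX.
have o : has_order phi 1.
  have phi0 : phi != 0.
    by apply: contraNneq (lX_neq0 k) => e; rewrite -hphi e lcomp0.
  have [v [v0 hv]] := order_exists phi0.
  have hl : has_order (lX : K) v.
    rewrite -hphi; split; last exact: (ge_lcomp hq hv).
    by rewrite lcomp_lead // mulf_neq0 //; case: (phiX_order hq v).
  by rewrite (has_order_uniq (lX_order k) hl).
exists phi; split=> //; apply: (lcomp_inj hq).
by rewrite (lcompA p o hq) hphi (lcomp_id p) (lcomp_lXz hq).
Qed.

End Saddle.

(** * Difference equations *)

(** Course-of-values recursion; the default [x0] only fills positions that [F n] does not read. *)
Lemma strong_rec (A : Type) (x0 : A) (F : nat -> (nat -> A) -> A) :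
  (forall n f g, (forall i, (i < n)%N -> f i = g i) -> F n f = F n g) ->
  exists f, forall n, f n = F n f.
Proof.
move=> FE; pose fix s n := if n is m.+1 then rcons (s m) (F m (nth x0 (s m))) else [::].
have ss n : size (s n) = n by elim: n => //= n IH; rewrite size_rcons IH.
have sE n i : (i < n)%N -> nth x0 (s n) i = nth x0 (s i.+1) i.
  elim: n => // n IH; rewrite ltnS leq_eqVlt => /predU1P[->//|lt_in].
  by rewrite -(IH lt_in) /= nth_rcons ss lt_in.
exists (fun n => nth x0 (s n.+1) n) => n.
rewrite /= nth_rcons ss ltnn eqxx; apply: FE => i lt_in.
by rewrite sE.
Qed.

Section Difference.
Variables (k : fieldType) (k0 : [pchar k] =i pred0).
Implicit Types p q : {poly k}.

(** The integers are infinitely many roots of p - q. This turns operator identities, tested at the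
    exponents of monomials, into polynomial identities. *)
Lemma poly_int_eq p q : (forall n : int, p.[n%:~R] = q.[n%:~R]) -> p = q.
Proof.
move=> h; apply/eqP; rewrite -subr_eq0; apply/negPn/negP => pq0.
pose rs : seq k := [seq i%:R | i <- iota 0 (size (p - q))].
suff: (size rs < size (p - q)%R)%N by rewrite size_map size_iota ltnn.
apply: max_poly_roots => //.
  apply/allP => x /mapP[i _ ->]; rewrite rootE !hornerE.
  by have := h i; rewrite -pmulrn => ->; rewrite subrr.
rewrite map_inj_uniq ?iota_uniq // => i j /eqP; rewrite -subr_eq0.
by rewrite !pmulrn -rmorphB /= intr_eq0_char // subr_eq0 => /eqP[].
Qed.

Lemma expr_Xadd n (c : k) : exists2 h : {poly k}, (size h <= n)%N &
  ('X + c%:P) ^+ n.+1 = 'X^(n.+1) + (n.+1%:R * c) *: 'X^n + h.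
Proof.
elim: n => [|n [h hs IH]].
  by exists 0; rewrite ?size_poly0 // !expr1 expr0 mul1r addr0 alg_polyC.
exists (h * 'X + (n.+1%:R * c * c) *: 'X^n + c *: h).
  rewrite (leq_trans (size_polyD _ _)) // geq_max (leq_trans (size_scale_leq _ _)) ?andbT.
    rewrite (leq_trans (size_polyD _ _)) // geq_max.
    rewrite (leq_trans (size_scale_leq _ _)) ?size_polyXn // andbT.
    have [->|h0] := eqVneq h 0; first by rewrite mul0r size_poly0.
    by rewrite size_mulX.
  exact: leqW.
rewrite exprSr IH -[in RHS]natr1 -!mul_polyC !(polyCD, polyCM) !exprSr.
ring.
Qed.

(** The difference operator lowers the degree by one and multiplies the leading coefficient of a
    polynomial of degree N + 1 by -(N + 1) d, which is nonzero in characteristic zero: induction on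
    the size. Its kernel contains the constants, which allows the normalisation at 0. *)
Lemma diff_solve (d : k) f : d != 0 ->
  exists g, g \Po ('X - d%:P) - g = f /\ g.[0] = 0.
Proof.
move=> d0.
have key N : forall p, (size p <= N)%N -> exists g, g \Po ('X - d%:P) - g = p.
  elim: N => [|N IH] p.
    by rewrite leqn0 size_poly_eq0 => /eqP ->; exists 0; rewrite comp_poly0 subr0.
  move=> hp; pose b := - (N.+1%:R * d)^-1 * p`_N.
  have [h hs he] := expr_Xadd N (- d).
  have hb : b * (N.+1%:R * - d) = p`_N.
    by rewrite /b; field; rewrite d0 addrC natr1 natr_neq0.
  have [|g hg] := IH (p - ((b *: 'X^(N.+1)) \Po ('X - d%:P) - b *: 'X^(N.+1))).
    rewrite comp_polyZ comp_Xn_poly -polyCN he; apply/leq_sizeP => j.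
    rewrite leq_eqVlt => /predU1P[<-|Nj].
      rewrite !(coefN, coefD, coefZ, coefXn) eqxx (nth_default _ hs).
      rewrite (_ : (N == N.+1) = false) ?mulr0 ?mulr1 ?add0r ?addr0 ?hb; last lia.
      by rewrite subr0 subrr.
    rewrite !(coefN, coefD, coefZ, coefXn).
    rewrite (nth_default _ (leq_trans hp Nj)) (nth_default _ (leq_trans hs (ltnW Nj))).
    rewrite (_ : (j == N) = false); last by apply/negbTE; rewrite neq_ltn Nj orbT.
    by rewrite mulr0 !addr0 subrr oppr0 add0r.
  exists (g + b *: 'X^(N.+1)); rewrite comp_polyD opprD addrACA hg.
  by rewrite subrK.
have [g hg] := key _ _ (leqnn (size f)); exists (g - g.[0]%:P).
by split; rewrite ?hornerE ?hornerC ?subrr // comp_polyB comp_polyC opprB addrA subrK.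
Qed.

(** In characteristic zero the progression of the points - n d is infinite, so p takes the value
    p(0) infinitely often. *)
Lemma periodic_const (d : k) p : d != 0 ->
  (forall n : nat, p.[- (n.+1%:R * d)] = p.[- (n%:R * d)]) -> p = (p.[0])%:P.
Proof.
move=> d0 h; have h0 n : p.[- (n%:R * d)] = p.[0].
  by elim: n => [|n IH]; rewrite ?mul0r ?oppr0 // h.
have e : p \Po (- d *: 'X) = (p.[0])%:P.
  apply/eqP; rewrite -subr_eq0; apply/negPn/negP => pq0.
  pose q := p \Po (- d *: 'X) - (p.[0])%:P.
  pose rs : seq k := [seq i%:R | i <- iota 0 (size q)].
  suff: (size rs < size q)%N by rewrite size_map size_iota ltnn.
  apply: max_poly_roots => //.
    apply/allP => x /mapP[i _ ->]; rewrite rootE /q !hornerE horner_comp !hornerE.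
    by rewrite mulNr [d * _]mulrC h0 subrr.
  rewrite map_inj_uniq ?iota_uniq // => i j /eqP; rewrite -subr_eq0.
  by rewrite !pmulrn -rmorphB /= intr_eq0_char // subr_eq0 => /eqP[].
have := congr1 (fun q => q \Po ((- d)^-1 *: 'X)) e.
rewrite comp_polyC -comp_polyA comp_polyZ comp_polyX scalerA mulfV ?oppr_eq0 //.
by rewrite scale1r comp_polyXr.
Qed.

End Difference.

(** * Differential operators of infinite order *)

Section Operators.
Variable k : fieldType.
Local Notation K := (laurent k).

Lemma serLS l (F : nat -> k) (n : nat) : (ser LS l F : K) (l + n%:Z) = F n.
Proof. exact: (cf_ser LS l F n). Qed.

Lemma monoLSE l (v : k) n : (mono LS l v : K) n = if n == l then v else 0.
Proof. exact: (cf_mono LS l v n). Qed.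

Lemma cf_mul_mono (g : K) l v n : (g * mono LS l v) n = g (n - l) * v.
Proof.
by rewrite monoLS mulrC -mulrA (lconst_mulE v) (lX_mulE l) mulrC.
Qed.

Lemma mono_lX i l (v : k) : lX ^ i * mono LS l v = mono LS (i + l) v.
Proof. by rewrite -mono1 mono_mul mul1r. Qed.

Lemma lconst_mono c l (v : k) : lconst c * mono LS l v = mono LS l (c * v).
Proof. by rewrite -mono_const mono_mul add0r. Qed.

Lemma mulD_l (g : K) : {morph *%R g : u w / u + w}.
Proof. by move=> u w; rewrite mulrDr. Qed.

Lemma filt_mul j (g : K) : ge LS j g -> filt LS LS j ( *%R g).
Proof. by move=> hg i w hw; rewrite addrC; apply: ge_mul. Qed.

Lemma mul_conv i j (f g : K) (n : nat) : ge LS i f -> ge LS j g ->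
  (g * f) (i + j + n%:Z) = \sum_(a < n.+1) g (j + (n - a)%N%:Z) * f (i + a%:Z).
Proof.
move=> hf hg; rewrite -[LHS]cfLS.
rewrite (@cf_ext _ _ LS _ _ LS j _ (mulD_l g) (filt_mul hg) i f n hf).
apply: eq_bigr => a _; rewrite [LHS]cfLS cf_mul_mono; congr (g _ * _).
by have := ltn_ord a; lia.
Qed.

(* T = \sum_i X^i c_i(theta). *)
Definition is_op (c : nat -> {poly k}) (T : K -> K) :=
  [/\ {morph T : u w / u + w}, filt LS LS 0 T &
    forall l v, T (mono LS l v) = ser LS l (fun i => v * (c i).[l%:~R])].

Lemma op_ex c : exists T, is_op c T.
Proof.
have [||T [TD Tf TE]] := @extension _ _ LS _ _ LS 0
  (fun l v => ser LS l (fun i => v * (c i).[l%:~R])).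
- move=> l u w; apply: (@ge_eq _ _ LS l); first exact: ge_ser.
    by apply: geD; apply: ge_ser.
  by move=> n; rewrite cfD !cf_ser mulrDl.
- by move=> l v; rewrite addr0; apply: ge_ser.
by exists T.
Qed.

Lemma op_cf c T l w (n : nat) : is_op c T -> ge LS l w ->
  (T w) (l + n%:Z) = \sum_(a < n.+1) w (l + a%:Z) * (c (n - a)%N).[(l + a%:Z)%:~R].
Proof.
move=> [TD Tf TE] hw; have e := @cf_ext _ _ LS _ _ LS 0 _ TD Tf l w n hw.
rewrite addr0 in e; rewrite -[LHS]cfLS e; apply: eq_bigr => a _; rewrite TE.
have -> : l + n%:Z = l + a%:Z + (n - a)%N%:Z by have := ltn_ord a; lia.
by rewrite cf_ser.
Qed.

Lemma op_const c T a w : is_op c T -> T (lconst a * w) = lconst a * T w.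
Proof.
move=> [TD Tf TE].
apply: (@dense_eq _ _ LS _ _ LS 0 0 (fun w => T (lconst a * w))
  (fun w => lconst a * T w)) => {w} [u w|u w|i w hw|i w hw|l v].
- by rewrite mulrDr TD.
- by rewrite TD mulrDr.
- by apply: Tf; apply: ge_const_mul.
- by apply: ge_const_mul; apply: Tf.
rewrite lconst_mono !TE; apply: (@ge_eq _ _ LS l); first exact: ge_ser.
  by apply/ge_const_mul/ge_ser.
by move=> n; rewrite cf_ser cfLS (lconst_mulE a) serLS mulrA.
Qed.

Section Conjugation.
Variables (m : nat) (eps : K) (heps : ge LS 1 eps).

(** [Pop 0] is the operator P of the overview for A = 0. The parameter stands for a conjugation:
    [Pop (- r)] is X^r P X^(-r), needed because Delta is multiplied by X^r to become an operator of
    the form [is_op]. *)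
Definition Pop (rho : k) (w : K) : K :=
  lX ^ (- m%:Z) * (w + eps * (theta w + lconst rho * w)).

(* Pop rho T = T X^(-m) for T = \sum_i X^i c_i(theta), coefficient by coefficient. *)
Definition Irel (rho : k) (c : nat -> {poly k}) := forall i,
  c i \Po ('X - m%:R%:P) =
  c i + \sum_(a < i) eps (i - a)%N%:Z *: (('X + (a%:R + rho)%:P) * c a).

Lemma PopD rho : {morph Pop rho : u w / u + w}.
Proof. by move=> u w; rewrite /Pop thetaD; move: (lX ^ _) => x; ring. Qed.

Lemma filt_Pop rho : filt LS LS (- m%:Z) (Pop rho).
Proof.
move=> i w hw; rewrite addrC; apply: ge_mul; first exact: ge_lX.
apply: geD => //; apply: ge_mul0; first by apply: (geW heps).
apply: geD; first exact: ge_theta.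
by apply: ge_const_mul.
Qed.

Lemma Pop_ser rho l (F : nat -> k) i :
  Pop rho (ser LS l F) (l - m%:Z + i%:Z) = F i +
    \sum_(a < i) eps (i - a)%N%:Z * ((l%:~R + (a%:R + rho)) * F a).
Proof.
rewrite /Pop (lX_mulE (- m%:Z)) laddE.
have -> : l - m%:Z + i%:Z - - m%:Z = l + i%:Z by lia.
rewrite serLS; congr (_ + _).
have h0 : ge LS 0 eps by apply: (geW heps).
have hs : ge LS l (theta (ser LS l F) + lconst rho * ser LS l F).
  apply: geD; first exact/ge_theta/ge_ser.
  by apply/ge_const_mul/ge_ser.
have := mul_conv i hs h0; rewrite addr0 => ->; rewrite big_ord_recr /= subnn.
rewrite (heps _ : eps (0 + 0%:Z) = 0) // mul0r addr0; apply: eq_bigr => a _.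
rewrite add0r laddE thetaE (lconst_mulE rho) serLS.
by rewrite intrD -pmulrn -mulrDl addrA.
Qed.

Lemma horner_shift (p : {poly k}) (x e : k) : (p \Po ('X + e%:P)).[x] = p.[x + e].
Proof. by rewrite horner_comp !hornerE. Qed.

Lemma Irel_rhs rho c i (x : k) :
  (c i + \sum_(a < i) eps (i - a)%N%:Z *: (('X + (a%:R + rho)%:P) * c a)).[x] =
  (c i).[x] + \sum_(a < i) eps (i - a)%N%:Z * ((x + (a%:R + rho)) * (c a).[x]).
Proof.
rewrite hornerD horner_sum; congr (_ + _); apply: eq_bigr => a _.
by rewrite hornerZ hornerM hornerD hornerX hornerC.
Qed.

Lemma Irel_op rho c T : is_op c T -> Irel rho c ->
  forall w, Pop rho (T w) = T (lX ^ (- m%:Z) * w).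
Proof.
move=> hT hc; have [TD Tf TE] := hT.
apply: (@dense_eq _ _ LS _ _ LS (- m%:Z) (- m%:Z) (fun w => Pop rho (T w))
  (fun w => T (lX ^ (- m%:Z) * w))) => [u w|u w|i w hw|i w hw|l v].
- by rewrite TD PopD.
- by rewrite mulrDr TD.
- by apply: filt_Pop; rewrite -[i]addr0; apply: Tf.
- by rewrite -[_ + _]addr0; apply: Tf; rewrite addrC; apply: ge_mul => //; apply: ge_lX.
rewrite mono_lX !TE addrC; apply: (@ge_eq _ _ LS (l - m%:Z)).
- exact/filt_Pop/ge_ser.
- exact: ge_ser.
move=> i; rewrite cf_ser cfLS Pop_ser intrD mulrNz -pmulrn -horner_shift polyCN.
rewrite hc Irel_rhs mulrDr mulr_sumr; congr (_ + _); apply: eq_bigr => a _.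
by move: (eps _) => x; ring.
Qed.

Lemma op_Irel (k0 : [pchar k] =i pred0) rho c T : is_op c T ->
  (forall w, Pop rho (T w) = T (lX ^ (- m%:Z) * w)) -> Irel rho c.
Proof.
move=> [TD Tf TE] h i; apply: (poly_int_eq k0) => l; rewrite Irel_rhs.
have := h (mono LS l 1); rewrite mono_lX !TE addrC => e.
have := congr1 (fun f : K => f (l - m%:Z + i%:Z)) e.
rewrite Pop_ser serLS intrD mulrNz -pmulrn -polyCN horner_shift !mul1r.
by move=> <-; congr (_ + _); apply: eq_bigr => a _; rewrite mul1r.
Qed.

Lemma Irel0 (k0 : [pchar k] =i pred0) rho c : (0 < m)%N -> Irel rho c ->
  (forall i, (c i).[0] = 0) -> forall i, c i = 0.
Proof.
move=> m0 hc h0 i; elim/ltn_ind: i => i IH.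
rewrite (periodic_const k0 (d := m%:R) (p := c i)) ?h0 //.
  by apply: natr_neq0 => //; lia.
move=> n; have := hc i; rewrite big1 => [|a _]; last by rewrite IH ?mulr0 ?scaler0.
rewrite addr0 => /(congr1 (fun p => p.[- (n%:R * m%:R)])).
by rewrite -polyCN horner_shift => <-; rewrite -natr1 mulrDl mul1r opprD.
Qed.

End Conjugation.
End Operators.

(** * Solution of equations (I) and (II) for A = 0 *)

Section ScalarSolution.
Variables (k : fieldType) (k0 : [pchar k] =i pred0).
Local Notation K := (laurent k).
Variables (r m : nat) (r_gt0 : (0 < r)%N) (m_gt0 : (0 < m)%N).
Variables (tau : K) (htau : has_order tau (- r%:Z)).

Definition epsilon : K := - (lX ^ m%:Z / theta tau).

Let mk : m%:R != 0 :> k. Proof. by apply: natr_neq0 => //; lia. Qed.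
Let rk : r%:R != 0 :> k. Proof. by apply: natr_neq0 => //; lia. Qed.

Lemma theta_tau_order : has_order (theta tau) (- r%:Z).
Proof. by apply: has_order_theta => //; lia. Qed.

Let theta_tau_neq0 : theta tau != 0.
Proof. exact: has_order_neq0 theta_tau_order. Qed.

Lemma epsilon_ge : ge LS (r + m)%N%:Z epsilon.
Proof.
apply: geN; have -> : (r + m)%N%:Z = m%:Z + - - r%:Z by lia.
by apply: ge_mul; [apply: ge_lX|apply/has_order_ge/has_orderV/theta_tau_order].
Qed.

Lemma epsilon_ge1 : ge LS 1 epsilon.
Proof. by apply: (geW epsilon_ge); lia. Qed.

Lemma epsilon_theta : lX ^ (- m%:Z) * epsilon * theta tau = -1.
Proof.
rewrite /epsilon -invr_expz; have : (lX ^ m%:Z : K) != 0 by rewrite expfz_neq0 ?lX_neq0.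
by move: (lX ^ m%:Z) (theta tau) theta_tau_neq0 => x y y0 x0; field; rewrite x0 y0.
Qed.

Lemma epsilon_lead : epsilon (r + m)%N%:Z = (r%:R * tau (- r%:Z))^-1.
Proof.
have [t0 _] := htau.
have h : ge LS 0 (epsilon * theta tau).
  rewrite -(subrr (r + m)%N%:Z).
  by apply: ge_mul; [exact: epsilon_ge|apply: (geW (has_order_ge theta_tau_order)); lia].
have e : (epsilon * theta tau) m%:Z = -1.
  have := congr1 (fun f : K => f 0) epsilon_theta.
  rewrite -mulrA (lX_mulE (- m%:Z)) opprK add0r => ->.
  by rewrite -[-1 : K]/(- 1) -lconst1 -lconstN lconstE eqxx.
have := mul_lead epsilon_ge (has_order_ge theta_tau_order).
rewrite (_ : _ + _ = m%:Z) ?e; last lia.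
rewrite thetaE mulrNz -pmulrn => e2.
have te : r%:R * tau (- r%:Z) != 0 by rewrite mulf_neq0.
apply: (mulIf te); rewrite mulVf //.
transitivity (- (epsilon (r + m)%N%:Z * (- r%:R * tau (- r%:Z)))); first by ring.
by rewrite -e2 opprK.
Qed.

Definition sigma : k := (m%:R - r%:R) / 2%:R.

(* The coefficients of X^r Delta T, see defect_op. *)
Definition defect (c : nat -> {poly k}) (j : nat) : {poly k} :=
  \sum_(b < j.+1) tau (- r%:Z + b%:Z) *:
     (c (j - b)%N - (c (j - b)%N \Po ('X + (b%:R - r%:R)%:P))) +
  (if (r + m <= j)%N then
     m%:R^-1 *: ((c (j - (r + m))%N \Po ('X + m%:R%:P)) * ('X + sigma%:P)) else 0).

Definition Delta (T : K -> K) (w : K) : K :=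
  tau * T w - T (tau * w - lconst m%:R^-1 * (lX ^ m%:Z * (theta w + lconst sigma * w))).

Lemma DeltaD T : {morph T : u w / u + w} -> {morph Delta T : u w / u + w}.
Proof.
move=> TD u w; rewrite /Delta TD thetaD.
set a := tau * (u + w) - _; set b := tau * u - _; set c := tau * w - _.
have -> : a = b + c by rewrite /a /b /c; move: (lX ^ _) => x; ring.
by rewrite TD; ring.
Qed.

(** The factor X^r compensates the pole of tau. In T tau, the term X^(b - r) of tau acts before T
    and shifts the argument of the polynomials by b - r; the factor X^m of the last term shifts it
    by m. *)
Lemma defect_op c T : is_op c T -> is_op (defect c) (fun w => lX ^ r%:Z * Delta T w).
Proof.
move=> hT; have [TD Tf TE] := hT; have ht := has_order_ge htau.
split.
- by move=> u w; rewrite (DeltaD TD) mulrDr.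
- move=> i w hw; have -> : i + 0 = r%:Z + (i - r%:Z) by lia.
  apply: ge_mul; first exact: ge_lX.
  apply: geB; first by rewrite addrC; apply: ge_mul => //; rewrite -[i]addr0; apply: Tf.
  rewrite -[_ - _]addr0; apply: Tf; apply: geB; first by rewrite addrC; apply: ge_mul.
  apply: ge_const_mul.
  have hh : ge LS (m%:Z + i) (lX ^ m%:Z * (theta w + lconst sigma * w)).
    apply: ge_mul; first exact: ge_lX.
    by apply: geD; [apply: ge_theta|apply: ge_const_mul].
  by apply: (geW hh); lia.
move=> l v; set w := mono LS l v.
have hw : ge LS l w by apply: ge_mono.
have hTw : ge LS l (T w) by rewrite TE; apply: ge_ser.
have third : lconst m%:R^-1 * (lX ^ m%:Z * (theta w + lconst sigma * w)) =
    mono LS (m%:Z + l) (m%:R^-1 * ((l%:~R + sigma) * v)).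
  rewrite /w theta_mono lconst_mono -monoD mono_lX lconst_mono.
  by rewrite [v * _]mulrC -mulrDl.
have ht3 : ge LS (m%:Z + l) (T (mono LS (m%:Z + l) (m%:R^-1 * ((l%:~R + sigma) * v)))).
  by rewrite TE; apply: ge_ser.
have e1 (j : nat) : (tau * T w) (- r%:Z + l + j%:Z) =
    v * \sum_(b < j.+1) tau (- r%:Z + b%:Z) * (c (j - b)%N).[l%:~R].
  rewrite mulrC addrAC -addrA [_ + l]addrC addrA.
  rewrite (mul_conv j ht hTw) mulr_sumr; apply: eq_bigr => b _.
  by rewrite TE serLS; move: (tau _) => x; ring.
have e2 (j : nat) : (T (tau * w)) (- r%:Z + l + j%:Z) =
    v * \sum_(b < j.+1) tau (- r%:Z + b%:Z) * (c (j - b)%N).[l%:~R + (b%:R - r%:R)].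
  rewrite (op_cf j hT (ge_mul ht hw)) mulr_sumr; apply: eq_bigr => b _.
  rewrite cf_mul_mono.
  have -> : - r%:Z + l + b%:Z - l = - r%:Z + b%:Z by lia.
  have -> : (- r%:Z + l + b%:Z)%:~R = l%:~R + (b%:R - r%:R) :> k.
    by rewrite !intrD mulrNz -!pmulrn; ring.
  by move: (tau _) => x; ring.
have e3 (j : nat) : (T (mono LS (m%:Z + l) (m%:R^-1 * ((l%:~R + sigma) * v))))
    (- r%:Z + l + j%:Z) =
    v * (if (r + m <= j)%N then
      m%:R^-1 * ((c (j - (r + m))%N).[l%:~R + m%:R] * (l%:~R + sigma)) else 0).
  case: ifP => hj; last by rewrite mulr0; apply: ht3; lia.
  have -> : - r%:Z + l + j%:Z = m%:Z + l + (j - (r + m))%N%:Z by lia.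
  rewrite TE serLS intrD -pmulrn [m%:R + _]addrC; ring.
rewrite /Delta third (morphB TD) opprB.
apply: (@ge_eq _ _ LS l).
- apply: (@geW _ _ LS _ (r%:Z + (- r%:Z + l))); last lia.
  apply: ge_mul; first exact: ge_lX.
  apply: geD; first exact: ge_mul.
  apply: geB; first by apply: (geW ht3); lia.
  by rewrite -[_ + _]addr0; apply: Tf; apply: ge_mul.
- exact: ge_ser.
move=> j; rewrite !cfLS serLS (lX_mulE r%:Z).
have -> : l + j%:Z - r%:Z = - r%:Z + l + j%:Z by lia.
rewrite laddE -[(_ - _ : K) _]cfLS cfB !cfLS e1 e2 e3 -mulrBr -mulrDr.
congr (_ * _); rewrite /defect hornerD horner_sum addrCA addrC; congr (_ + _).
  rewrite -sumrB; apply: eq_bigr => b _.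
  by rewrite hornerZ hornerD hornerN horner_shift mulrBr.
case: ifP => _; last by rewrite horner0.
by rewrite hornerZ hornerM horner_shift hornerD hornerX hornerC.
Qed.

Notation P := (Pop m epsilon).

(** The Weyl relation [P, tau] = -1 between t' and t; it is what the normalisation of [epsilon] by
    theta tau achieves. *)
Lemma Pop_tau u : P 0 (tau * u) = tau * P 0 u - u.
Proof.
have := epsilon_theta; rewrite /Pop lconst0 !mul0r !addr0 thetaM.
move: (lX ^ _) (theta u) (theta tau) => y u' t' e.
have -> : y * (tau * u + epsilon * (t' * u + tau * u')) =
  tau * (y * (u + epsilon * u')) + y * epsilon * t' * u by ring.
by rewrite e mulN1r.
Qed.

(** X^(-m) and tau - X^m (theta + sigma) / m also have commutator -1, so the two copies of T
    produced by the commutators cancel. *)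
Lemma Pop_Delta T : {morph T : u w / u + w} ->
  (forall w, P 0 (T w) = T (lX ^ (- m%:Z) * w)) ->
  forall w, P 0 (Delta T w) = Delta T (lX ^ (- m%:Z) * w).
Proof.
move=> TD hT w; rewrite {1}/Delta (morphB (@PopD _ _ _ _)) Pop_tau !hT.
rewrite /Delta thetaM theta_lX mulrNz -pmulrn -addrA; congr (_ + _).
rewrite -opprD -TD; congr (- T _).
have xy : (lX ^ m%:Z : K) * lX ^ (- m%:Z) = 1.
  by rewrite -expfzDr ?lX_neq0 // subrr.
have mm : lconst m%:R^-1 * m%:R = 1 :> K.
  by rewrite -lconst_nat -lconstM mulVf ?lconst1.
move: (lX ^ m%:Z) (lX ^ (- m%:Z)) (lconst m%:R^-1) (theta w) (lconst sigma) xy mm.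
move=> x y im w' sg xy mm.
transitivity (w + y * tau * w - im * (x * y) * (w' + sg * w)); first by ring.
transitivity (im * m%:R * (x * y) * w + y * tau * w - im * (x * y) * (w' + sg * w)).
  by rewrite mm xy !mul1r.
by ring.
Qed.

Lemma Irel_const rho c i : Irel m epsilon rho c ->
  (forall a : 'I_i, epsilon (i - a)%N%:Z *: c a = 0) -> c i = ((c i).[0])%:P.
Proof.
move=> hc h0; apply: (periodic_const k0 mk) => n; have := hc i.
rewrite big1 => [|a _]; last by rewrite scalerAr h0 mulr0.
rewrite addr0 => /(congr1 (fun p => p.[- (n%:R * m%:R)])).
by rewrite -polyCN horner_shift => <-; rewrite -natr1 mulrDl mul1r opprD.
Qed.

(** Each difference equation leaves the constant of c_i free; the choice made here is the one for
    which the operator fixes 1. *)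
Lemma base_solution : exists c, Irel m epsilon 0 c /\
  forall i, (c i).[0] = (i == 0%N)%:R.
Proof.
have /choice[sol hsol] := fun f : {poly k} => diff_solve k0 f mk.
pose F i (c : nat -> {poly k}) : {poly k} :=
  sol (\sum_(a < i) epsilon (i - a)%N%:Z *: (('X + (a%:R + 0)%:P) * c a)) +
  ((i == 0%N)%:R)%:P.
have [|c hc] := @strong_rec _ 0 F.
  move=> n f g h; rewrite /F; congr (sol _ + _); apply: eq_bigr => a _.
  by rewrite h.
exists c; split=> i; last by rewrite hc /F hornerD hornerC (hsol _).2 add0r.
rewrite hc /F comp_polyD comp_polyC.
set p := \sum_(a < i) _; have [e _] := hsol p.
by rewrite -[X in _ = _ + X]e; ring.
Qed.

Section Base.
Variables (c : nat -> {poly k}).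
Hypothesis hc : Irel m epsilon 0 c.
Hypothesis hc0 : forall i, (c i).[0] = (i == 0%N)%:R.

(** [epsilon] starts in degree r + m, so below that index the difference equations have no source
    and their solutions are periodic. *)
Lemma base_const i : (i < r + m)%N -> c i = ((i == 0%N)%:R)%:P.
Proof.
move=> his; rewrite (Irel_const hc) ?hc0 // => a.
by rewrite (epsilon_ge _ : epsilon (i - a)%N%:Z = 0) ?scale0r //; lia.
Qed.

(** At index r + m the only source comes from c_0 = 1: with e the leading coefficient of [epsilon],
    the equation is c(x - m) - c(x) = e x, and the solution vanishing at 0 is quadratic. *)
Lemma base_quadratic x :
  (c (r + m)%N).[x] = - (epsilon (r + m)%N%:Z / (2%:R * m%:R)) * (x ^+ 2 + m%:R * x).
Proof.
have k2 : 2%:R != 0 :> k by apply: natr_neq0.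
set e := epsilon _.
pose q : {poly k} := - (e / (2%:R * m%:R)) *: ('X^2 + m%:R *: 'X).
have qE y : q.[y] = - (e / (2%:R * m%:R)) * (y ^+ 2 + m%:R * y).
  by rewrite /q hornerZ hornerD hornerZ hornerXn hornerX.
suff -> : c (r + m)%N = q by [].
apply/eqP; rewrite -subr_eq0; apply/eqP.
rewrite (periodic_const k0 mk (p := _ - q)).
  rewrite hornerD hornerN hc0 (_ : (r + m == 0)%N = false); last lia.
  have -> : q.[0] = 0 by rewrite qE; ring.
  by rewrite subr0 polyC0.
move=> n; set x0 := - (n%:R * m%:R).
have -> : - (n.+1%:R * m%:R) = x0 - m%:R :> k by rewrite -natr1 mulrDl mul1r opprD.
have := congr1 (fun p => p.[x0]) (hc (r + m)%N).
rewrite -polyCN horner_shift Irel_rhs.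
have pos : (0 < r + m)%N by lia.
rewrite (bigD1 (Ordinal pos)) //= big1 => [|a a0]; last first.
  rewrite (epsilon_ge _ : epsilon _ = 0) ?mul0r //.
  have := ltn_ord a; have : (a != 0 :> nat)%N by apply: contraNneq a0 => h; apply/eqP/val_inj.
  by lia.
rewrite subn0 -/e (base_const pos) eqxx hornerC mulr1 !addr0 !hornerD !hornerN => ->.
by rewrite !qE; field; rewrite k2 mk.
Qed.

(* The left-hand side of the equation, seen as an operator in u, raises the order
   by m and multiplies the leading coefficient in degree l by - l / m: it is
   solvable with u 0 = 1 since the factor only vanishes for l = 0. *)
Lemma base_gauge (T : K -> K) : is_op c T -> exists u : K, [/\ ge LS 0 u, u 0 = 1 &
  tau * T u - T (tau * u) + lconst sigma * (lconst m%:R^-1 * T (lX ^ m%:Z * u)) = 0].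
Proof.
move=> hT; have [TD Tf TE] := hT; have ht := has_order_ge htau.
pose F w := tau * T w - T (tau * w) +
  lconst sigma * (lconst m%:R^-1 * T (lX ^ m%:Z * w)).
have FD : {morph F : u w / u + w}.
  by move=> u w; rewrite /F !(mulrDr, TD); move: (T _) => x; ring.
have Ff : filt LS LS (- r%:Z) F.
  move=> i w hw; have hTw : ge LS i (T w) by rewrite -[i]addr0; apply: Tf.
  apply: geD; first apply: geB; first by rewrite addrC; apply: ge_mul.
    by rewrite -[_ + _]addr0; apply: Tf; rewrite addrC; apply: ge_mul.
  do 2!apply: ge_const_mul; rewrite -[_ + _]addr0; apply: Tf.
  have h : ge LS (m%:Z + i) (lX ^ m%:Z * w) by apply: ge_mul => //; apply: ge_lX.
  by apply: (geW h); lia.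
have Fmono l v (j : nat) : F (mono LS l v) (- r%:Z + l + j%:Z) =
    v * (\sum_(b < j.+1) tau (- r%:Z + b%:Z) *
      ((c (j - b)%N).[l%:~R] - (c (j - b)%N).[l%:~R + (b%:R - r%:R)]) +
     (if (r + m <= j)%N then
       sigma * (m%:R^-1 * (c (j - (r + m))%N).[l%:~R + m%:R]) else 0)).
  set w := mono LS l v; have hw : ge LS l w by apply: ge_mono.
  have hTw : ge LS l (T w) by rewrite TE; apply: ge_ser.
  have e1 : (tau * T w) (- r%:Z + l + j%:Z) =
      v * \sum_(b < j.+1) tau (- r%:Z + b%:Z) * (c (j - b)%N).[l%:~R].
    rewrite mulrC addrAC -addrA [_ + l]addrC addrA.
    rewrite (mul_conv j ht hTw) mulr_sumr; apply: eq_bigr => b _.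
    by rewrite TE serLS; move: (tau _) => x; ring.
  have e2 : (T (tau * w)) (- r%:Z + l + j%:Z) =
      v * \sum_(b < j.+1) tau (- r%:Z + b%:Z) * (c (j - b)%N).[l%:~R + (b%:R - r%:R)].
    rewrite (op_cf j hT (ge_mul ht hw)) mulr_sumr; apply: eq_bigr => b _.
    rewrite cf_mul_mono.
    have -> : - r%:Z + l + b%:Z - l = - r%:Z + b%:Z by lia.
    have -> : (- r%:Z + l + b%:Z)%:~R = l%:~R + (b%:R - r%:R) :> k.
      by rewrite !intrD mulrNz -!pmulrn; ring.
    by move: (tau _) => x; ring.
  rewrite /F laddE -cfLS cfB !cfLS e1 e2 -mulrBr -sumrB mulrDr; congr (_ + _).
    by congr (_ * _); apply: eq_bigr => b _; rewrite mulrBr.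
  rewrite (lconst_mulE sigma) (lconst_mulE m%:R^-1) /w mono_lX TE; case: ifP => hj.
    have -> : - r%:Z + l + j%:Z = m%:Z + l + (j - (r + m))%N%:Z by lia.
    by rewrite serLS intrD -pmulrn [m%:R + _]addrC; ring.
  rewrite [X in _ * (_ * X)](_ : _ = 0) ?mulr0 //.
  by apply: (@ge_ser _ _ LS (m%:Z + l) _); lia.
have diff0 (i : nat) x y : (i < r + m)%N -> (c i).[x] - (c i).[y] = 0.
  by move=> his; rewrite base_const // !hornerC subrr.
have Fge l v : ge LS (l + m%:Z) (F (mono LS l v)).
  move=> n hn; have [h|h] := ltP n (- r%:Z + l).
    by apply: (Ff _ _ (@ge_mono _ _ LS l v)); rewrite addrC.
  have -> : n = - r%:Z + l + (absz (n + r%:Z - l)%R)%:Z by lia.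
  have hj : (absz (n + r%:Z - l)%R < r + m)%N by lia.
  rewrite cfLS Fmono leqNgt hj addr0 big1 ?mulr0 // => b _.
  by rewrite diff0 ?mulr0 //; lia.
(* By [base_quadratic] and [epsilon_lead], the first nonzero increment contributes - (2 l + m - r) /
   (2 m). The term sigma / m cancels its part independent of l, which is the reason for sigma = (m -
   r) / 2. *)
have Flead l v : F (mono LS l v) (l + m%:Z) = - (l%:~R / m%:R) * v.
  have -> : l + m%:Z = - r%:Z + l + (r + m)%N%:Z by lia.
  rewrite Fmono leqnn subnn big_ord_recl big1 ?addr0 => [|b _]; last first.
    by rewrite diff0 ?mulr0 //= /bump /=; have := ltn_ord b; lia.
  rewrite subn0 (base_const (i := 0)) ?eqxx; last lia.
  rewrite hornerC mulr1 !base_quadratic epsilon_lead sub0r.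
  have k2 : 2%:R != 0 :> k by apply: natr_neq0.
  have [t0 _] := htau; rewrite /sigma; move: (tau _) t0 => t t0.
  by field; rewrite k2 mk rk t0.
have Ffm : filt LS LS m%:Z F := filt_of_mono FD Ff Fge.
(* Adding w 0 repairs the degree 0, where the factor - l / m vanishes. The equation T1 u = 1 then
   gives u 0 = 1, because F u has no term of degree m, and hence F u = 0. *)
pose T1 w := lX ^ (- m%:Z) * F w + mono LS 0 (w 0).
have T1D : {morph T1 : u w / u + w}.
  by move=> u w; rewrite /T1 FD laddE monoD mulrDr addrACA.
have [|i a i0|u hu e] := @tri_surj _ _ LS _ _ LS _ T1D 0 _ _ 1 (has_order_ge (has_order1 k)).
- move=> i w i0 hw; apply: geD.
    apply: (@geW _ _ LS _ (- m%:Z + (i + m%:Z))); last lia.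
    by apply: ge_mul; [exact: ge_lX|apply: Ffm].
  have [->|ni] := eqVneq i 0; first exact: ge_mono.
  rewrite (hw 0 _ : w 0 = 0); last lia.
  by rewrite monoLS lconst0 mul0r; apply: ge0.
- exists (if i == 0 then a else - (m%:R / i%:~R) * a).
  rewrite cfD cfLS (lX_mulE (- m%:Z)) opprK Flead cf_mono monoLSE.
  rewrite [0 == i]eq_sym; case: eqP => [->|/eqP ni]; first by rewrite mul0r oppr0 mul0r add0r.
  have hi : i%:~R != 0 :> k by rewrite intr_eq0_char.
  by rewrite addr0; field; rewrite hi mk.
have u0 : u 0 = 1.
  have := congr1 (fun f : K => f 0) e; rewrite laddE (lX_mulE (- m%:Z)) opprK add0r.
  rewrite monoLSE loneE !eqxx => e0.
  suff h : F u m%:Z = 0 by move: e0; rewrite h add0r.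
  have hr := Ffm _ _ (ge_rest hu); have h1 : m%:Z < 0 + 1 + m%:Z by lia.
  have := hr _ h1; rewrite (morphB FD) cfB !cfLS.
  by have := Flead 0 (u 0); rewrite add0r => ->; rewrite mul0r oppr0 mul0r subr0.
exists u; split=> //; move: e; rewrite /T1 u0 mono_const lconst1 => /eqP.
rewrite -subr_eq0 addrK mulf_eq0 expfz_eq0 (negbTE (lX_neq0 k)) andbF => /eqP.
by [].
Qed.

End Base.

Lemma scalar_solution : exists c : nat -> {poly k},
  [/\ c 0%N = 1, Irel m epsilon 0 c & forall j, defect c j = 0].
Proof.
have [c0 [hc0 hc00]] := base_solution.
have [T0 hT0] := op_ex c0; have [TD Tf TE] := hT0.
have [u [hu u0 Fu]] := base_gauge hc0 hc00 hT0.
(* The coefficients of the composite of T0 with multiplication by u: X^b acts first and shifts the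
   argument by b. Equation (I) survives because u commutes with X^(-m). *)
pose c i := \sum_(b < i.+1) u b%:Z *: (c0 (i - b)%N \Po ('X + b%:R%:P)).
have hT : is_op c (fun w => T0 (u * w)).
  split=> [v w|i w hw|l v]; first by rewrite mulrDr TD.
    by apply: Tf; apply: ge_mul0.
  have hul : ge LS l (u * mono LS l v) by apply: ge_mul0 => //; apply: ge_mono.
  apply: (@ge_eq _ _ LS l); [|exact: ge_ser|].
    by rewrite -[l]addr0; apply: Tf; rewrite addr0.
  move=> n; rewrite !cfLS (op_cf n hT0 hul) serLS horner_sum mulr_sumr.
  apply: eq_bigr => b _; rewrite cf_mul_mono hornerZ horner_shift.
  by rewrite addrC addKr intrD -pmulrn; ring.
have hP w : P 0 (T0 (u * w)) = T0 (u * (lX ^ (- m%:Z) * w)).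
  by rewrite (Irel_op epsilon_ge1 hT0 hc0); congr T0; rewrite mulrCA.
exists c; split.
- rewrite /c big_ord_recl big_ord0 addr0 u0 scale1r subnn addr0 comp_polyXr.
  by rewrite (base_const hc0 hc00) //; lia.
- exact: (op_Irel epsilon_ge1 k0 hT hP).
have hd := defect_op hT; have [DD Df DE] := hd.
apply: (Irel0 k0 (rho := - r%:R) m_gt0 _ _ (eps := epsilon)).
  apply: (op_Irel epsilon_ge1 k0 hd) => w.
  have [hTD _ _] := hT.
  rewrite -(Pop_Delta hTD hP) /Pop thetaM theta_lX lconst0 mul0r addr0.
  rewrite lconstN lconst_nat -pmulrn.
  by move: (lX ^ r%:Z) (lX ^ (- m%:Z)) => x y; ring.
(* As theta 1 = 0, Delta at 1 is the equation solved by u; the coefficients of X^r Delta 1 are the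
   values at 0 of the polynomials [defect c j]. *)
move=> j; have e : Delta (fun w => T0 (u * w)) 1 = 0.
  rewrite /Delta theta1 add0r !mulr1 mulrBr (morphB TD) -[RHS]Fu opprB.
  rewrite [u * tau]mulrC -addrA; congr (_ + _).
  rewrite addrC; congr (_ + _); rewrite -!(op_const _ _ hT0); congr T0.
  by move: (lX ^ _) => x; ring.
have := DE 0 1; rewrite mono_const lconst1 e mulr0.
move/(congr1 (fun f : K => f (0 + j%:Z))); rewrite serLS mul1r => <-.
by rewrite -[LHS]cfLS cf0.
Qed.

End ScalarSolution.

Arguments cf : simpl never.

(** * Operators with a matrix residue A *)

Section MatrixOperators.
Variable k : fieldType.
Local Notation K := (laurent k).

Lemma cf_scale_mono a b (g : K) l (v : 'M[k]_(a, b)) n :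
  cf (MS k a b) (g *: mono (MS k a b) l v) n = g (n - l) *: v.
Proof.
apply/matrixP => i j; rewrite cfMS !mxE monoMS !mxE mulrCA (lX_mulE l) [g * _]mulrC.
by rewrite (lconst_mulE (v i j)) mulrC.
Qed.

Lemma scaleD a b (g : K) : {morph (fun w : 'M[K]_(a, b) => g *: w) : u w / u + w}.
Proof. by move=> u w; rewrite scalerDr. Qed.

Lemma filt_scale a b j (g : K) : ge LS j g ->
  filt (MS k a b) (MS k a b) j (fun w => g *: w).
Proof. by move=> hg i w hw; rewrite addrC; apply: ge_scale. Qed.

Lemma scale_conv a b i j (g : K) (w : 'M[K]_(a, b)) (n : nat) :
  ge (MS k a b) i w -> ge LS j g ->
  cf (MS k a b) (g *: w) (i + j + n%:Z) =
  \sum_(l < n.+1) g (j + (n - l)%N%:Z) *: cf (MS k a b) w (i + l%:Z).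
Proof.
move=> hw hg.
rewrite (@cf_ext _ _ (MS k a b) _ _ (MS k a b) j _ (@scaleD a b g) (@filt_scale a b j g hg) i w n hw).
apply: eq_bigr => l _; rewrite cf_scale_mono; congr (g _ *: _).
by have := ltn_ord l; lia.
Qed.

Section Residue.
Variables (n' : nat) (A : 'M[k]_n'.+1).
Local Notation S := (MS k 1 n'.+1).
Implicit Types w : 'rV[K]_n'.+1.

(* The action of p(theta + A) on the coefficient of X^l. *)
Definition ev (l : int) (p : {poly k}) : 'M[k]_n'.+1 := horner_mx (A + l%:~R%:M) p.

Lemma ev_X l : ev l 'X = A + l%:~R%:M. Proof. exact: horner_mx_X. Qed.
Lemma ev_C l a : ev l a%:P = a%:M. Proof. exact: horner_mx_C. Qed.
Lemma evD l p q : ev l (p + q) = ev l p + ev l q. Proof. exact: rmorphD. Qed.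
Lemma evN l p : ev l (- p) = - ev l p. Proof. exact: rmorphN. Qed.
Lemma evM l p q : ev l (p * q) = ev l p *m ev l q. Proof. exact: rmorphM. Qed.
Lemma evZ l a p : ev l (a *: p) = a *: ev l p. Proof. exact: linearZ. Qed.
Lemma ev1 l : ev l 1 = 1%:M. Proof. exact: rmorph1. Qed.
Lemma ev_sum l I (s : seq I) (F : I -> {poly k}) :
  ev l (\sum_(i <- s) F i) = \sum_(i <- s) ev l (F i).
Proof. exact: rmorph_sum. Qed.

(** An integer shift of the variable amounts to passing from X^l to X^(l + e). Thus the shifts in
    [Irel] and [defect] keep their meaning when numbers are replaced by the matrices A + l. *)
Lemma ev_shift l (e : int) p : ev l (p \Po ('X + e%:~R%:P)) = ev (l + e) p.
Proof.
elim/poly_ind: p => [|p c IH]; first by rewrite comp_poly0 /ev !rmorph0.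
rewrite comp_polyD comp_polyM comp_polyX comp_polyC evD evM IH !evD evM.
rewrite !ev_C !ev_X intrD -addrA; congr (_ *m (_ + _) + _).
by rewrite raddfD.
Qed.

Definition Dres w := mtheta w + w *m cmx A.

Lemma DresD : {morph Dres : u w / u + w}.
Proof. by move=> u w; rewrite /Dres mthetaD mulmxDl addrACA. Qed.

Lemma cf_Dres w n : cf S (Dres w) n = cf S w n *m (A + n%:~R%:M).
Proof.
by rewrite cfD cf_mtheta cf_mul_cmx mulmxDr mul_mx_scalar addrC.
Qed.

Lemma ge_Dres i w : ge S i w -> ge S i (Dres w).
Proof. by move=> h l li; rewrite cf_Dres h ?mul0mx. Qed.

Lemma Dres_mono l v : Dres (mono S l v) = mono S l (v *m (A + l%:~R%:M)).
Proof.
apply: (@cf_inj _ _ S) => i; rewrite cf_Dres !cf_mono.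
by case: eqP => [->|]; rewrite ?mul0mx.
Qed.

Definition is_mop (c : nat -> {poly k}) (T : 'rV[K]_n'.+1 -> 'rV[K]_n'.+1) :=
  [/\ {morph T : u w / u + w}, filt S S 0 T &
    forall l v, T (mono S l v) = ser S l (fun i => v *m ev l (c i))].

Lemma mop_ex c : exists T, is_mop c T.
Proof.
have [||T [TD Tf TE]] := @extension _ _ S _ _ S 0
  (fun l v => ser S l (fun i => v *m ev l (c i))).
- move=> l u w; apply: (@ge_eq _ _ S l); first exact: ge_ser.
    by apply: geD; apply: ge_ser.
  by move=> n; rewrite cfD !cf_ser mulmxDl.
- by move=> l v; rewrite addr0; apply: ge_ser.
by exists T.
Qed.

Lemma mop_cf c T l w (n : nat) : is_mop c T -> ge S l w ->
  cf S (T w) (l + n%:Z) =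
  \sum_(a < n.+1) cf S w (l + a%:Z) *m ev (l + a%:Z) (c (n - a)%N).
Proof.
move=> [TD Tf TE] hw; have e := @cf_ext _ _ S _ _ S 0 _ TD Tf l w n hw.
rewrite addr0 in e; rewrite e; apply: eq_bigr => a _; rewrite TE.
have -> : l + n%:Z = l + a%:Z + (n - a)%N%:Z by have := ltn_ord a; lia.
by rewrite cf_ser.
Qed.

Lemma mop_lead c T : c 0%N = 1 -> is_mop c T ->
  forall i w, ge S i w -> cf S (T w) i = cf S w i.
Proof.
move=> c0 hT i w hw; have := mop_cf 0 hT hw.
by rewrite addr0 big_ord_recl big_ord0 !addr0 c0 ev1 mulmx1.
Qed.

Lemma mono_scale_lX j l v : lX ^ j *: mono S l v = mono S (l + j) v.
Proof.
apply: (@cf_inj _ _ S) => i; rewrite cf_scale_lX !cf_mono.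
by rewrite subr_eq.
Qed.

Lemma mono_scale_const a l v : lconst a *: mono S l v = mono S l (a *: v).
Proof.
apply: (@cf_inj _ _ S) => i; rewrite cf_scale_const !cf_mono.
by case: eqP; rewrite ?scaler0.
Qed.

Variables (m : nat) (eps : K) (heps : ge LS 1 eps).

Lemma mop_Irel c T : is_mop c T -> Irel m eps 0 c -> forall w,
  lX ^ (- m%:Z) *: (T w + eps *: Dres (T w)) = T (lX ^ (- m%:Z) *: w).
Proof.
move=> hT hc; have [TD Tf TE] := hT.
have f1 i w : ge S i w -> ge S (i - m%:Z) (lX ^ (- m%:Z) *: (w + eps *: Dres w)).
  move=> hw; rewrite addrC; apply: ge_scale; first exact: ge_lX.
  apply: geD => //; apply: ge_scale0; last exact: ge_Dres.
  by apply: (geW heps).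
apply: (@dense_eq _ _ S _ _ S (- m%:Z) (- m%:Z)
  (fun w => lX ^ (- m%:Z) *: (T w + eps *: Dres (T w)))
  (fun w => T (lX ^ (- m%:Z) *: w))) => [u w|u w|i w hw|i w hw|l v].
- by rewrite TD DresD; move: (lX ^ _) => x; rewrite (scalerDr eps) addrACA scalerDr.
- by rewrite scalerDr TD.
- by apply: f1; rewrite -[i]addr0; apply: Tf.
- by rewrite -[_ + _]addr0; apply: Tf; rewrite addrC; apply: ge_scale => //; apply: ge_lX.
rewrite mono_scale_lX !TE.
apply: (@ge_eq _ _ S (l - m%:Z)); [exact/f1/ge_ser|exact: ge_ser|].
move=> i; rewrite cf_ser cf_scale_lX -ev_shift mulrNz -pmulrn polyCN hc.
have -> : l - m%:Z + i%:Z - - m%:Z = l + i%:Z by lia.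
have h0 : ge LS 0 eps by apply: (geW heps).
set F := fun i => _.
have hs : ge S l (Dres (ser S l F)) by apply/ge_Dres/ge_ser.
rewrite cfD cf_ser evD mulmxDr; congr (_ + _).
have := scale_conv i hs h0; rewrite addr0 => ->; rewrite big_ord_recr /= subnn.
rewrite (heps _ : eps (0 + 0%:Z) = 0) // scale0r addr0 ev_sum mulmx_sumr.
apply: eq_bigr => a _; rewrite add0r cf_Dres cf_ser evZ -scalemxAr; congr (_ *: _).
rewrite /F -mulmxA; congr (_ *m _); rewrite mulrC evM evD ev_X ev_C addr0.
have smD x y : (x + y)%:M = x%:M + y%:M :> 'M[k]_n'.+1 by apply: raddfD.
by rewrite intrD -pmulrn smD addrA.
Qed.

Variables (k0 : [pchar k] =i pred0).
Variables (r : nat) (tau : K) (htau : has_order tau (- r%:Z)).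

(** On v X^l the difference of the two sides has coefficients v [ev l (defect j)], and these
    polynomials vanish. *)
Lemma mop_defect c T : is_mop c T -> (forall j, defect r m tau c j = 0) -> forall w,
  tau *: T w =
  T (tau *: w - lconst m%:R^-1 *: (lX ^ m%:Z *: (Dres w + lconst (sigma k r m) *: w))).
Proof.
move=> hT hd; have [TD Tf TE] := hT; have ht := has_order_ge htau.
set sg := sigma k r m.
pose Z w := tau *: w - lconst m%:R^-1 *: (lX ^ m%:Z *: (Dres w + lconst sg *: w)).
have ZD : {morph Z : u w / u + w}.
  move=> u w; rewrite /Z DresD; move: (lX ^ _) (lconst sg) (lconst _) => x y z.
  by rewrite (scalerDr y) addrACA (scalerDr x) (scalerDr z) scalerDr opprD addrACA.
have Zf : filt S S (- r%:Z) Z.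
  move=> i w hw; apply: geB; first by rewrite addrC; apply: ge_scale.
  apply: ge_scale0; first exact: ge_lconst.
  have h : ge S (m%:Z + i) (lX ^ m%:Z *: (Dres w + lconst sg *: w)).
    apply: ge_scale; first exact: ge_lX.
    apply: geD; first exact: ge_Dres.
    by apply: ge_scale0 => //; apply: ge_lconst.
  by apply: (geW h); lia.
apply: (@dense_eq _ _ S _ _ S (- r%:Z) (- r%:Z) (fun w => tau *: T w) (T \o Z))
   => [u w|u w|i w hw|i w hw|l v].
- by rewrite TD scalerDr.
- by rewrite /= ZD TD.
- by rewrite addrC; apply: ge_scale => //; rewrite -[i]addr0; apply: Tf.
- by rewrite -[_ + _]addr0; apply/Tf/Zf.
set w := mono S l v; have hw : ge S l w by apply: ge_mono.
have hTw : ge S l (T w) by rewrite TE; apply: ge_ser.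
have third : lconst m%:R^-1 *: (lX ^ m%:Z *: (Dres w + lconst sg *: w)) =
    mono S (l + m%:Z) (m%:R^-1 *: (v *m ev l ('X + sg%:P))).
  rewrite /w Dres_mono mono_scale_const -monoD mono_scale_lX mono_scale_const.
  by congr (mono S _ (_ *: _)); rewrite evD ev_X ev_C [RHS]mulmxDr mul_mx_scalar.
rewrite /= /Z third (morphB TD) [X in _ - X]TE.
set F := fun i => _.
apply/eqP; rewrite -subr_eq0; apply/eqP.
apply: (@ge_eq _ _ S (l - r%:Z)); [|exact: ge0|].
  apply: geB; first by rewrite addrC; apply: ge_scale.
  apply: geB; last by apply: (geW (@ge_ser _ _ S (l + m%:Z) F)); lia.
  by rewrite -[_ - _]addr0; apply: Tf; rewrite addrC; apply: ge_scale.
move=> j; rewrite cf0 !cfB.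
have e1 : cf S (tau *: T w) (l - r%:Z + j%:Z) =
    v *m ev l (\sum_(b < j.+1) tau (- r%:Z + b%:Z) *: c (j - b)%N).
  rewrite (scale_conv j hTw ht) (reindex_inj rev_ord_inj) /= ev_sum mulmx_sumr.
  apply: eq_bigr => b _; rewrite subSS TE cf_ser evZ -scalemxAr.
  by congr (tau _ *: _); have := ltn_ord b; lia.
have e2 : cf S (T (tau *: w)) (l - r%:Z + j%:Z) =
    v *m ev l (\sum_(b < j.+1) tau (- r%:Z + b%:Z) *:
      (c (j - b)%N \Po ('X + (b%:R - r%:R)%:P))).
  have htw : ge S (l - r%:Z) (tau *: w) by rewrite addrC; apply: ge_scale.
  rewrite (mop_cf j hT htw) ev_sum mulmx_sumr; apply: eq_bigr => b _.
  rewrite cf_scale_mono evZ -scalemxAl -scalemxAr.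
  have -> : l - r%:Z + b%:Z - l = - r%:Z + b%:Z by lia.
  congr (_ *: (_ *m _)).
  have -> : (b%:R - r%:R : k) = (b%:Z - r%:Z)%:~R by rewrite intrB -!pmulrn.
  by rewrite ev_shift; congr ev; lia.
have e3 : cf S (ser S (l + m%:Z) F) (l - r%:Z + j%:Z) =
    v *m ev l (if (r + m <= j)%N then
       m%:R^-1 *: ((c (j - (r + m))%N \Po ('X + m%:R%:P)) * ('X + sg%:P)) else 0).
  case: ifP => hj; last first.
    by rewrite /ev rmorph0 mulmx0; apply: (@ge_ser _ _ S (l + m%:Z) F); lia.
  have -> : l - r%:Z + j%:Z = l + m%:Z + (j - (r + m))%N%:Z by lia.
  rewrite cf_ser /F evZ mulrC evM -scalemxAl -scalemxAr mulmxA.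
  by rewrite [m%:R in RHS]pmulrn ev_shift.
rewrite e1 e2 e3 -!mulmxBr -!evN -!evD -evN -evD.
have := hd j; rewrite /defect; set Y := (if _ then _ else _) => hj.
transitivity (v *m ev l 0); last by rewrite /ev rmorph0 mulmx0.
congr (v *m ev l _); rewrite -[RHS]hj opprB addrCA [RHS]addrC; congr (_ + _).
by rewrite -sumrB; apply: eq_bigr => b _; rewrite scalerBr.
Qed.

End Residue.
End MatrixOperators.

(** * Stationary phase *)

Section StationaryPhase.
Variables (k : fieldType) (k0 : [pchar k] =i pred0).
Local Notation K := (laurent k).
Variables (r m : nat) (r_gt0 : (0 < r)%N) (m_gt0 : (0 < m)%N).
Variables (alpha phi beta : K).
Hypothesis phi1 : has_order phi 1.
Hypothesis saddle : lcomp (partial_t r alpha) phi + tvar k m = 0.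
Hypothesis betaE : lcomp alpha phi + lcomp (tvar k r) phi * tvar k m = beta.

Let mk : m%:R != 0 :> k. Proof. by apply: natr_neq0 => //; lia. Qed.
Let rk : r%:R != 0 :> k. Proof. by apply: natr_neq0 => //; lia. Qed.
Let phi0 : phi != 0. Proof. exact: has_order_neq0 phi1. Qed.

Let natK (n : nat) : n%:R != 0 :> k -> n%:R != 0 :> K.
Proof. by rewrite -lconst_nat lconst_eq0. Qed.

Lemma lconstV (c : k) : lconst c^-1 = (lconst c)^-1 :> K.
Proof.
have [->|c0] := eqVneq c 0; first by rewrite invr0 lconst0 invr0.
have h : lconst c != 0 :> K by rewrite lconst_eq0.
by apply: (mulfI h); rewrite -lconstM !mulfV // lconst1.
Qed.

Lemma tvarE n : tvar k n = lX ^ (- n%:Z).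
Proof. by rewrite /tvar exprnN. Qed.

Definition tau : K := phi ^ (- r%:Z).

Lemma tau_order : has_order tau (- r%:Z).
Proof. exact: phiX_order. Qed.

Lemma tau_neq0 : tau != 0. Proof. exact: has_order_neq0 tau_order. Qed.

Lemma lcomp_tvar : lcomp (tvar k r) phi = tau.
Proof. by rewrite tvarE lcomp_lXz. Qed.

Lemma saddle_theta :
  lcomp (theta alpha) phi = r%:R * tau * lX ^ (- m%:Z).
Proof.
rewrite -tvarE; have := saddle; rewrite /partial_t !(lcompM phi1) (lcompN phi1) (lcompV phi1).
rewrite (lcomp_tvar) (lcomp_const phi1) lconstV lconst_nat.
move: (tvar k m) (lcomp _ _) tau tau_neq0 (natK rk) => x y t t0 rK /eqP.
rewrite addrC addr_eq0 => /eqP ->.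
by field; rewrite rK t0.
Qed.

Definition dlog : K := theta phi / phi.

Lemma dlog_ge : ge LS 0 dlog. Proof. exact: (theta_lead phi1).1. Qed.
Lemma dlog0 : dlog 0 = 1. Proof. exact: (theta_lead phi1).2. Qed.

Lemma dlog_neq0 : dlog != 0.
Proof.
by apply/eqP => e; have := dlog0; rewrite e lzeroE => /eqP; rewrite eq_sym oner_eq0.
Qed.

Lemma theta_tau : theta tau = - (r%:R * tau * dlog).
Proof. by rewrite thetaX // mulrNz -pmulrn /dlog !mulNr. Qed.

(** beta is a critical value: by the saddle equation the terms in [dlog], which come from the
    variation of phi, cancel, and only the explicit factor X^(-m) is differentiated. *)
Lemma theta_beta : theta beta = - (m%:R * tau * lX ^ (- m%:Z)).
Proof.
rewrite -betaE thetaD theta_lcomp // saddle_theta -/dlog lcomp_tvar thetaM theta_tau.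
rewrite tvarE theta_lX mulrNz -pmulrn.
by move: (lX ^ _) => x; ring.
Qed.

Lemma beta_order : has_order beta (- (r + m)%N%:Z).
Proof.
have h : has_order (theta beta) (- (r + m)%N%:Z).
  have -> : theta beta = lconst (- m%:R) * (tau * lX ^ (- m%:Z)).
    by rewrite theta_beta lconstN lconst_nat mulNr mulrA.
  rewrite (_ : - (r + m)%N%:Z = - r%:Z + - m%:Z); last lia.
  apply: has_order_const_mul; first by rewrite oppr_eq0.
  exact: has_orderM tau_order (has_order_lX _ _).
have [h0 hl] := h; split; first by apply: contraNneq h0; rewrite thetaE => ->; rewrite mulr0.
move=> n hn; have := hl n hn => /eqP; rewrite thetaE mulf_eq0 intr_eq0_char //.
by case/orP => /eqP // n0; lia.
Qed.

Lemma eps_tau : lX ^ (- m%:Z) * epsilon m tau = (r%:R * tau * dlog)^-1.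
Proof.
have h : r%:R * tau * dlog != 0 by rewrite mulf_neq0 ?dlog_neq0 // mulf_neq0 ?tau_neq0 // natK.
have t0 : theta tau != 0 by rewrite theta_tau oppr_eq0.
have := epsilon_theta k0 r_gt0 m_gt0 tau_order; rewrite theta_tau mulrN => /oppr_inj e.
by apply: (mulIf h); rewrite e mulVf.
Qed.

Section Phase.
Variables (n' : nat) (A : 'M[k]_n'.+1).
Local Notation S := (MS k 1 n'.+1).
Local Notation W := 'rV[K]_n'.+1.

Definition pull (w : W) : W := map_mx (fun f => lcomp f phi) w.

Lemma pullD : {morph pull : u w / u + w}.
Proof. by move=> u w; apply/matrixP => i j; rewrite !mxE lcompD. Qed.

Lemma pullZ f w : pull (f *: w) = lcomp f phi *: pull w.
Proof. by apply/matrixP => i j; rewrite !mxE lcompM. Qed.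

Lemma pull_theta w : mtheta (pull w) = dlog *: pull (mtheta w).
Proof. by apply/matrixP => i j; rewrite !mxE theta_lcomp // mulrC. Qed.

Lemma pull_cmx w : pull (w *m cmx A) = pull w *m cmx A.
Proof.
apply/matrixP => i j; rewrite !mxE.
rewrite (big_morph _ (lcompD phi1) (lcomp0 phi1)); apply: eq_bigr => l _.
by rewrite !mxE lcompM // lcomp_const.
Qed.

Lemma ge_pull i w : ge S i w -> ge S i (pull w).
Proof. by move=> /ge_mxP h; apply/ge_mxP => a b; rewrite mxE; apply: ge_lcomp. Qed.

Lemma pull_lead i w : ge S i w -> cf S (pull w) i = (phi ^ i) i *: cf S w i.
Proof.
move=> /ge_mxP h; apply/matrixP => a b; rewrite cfMS !mxE.
by rewrite lcomp_lead // mulrC.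
Qed.

(* g is X^(-r) T^(-1) G phi^*, where G has theta G = (dlog - 1) A G: it turns the
   connection theta / dlog + A obtained by substitution into (theta + A) / dlog. *)
Lemma stationary_phase : exists g : W -> W,
  [/\ bijective g, {morph g : u w / u + w},
      forall c w, g (lconst c *: w) = lconst c *: g w,
      forall i w, ge S i (g w) -> ge S (i + r%:Z) w &
   (forall w, g (lX ^ r%:Z *: (lconst r%:R^-1 *: (mtheta w + theta alpha *: w + w *m cmx A)))
     = lX ^ (- m%:Z) *: g w) /\
   (forall w, - g (lX ^ (- r%:Z) *: w) = lX ^ m%:Z *: (lconst m%:R^-1 *:
      (mtheta (g w) + (theta beta + lconst ((r + m)%:R / 2%:R)) *: g w + g w *m cmx A)))].
Proof.
have hlam : ge LS 1 (dlog - 1).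
  apply: (@ge_step _ _ LS 0).
    by apply: geB; [exact: dlog_ge|exact/has_order_ge/has_order1].
  by rewrite cfB !cfLS dlog0 loneE subrr.
have [G [hG G0 GE GA]] := gauge_const k0 A hlam.
pose h w := pull w *m G.
have hD : {morph h : u w / u + w} by move=> u w; rewrite /h pullD mulmxDl.
have hZ f w : h (f *: w) = lcomp f phi *: h w by rewrite /h pullZ scalemxAl.
have hge i w : ge S i w -> ge S i (h w).
  by move=> hw; rewrite -[i]addr0; apply: ge_mulmx => //; apply: ge_pull.
have hlead i w : ge S i w -> cf S (h w) i = (phi ^ i) i *: cf S w i.
  move=> hw; have := mulmx_lead (ge_pull hw) hG; rewrite addr0 => ->.
  by rewrite G0 mulmx1 pull_lead.
have p0 i : (phi ^ i) i != 0 by case: (phiX_order phi1 i).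
have hinj i (v : 'rV[k]_n'.+1) : (phi ^ i) i *: v = 0 -> v = 0.
  by move/eqP; rewrite scaler_eq0 (negbTE (p0 i)) => /eqP.
have hsurj i (a : 'rV[k]_n'.+1) : exists b, (phi ^ i) i *: b = a.
  by exists (((phi ^ i) i)^-1 *: a); rewrite scalerA mulfV ?scale1r.
have hbij : bijective h := tri_bij hD hge hlead hinj hsurj.
have [c [c0 hc hd]] := scalar_solution k0 r_gt0 m_gt0 tau_order.
have [T hT] := mop_ex A c; have [TD Tf _] := hT.
have Tge i w : ge S i w -> ge S i (T w) by move=> hw; rewrite -[i]addr0; apply: Tf.
have Tlead := mop_lead c0 hT.
have [|T' T'K TK] := tri_bij TD Tge (B := fun _ v => v) Tlead (fun _ _ e => e).
  by move=> _ a; exists a.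
have h1 w : h (mtheta w + w *m cmx A) = dlog^-1 *: Dres A (h w).
  rewrite /Dres /h mtheta_mul pull_theta GE pullD pull_cmx mulmxDl.
  rewrite -[pull w *m G *m cmx A]mulmxA -GA -scalemxAl -scalemxAr mulmxA -addrA.
  move: (pull (mtheta w) *m G) (pull w *m cmx A *m G) => x y.
  by apply/rowP => j; rewrite !mxE; field; rewrite dlog_neq0.
have e_ge := epsilon_ge1 k0 r_gt0 m_gt0 tau_order.
have h2 w : h (lX ^ r%:Z *: (lconst r%:R^-1 *:
    (mtheta w + theta alpha *: w + w *m cmx A))) =
    lX ^ (- m%:Z) *: (h w + epsilon m tau *: Dres A (h w)).
  rewrite addrAC !hZ hD h1 hZ saddle_theta lcomp_lXz // (lcomp_const phi1).
  rewrite [RHS]scalerDr [in RHS]scalerA eps_tau lconstV lconst_nat.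
  have -> : phi ^ r%:Z = tau^-1 by rewrite /tau -invr_expz invrK.
  move: (Dres A (h w)) (h w) tau tau_neq0 dlog dlog_neq0 (natK rk) (lX ^ _).
  move=> x y t t0 d d0 rK z; apply/rowP => j; rewrite !mxE.
  by field; rewrite t0 d0 rK.
have T'D : {morph T' : u w / u + w}.
  by move=> u w; apply: (can_inj T'K); rewrite TD !TK.
pose g w := lX ^ (- r%:Z) *: T' (h w).
have X0 : (lX ^ (- r%:Z) : K) != 0 by rewrite expfz_neq0 ?lX_neq0.
exists g; split; last split.
- have [h' h'K hK] := hbij.
  exists (fun y => h' (T ((lX ^ (- r%:Z))^-1 *: y))) => w; rewrite /g.
    by rewrite scalerA mulVf // scale1r TK h'K.
  by rewrite hK T'K scalerA mulfV // scale1r.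
- by move=> u w; rewrite /g hD T'D; move: (lX ^ _) => x; rewrite scalerDr.
- move=> a w; rewrite /g hZ (lcomp_const phi1).
  have -> : T' (lconst a *: h w) = lconst a *: T' (h w).
    apply: (can_inj T'K); rewrite TK; move: (T' (h w)) (TK (h w)) => z <-.
    apply: (@dense_eq _ _ S _ _ S 0 0 (fun z => lconst a *: T z) (T \o ( *:%R (lconst a))))
       => {z} [u x|u x|i x hx|i x hx|l v].
    + by rewrite TD scalerDr.
    + by rewrite /= scalerDr TD.
    + by rewrite addr0; apply: ge_scale0; [exact: ge_lconst|exact: Tge].
    + by rewrite addr0; apply/Tge/ge_scale0 => //; apply: ge_lconst.
    have [_ _ TE] := hT.
    rewrite /= mono_scale_const !TE; apply: (@ge_eq _ _ S l).
    + by apply: ge_scale0; [exact: ge_lconst|exact: ge_ser].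
    + exact: ge_ser.
    by move=> i; rewrite cf_scale_const !cf_ser scalemxAl.
  by rewrite scalerA mulrC -scalerA.
(* T and h preserve orders, so only the factor X^(-r) changes them. This bound later yields the
   continuity clause. *)
- move=> i w hg; apply: (tri_ge hlead hinj); rewrite -[h w]TK; apply: Tge.
  move=> l hl; have := hg (l - r%:Z); rewrite /g cf_scale_lX.
  by rewrite opprK subrK; apply; lia.
- move=> w; rewrite /g h2 -{1 2}[h w]TK (mop_Irel e_ge hT hc) T'K.
  by rewrite scalerA mulrC -scalerA.
- move=> w; rewrite /g hZ lcomp_lXz // -/tau.
  have md := mop_defect tau_order hT hd (T' (h w)); rewrite TK in md.
  move/(congr1 T'): md; rewrite T'K => ->; rewrite /Dres.
  move: (T' (h w)) => z.
  rewrite mthetaZ theta_lX mulrNz -pmulrn theta_beta -scalemxAl.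
  (* Moving theta past X^(-r) subtracts r, so the constant s / 2 on the transform becomes s / 2 - r
     = sigma for T. *)
  have -> : lconst ((r + m)%:R / 2%:R) = lconst (sigma k r m) + r%:R :> K.
    rewrite -lconst_nat -lconstD; congr lconst; rewrite /sigma natrD.
    have k2 : 2%:R != 0 :> k by apply: natr_neq0.
    by field.
  have xy : (lX ^ m%:Z : K) * lX ^ (- m%:Z) = 1.
    by rewrite -expfzDr ?lX_neq0 // subrr.
  have im : lconst m%:R^-1 * m%:R = 1 :> K by rewrite -lconst_nat -lconstM mulVf ?lconst1.
  move: (lX ^ m%:Z) (lX ^ (- m%:Z)) (lX ^ (- r%:Z)) (lconst _) (lconst _) xy im.
  move=> x y v s i xy im.
  apply/rowP => j; rewrite !mxE; move: (z 0 j) (theta _) (\sum_(_ < _) _) => zj tj aj.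
  transitivity (v * (i * (x * (tj + aj + s * zj)) - (i * m%:R) * (x * y) * tau * zj)).
    by rewrite im xy; ring.
  by ring.
Qed.

End Phase.
(** [ev] is defined for matrices of positive size; in rank 0 every vector is zero. *)
Lemma stationary_phase_any n (A : 'M[k]_n) : exists g : 'rV[K]_n -> 'rV[K]_n,
  [/\ bijective g, {morph g : u w / u + w},
      forall c w, g (lconst c *: w) = lconst c *: g w,
      forall i w, ge (MS k 1 n) i (g w) -> ge (MS k 1 n) (i + r%:Z) w &
   (forall w, g (lX ^ r%:Z *: (lconst r%:R^-1 *: (mtheta w + theta alpha *: w + w *m cmx A)))
     = lX ^ (- m%:Z) *: g w) /\
   (forall w, - g (lX ^ (- r%:Z) *: w) = lX ^ m%:Z *: (lconst m%:R^-1 *: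
      (mtheta (g w) + (theta beta + lconst ((r + m)%:R / 2%:R)) *: g w + g w *m cmx A)))].
Proof.
case: n A => [|n] A; last exact: stationary_phase.
exists id; split=> //; first by exists id.
  by move=> i w _; rewrite [w]thinmx0; apply: ge0.
by split=> w; rewrite [LHS]thinmx0 [RHS]thinmx0.
Qed.
End StationaryPhase.

(** * Normal form of regular connections *)

Section NormalForm.
Variables (k : closedFieldType) (k0 : [pchar k] =i pred0).
Local Notation K := (laurent k).

(* The rows of H are a new basis, in which the connection of matrix B (acting on
   row vectors by theta w + w B) has the matrix B1. *)
Definition gauge n (B B1 : 'M[K]_n) := exists2 H : 'M[K]_n,
  H \in unitmx & mtheta H + H *m B = B1 *m H.

Lemma gauge_trans n (B1 B B2 : 'M[K]_n) : gauge B B1 -> gauge B1 B2 -> gauge B B2.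
Proof.
move=> [H1 u1 e1] [H2 u2 e2]; exists (H2 *m H1); first by rewrite unitmx_mul u1 u2.
by rewrite mtheta_mul -addrA -!mulmxA -mulmxDr e1 !mulmxA -mulmxDl e2.
Qed.

Definition spectral n (A : 'M[k]_n) (a : k) := A - a%:M \notin unitmx.

Definition nonresonant n (A : 'M[k]_n) :=
  forall a b (i : int), spectral A a -> spectral A b -> a = b + i%:~R -> i = 0.

Lemma eigenvalue_spectral n (A : 'M[k]_n) a : eigenvalue A a = spectral A a.
Proof. by rewrite /eigenvalue /eigenspace kermx_eq0 row_free_unit. Qed.

Lemma ge_lprod I (s : seq I) (P : pred I) (F : I -> K) :
  (forall i, P i -> ge LS 0 (F i)) -> ge LS 0 (\prod_(i <- s | P i) F i).
Proof.
move=> h; elim/big_rec: _ => [|i x Pi hx]; first exact/has_order_ge/has_order1.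
by apply: ge_mul0 => //; apply: h.
Qed.

Lemma ge_sign n : ge LS 0 ((-1) ^+ n : K).
Proof.
elim: n => [|n IH]; first exact/has_order_ge/has_order1.
by rewrite exprS mulN1r; apply: geN.
Qed.

Lemma ge_det n (M : 'M[K]_n) : ge (MS k n n) 0 M -> ge LS 0 (\det M).
Proof.
move=> /ge_mxP h; apply: ge_sum => s _; apply: ge_mul0; first exact: ge_sign.
exact: ge_lprod.
Qed.

Lemma ge_invmx n (M : 'M[K]_n) : ge (MS k n n) 0 M -> has_order (\det M) 0 ->
  M \in unitmx /\ ge (MS k n n) 0 (invmx M).
Proof.
move=> h d; have u : M \in unitmx by rewrite unitmxE unitfE (has_order_neq0 d).
split=> //; rewrite /invmx u; apply: ge_scale0.
  by have := has_order_ge (has_orderV d); rewrite oppr0.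
apply/ge_mxP => i j; rewrite mxE; apply: ge_mul0; first exact: ge_sign.
by apply: ge_det; apply/ge_mxP => a b; rewrite !mxE; move/ge_mxP: h.
Qed.

(** Descend from any eigenvalue by integer steps and keep the last one met; there are finitely many
    eigenvalues. The absence of a - i for i > 0 removes the obstructions in [exists_eigenvector]. *)
Lemma extremal_eigenvalue n (A : 'M[k]_n.+1) : exists a, spectral A a /\
  forall i : nat, ~~ spectral A (a - i.+1%:R).
Proof.
have p1 : size (char_poly A) != 1%N by rewrite size_char_poly.
have /closed_rootP[a0 ra0] := p1.
have [rs hrs] := closed_field_poly_normal (char_poly A).
have c0 : lead_coef (char_poly A) != 0.
  by rewrite lead_coef_eq0 -size_poly_eq0 size_char_poly.
have specE a : spectral A a = (a \in rs).
  by rewrite -eigenvalue_spectral eigenvalue_root_char hrs rootZ // root_prod_XsubC.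
have [N hN] : exists N, forall n : nat, (N <= n)%N -> a0 - n%:R \notin rs.
  elim: rs {hrs specE} => [|x rs [N hN]]; first by exists 0%N.
  have [[n0 hn0]|h] := pselect (exists n0 : nat, a0 - n0%:R = x).
    exists (maxn N n0.+1) => l hl; rewrite inE negb_or hN ?andbT; last lia.
    apply/eqP; rewrite -hn0 => /addrI/oppr_inj/eqP; rewrite -subr_eq0 !pmulrn -intrB.
    by rewrite intr_eq0_char //; lia.
  exists N => l hl; rewrite inE negb_or hN ?andbT //.
  by apply/eqP => e; apply: h; exists l.
have ex : exists n : nat, a0 - n%:R \in rs.
  by exists 0%N; rewrite subr0 -specE -eigenvalue_spectral eigenvalue_root_char.
have ub l : a0 - l%:R \in rs -> (l <= N)%N.
  by move=> h; rewrite leqNgt; apply/negP => /ltnW/hN; rewrite h.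
case: (ex_maxnP ex ub) => l hl lmax; exists (a0 - l%:R); split; first by rewrite specE.
move=> i; rewrite specE -addrA -opprD -natrD; apply/negP => /lmax; lia.
Qed.

(** Start from an eigenvector of the constant term B_0. In degree i > 0 the equation has diagonal
    part B_0 - (a - i), invertible by the choice of a, so the vector extends to a power series. *)
Lemma exists_eigenvector n (B : 'M[K]_n.+1) : ge (MS k _ _) 0 B ->
  exists a (g : 'rV[K]_n.+1), [/\ ge (MS k _ _) 0 g, cf (MS k _ _) g 0 != 0 &
    mtheta g + g *m B = lconst a *: g].
Proof.
move=> hB; pose S := MS k 1 n.+1; pose B0 := cf (MS k _ _) B 0.
have [a [sa hs]] := extremal_eigenvalue B0.
have /eigenvalueP[v hv v0] : eigenvalue B0 a by rewrite eigenvalue_spectral.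
pose T (w : 'rV[K]_n.+1) := mtheta w + w *m B - lconst a *: w.
have TD : {morph T : u w / u + w}.
  move=> u w; rewrite /T mthetaD mulmxDl scalerDr opprD [RHS]addrACA.
  by congr (_ + _); rewrite addrACA.
have Tge i w : ge S i w -> ge S i (T w).
  move=> hw; apply: geB; first apply: geD; first exact: ge_mtheta.
    by rewrite -[i]addr0; apply: ge_mulmx.
  by apply: ge_scale0 => //; apply: ge_lconst.
have Tlead i w : ge S i w ->
    cf S (T w) i = cf S w i *m (B0 - (a - i%:~R)%:M).
  move=> hw; rewrite cfB cfD cf_mtheta cf_scale_const.
  have := mulmx_lead hw hB; rewrite addr0 => ->.
  rewrite mulmxBr mul_mx_scalar scalerBl opprB addrA.
  by rewrite [_ + i%:~R *: _]addrC.
have h0 : ge S 0 (mono S 0 v) by apply: ge_mono.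
have [|||w hw ew] := @tri_surj _ _ S _ _ S T TD 1 _ _ (- T (mono S 0 v)).
- by move=> i w _; apply: Tge.
- move=> i b i1; have u : B0 - (a - i%:~R)%:M \in unitmx.
    have := hs (absz i).-1; rewrite /spectral negbK.
    by have -> : (absz i).-1.+1%:R = i%:~R :> k by rewrite pmulrn; congr (_%:~R); lia.
  exists (b *m invmx (B0 - (a - i%:~R)%:M)).
  by rewrite Tlead ?cf_mono ?eqxx ?mulmxKV //; apply: ge_mono.
- apply/geN/(@ge_step _ _ S 0); first exact: Tge.
  rewrite Tlead // cf_mono eqxx subr0 mulmxBr hv mul_mx_scalar.
  by rewrite subrr.
exists a, (mono S 0 v + w); split.
- by apply: geD => //; apply: (geW hw).
- by rewrite cfD cf_mono eqxx hw ?addr0.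
apply/eqP; rewrite -subr_eq0 -/(T _) TD ew subrr //.
Qed.

(** Some entry of g is a unit. A transposition brings it to the front, and a block triangular matrix
    with first row g then has that entry as determinant. *)
Lemma complete_row n (g : 'rV[K]_(1 + n)) :
  ge (MS k _ _) 0 g -> cf (MS k _ _) g 0 != 0 ->
  exists H : 'M[K]_(1 + n), [/\ ge (MS k _ _) 0 H, H \in unitmx,
    ge (MS k _ _) 0 (invmx H) & row_mx 1%:M 0 *m H = g].
Proof.
move=> hg g0; have [j gj] : exists j, cf (MS k _ _) g 0 0 j != 0.
  apply: contrapT => h; move/eqP: g0; apply; apply/rowP => j; rewrite [RHS]mxE.
  by apply/eqP/negPn/negP => hj; apply: h; exists j.
pose P : 'M[K]_(1 + n) := tperm_mx 0 j.
have PP : P *m P = 1%:M by rewrite /P /tperm_mx -perm_mxM tperm2 perm_mx1.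
have hP : ge (MS k _ _) 0 P.
  by apply/ge_mxP => a b; rewrite !mxE; apply: ge_bool.
have [g' g'E] : exists g', g' = g *m P by exists (g *m P).
have hg' : ge (MS k _ _) 0 g' by rewrite g'E -[0]addr0; apply: ge_mulmx.
have g'0 : g' 0 0 = g 0 j.
  by rewrite g'E -xcolE !mxE tpermL.
pose H : 'M[K]_(1 + n) := block_mx (lsubmx g') (rsubmx g') 0 1%:M.
have dH : \det H = g' 0 0.
  rewrite det_ublock det1 mulr1 [lsubmx g']mx11_scalar det_scalar1 mxE.
  by congr (g' _ _); apply: val_inj.
have hH : ge (MS k _ _) 0 H.
  move/ge_mxP: hg' => h.
  apply/ge_mxP => a b; rewrite /H !mxE; case: split => a'; rewrite !mxE; case: split => b';
    rewrite ?mxE; by [exact: h|exact: ge0|exact: ge_bool].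
have oH : has_order (\det H) 0.
  rewrite dH g'0; split; first by rewrite -[g 0 j 0](cfMS g 0 0 j).
  by move/ge_mxP: hg => h; exact: (h 0 j).
have [uH iH] := ge_invmx hH oH.
have uP : P \in unitmx by rewrite unitmx_perm.
have iP : invmx P = P.
  by rewrite -[LHS]mulmx1 -PP mulmxA mulVmx // mul1mx.
exists (H *m P); split.
- by rewrite -[0]addr0; apply: ge_mulmx.
- by rewrite unitmx_mul uH uP.
- rewrite (_ : invmx _ = P *m invmx H); first by rewrite -[0]addr0; apply: ge_mulmx.
  have e : (H *m P) *m (P *m invmx H) = 1%:M.
    by rewrite mulmxA -(mulmxA H) PP mulmx1 mulmxV.
  have u : H *m P \in unitmx by rewrite unitmx_mul uH uP.
  by rewrite -[RHS]mul1mx -(mulVmx u) -mulmxA e mulmx1.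
- rewrite mulmxA mul_row_block !mul1mx !mul0mx !addr0 hsubmxK.
  by rewrite g'E -mulmxA PP mulmx1.
Qed.

Lemma gauge_split n (B : 'M[K]_(1 + n)) : ge (MS k _ _) 0 B ->
  exists a (b : 'cV[K]_n) (B' : 'M[K]_n), ge (MS k _ _) 0 B' /\
    gauge B (block_mx (lconst a)%:M 0 b B').
Proof.
move=> hB; have [a [g [hg g0 eg]]] := exists_eigenvector hB.
have [H [hH uH iH rH]] := complete_row hg g0.
have [B1 B1E] : exists B1, B1 = (mtheta H + H *m B) *m invmx H by eexists.
have e1 : mtheta H + H *m B = B1 *m H by rewrite B1E mulmxKV.
have hB1 : ge (MS k _ _) 0 B1.
  rewrite B1E -[0]addr0; apply: ge_mulmx => //; apply: geD; first exact: ge_mtheta.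
  by rewrite -[0]addr0; apply: ge_mulmx.
have t1 : mtheta (row_mx 1%:M 0 : 'rV[K]_(1 + n)) = 0.
  apply/matrixP => i j; rewrite !mxE; case: split => l; rewrite !mxE.
    by case: (_ == _); rewrite ?theta1 ?theta0.
  exact: theta0.
have row1 : row_mx 1%:M 0 *m B1 = row_mx (lconst a)%:M 0 :> 'rV[K]_(1 + n).
  rewrite B1E mulmxA mulmxDr mulmxA.
  have -> : row_mx 1%:M 0 *m mtheta H = mtheta (row_mx 1%:M 0 *m H).
    by rewrite mtheta_mul t1 mul0mx add0r.
  rewrite rH eg -rH -scalemxAl mulmxK //.
  by rewrite scale_row_mx scaler0 scalemx1.
exists a, (dlsubmx B1), (drsubmx B1); split.
  apply/ge_mxP => i j; rewrite !mxE; by move/ge_mxP: hB1 => h; apply: (h _ _).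
exists H => //; rewrite e1; congr (_ *m H); rewrite -[LHS]submxK.
move: row1; rewrite -[B1 in LHS]submxK mul_row_block !mul1mx !mul0mx !addr0.
by move/eq_row_mx => [-> ->].
Qed.

Lemma block_unit n (x : K) (h : 'cV[K]_n) (H : 'M[K]_n) : x != 0 -> H \in unitmx ->
  block_mx x%:M 0 h H \in unitmx.
Proof.
by move=> x0; rewrite !unitmxE !unitfE det_lblock det_scalar1 => H0; rewrite mulf_neq0.
Qed.

Lemma mtheta_block a b c d (M1 : 'M[K]_(a, b)) (M2 : 'M[K]_(a, c)) (M3 : 'M[K]_(d, b))
  (M4 : 'M[K]_(d, c)) :
  mtheta (block_mx M1 M2 M3 M4) = block_mx (mtheta M1) (mtheta M2) (mtheta M3) (mtheta M4).
Proof. exact: map_block_mx. Qed.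

Lemma mtheta0 a b : mtheta (0 : 'M[K]_(a, b)) = 0.
Proof. exact: morph0 (@mthetaD _ a b). Qed.

Lemma mtheta_scalar n (x : K) : mtheta (x%:M : 'M[K]_n) = (theta x)%:M.
Proof.
by apply/matrixP => i j; rewrite !mxE; case: (_ == _); rewrite ?mulr1n ?mulr0n ?theta0.
Qed.

Lemma gauge_block n a (b : 'cV[K]_n) (B' B'' : 'M[K]_n) : gauge B' B'' ->
  exists b', gauge (block_mx a%:M 0 b B') (block_mx a%:M 0 b' B'').
Proof.
move=> [H uH eH]; exists (H *m b); exists (block_mx 1%:M 0 0 H).
  by apply: block_unit; rewrite ?oner_neq0.
rewrite mtheta_block !mtheta0 mtheta_scalar theta1 !mulmx_block.
rewrite !(mulmx0, mul0mx, mul1mx, mulmx1, addr0, add0r) add_block_mx.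
by rewrite !(add0r, addr0) -eH (_ : 0%:M = 0) ?add0r //; apply: raddf0.
Qed.

(** Rescaling the first basis vector by X^i adds i to its exponent. The block below may acquire
    poles. *)
Lemma gauge_shift n a i (b : 'cV[K]_n) (B' : 'M[K]_n) :
  exists b', gauge (block_mx a%:M 0 b B') (block_mx (a + i%:~R)%:M 0 b' B').
Proof.
have X0 : (lX ^ i : K) != 0 by rewrite expfz_neq0 ?lX_neq0.
exists ((lX ^ i)^-1 *: b); exists (block_mx (lX ^ i)%:M 0 0 1%:M).
  by apply: block_unit => //; apply: unitmx1.
rewrite mtheta_block !mtheta0 !mtheta_scalar theta1 theta_lX !mulmx_block.
rewrite !(mulmx0, mul0mx, mul1mx, mulmx1, addr0, add0r) add_block_mx.
rewrite !(add0r, addr0) -!scalar_mxM mul_mx_scalar.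
have -> : (0%:M : 'M[K]_n) = 0 by apply: raddf0.
rewrite !add0r scalerA.
move: (lX ^ i) X0 => x x0; rewrite mulfV // scale1r; congr block_mx.
by rewrite -raddfD /=; congr (_%:M); ring.
Qed.

(** In degree i the gauge equation reads (A' - a - i) h_i = b_i for i nonzero; degree 0 is left as
    [b']. Negative i occur because b may have poles. *)
Lemma gauge_offdiag n (a : k) (b : 'cV[K]_n) (A' : 'M[k]_n) :
  (forall i : int, i != 0 -> ~~ spectral A' (a + i%:~R)) ->
  exists b' : 'cV[k]_n, gauge (block_mx (lconst a)%:M 0 b (cmx A'))
                              (block_mx (lconst a)%:M 0 (cmx b') (cmx A')).
Proof.
move=> hu; pose S := MS k n 1; exists (cf S b 0).
have [l hl] := ge_ex S b.
pose F (i : int) : 'cV[k]_n :=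
  if i == 0 then 0 else invmx (A' - (a + i%:~R)%:M) *m cf S b i.
have [|h hh] := cf_ex S (F := F) (i := l).
  by move=> i il; rewrite /F (hl i il) mulmx0; case: eqP.
exists (block_mx 1%:M 0 h 1%:M).
  by apply: block_unit; rewrite ?oner_neq0 ?unitmx1.
rewrite mtheta_block !mtheta0 !mtheta_scalar theta1 !mulmx_block.
rewrite !(mulmx0, mul0mx, mul1mx, mulmx1, addr0, add0r) add_block_mx.
have z m : (0%:M : 'M[K]_m) = 0 by apply: raddf0.
rewrite !z !add0r; congr block_mx.
apply: (@cf_inj _ _ S) => i; rewrite mul_mx_scalar !cfD cf_mtheta cf_scale_const.
rewrite cf_cmx_mul cf_cmx hh /F; case: eqP => [->|/eqP i0].
  by rewrite !scaler0 mulmx0 !add0r addr0.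
have /negPn u := hu i i0.
rewrite add0r addrA -[cf S b i in X in _ + X](mulKVmx u) mulmxBl mul_scalar_mx.
by rewrite -scalerDl [i%:~R + a]addrC addrC subrK.
Qed.

Lemma spectral_block n (a c : k) (b : 'cV[k]_n) (A' : 'M[k]_n) :
  spectral (block_mx a%:M 0 b A') c -> c = a \/ spectral A' c.
Proof.
rewrite /spectral scalar_mx_block opp_block_mx add_block_mx !subr0 -raddfB /=.
rewrite !unitmxE !unitfE det_lblock det_scalar1 mulf_eq0 negb_or.
by case: eqP => [/eqP|_] /=; [rewrite subr_eq0 => /eqP -> _; left|right].
Qed.

(* Nonresonance is what makes the induction work: it is needed to solve for the
   off-diagonal block. *)
Lemma regular_normal_form n (B : 'M[K]_n) : ge (MS k n n) 0 B ->
  exists A : 'M[k]_n, nonresonant A /\ gauge B (cmx A).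
Proof.
elim: n B => [|n IH] B hB.
  exists 0; split; first by move=> a b i; rewrite /spectral unitmxE det_mx00 unitr1.
  by exists 1%:M; rewrite ?unitmx1 // [LHS]flatmx0 [RHS]flatmx0.
have [a [b [B' [hB' g1]]]] := gauge_split (hB : ge (MS k (1 + n) (1 + n)) 0 B).
have [A' [nA' g2]] := IH B' hB'.
have [b2 {}g2] := gauge_block (lconst a) b g2.
(* If a differs by an integer from an eigenvalue c of A', shift it onto c; nonresonance of A' then
   excludes every nonzero integer difference. *)
have [i hi] : exists i : int, forall c j, spectral A' c -> a + i%:~R = c + j%:~R -> j = 0.
  have [[c [j [hc e]]]|h] := pselect (exists c (j : int), spectral A' c /\ a = c + j%:~R).
    exists (- j) => c' j' hc'; rewrite e rmorphN addrK; exact: nA'.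
  exists 0 => c j hc; rewrite addr0 => e; exfalso; apply: h; by exists c, j.
have [b3 g3] := gauge_shift (lconst a) i b2 (cmx A').
set a' := a + i%:~R in hi.
have ea : lconst a + i%:~R = lconst a' :> K by rewrite lconstD lconst_int.
rewrite ea in g3.
have hu j : j != 0 -> ~~ spectral A' (a' + j%:~R).
  move=> j0; apply/negP => h; have := hi _ (- j) h; rewrite rmorphN addrK => /(_ erefl).
  by move/eqP; rewrite oppr_eq0 (negbTE j0).
have [b4 g4] := gauge_offdiag b3 hu.
exists (block_mx a'%:M 0 b4 A'); split.
  move=> c d j /spectral_block[->|hc] /spectral_block[->|hd].
  - by move/eqP; rewrite -subr_eq0 opprD addrA subrr sub0r oppr_eq0 intr_eq0_char // => /eqP.
  - exact: hi.
  - move=> e; have := hi c (- j) hc; rewrite e rmorphN addrK => /(_ erefl) /eqP.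
    by rewrite oppr_eq0 => /eqP.
  - exact: nA'.
have -> : cmx (block_mx a'%:M 0 b4 A') = block_mx (lconst a')%:M 0 (cmx b4) (cmx A').
  rewrite /cmx map_block_mx; congr block_mx; apply/matrixP => p q; rewrite !mxE.
    by case: (_ == _); rewrite ?mulr1n ?mulr0n ?lconst0.
  exact: lconst0.
exact: gauge_trans (gauge_trans (gauge_trans g1 g2) g3) g4.
Qed.

End NormalForm.

(** * Lattices *)

Section Lattices.
Variable k : fieldType.
Local Notation K := (laurent k).

Section OneLattice.
Variables (V : vectType K) (L : V -> Prop).
Hypothesis hL : is_lattice L.

Lemma latticeB u v : L u -> L v -> L (u - v).
Proof.
have [n [e [_ hE]]] := hL; move=> /hE[a [ha ->]] /hE[b [hb ->]].
apply/hE; exists (fun i => a i - b i); split; first by move=> i; exact: (@geB _ _ LS 0 _ _ (ha i) (hb i)).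
by rewrite -sumrB; apply: eq_bigr => i _; rewrite scalerBl.
Qed.

(** Scalars of high enough order clear the poles of the coordinates of the finitely many [w s] on
    the generators. *)
Lemma lattice_absorbs (I : finType) (w : I -> V) : exists q : nat,
  forall c : I -> K, (forall s, ge LS q%:Z (c s)) -> L (\sum_s c s *: w s).
Proof.
have [n [e [eV hE]]] := hL.
have hw s : w s = \sum_i coord e i (w s) *: tnth e i.
  rewrite {1}(coord_span (v := w s) (X := e)) ?eV ?memvf //.
  by apply: eq_bigr => i _; rewrite (tnth_nth 0).
have /choice[b hb] : forall si : I * 'I_n, exists N : nat,
    forall j, coord e si.2 (w si.1) j != 0 -> - N%:Z <= j.
  by move=> si; apply: lbound.
pose q := (\max_si b si)%N; exists q => c hc; apply/hE.
exists (fun i => \sum_s c s * coord e i (w s)); split.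
  move=> i; have g : ge LS 0 (\sum_s c s * coord e i (w s)); last exact: g.
  apply: ge_sum => s _; rewrite -(subrr q%:Z).
  apply: ge_mul => // j hj; apply/eqP/negPn/negP => /(hb (s, i)).
  by have : (b (s, i) <= q)%N by [apply: leq_bigmax]; lia.
under [RHS]eq_bigr => i _ do rewrite scaler_suml.
rewrite exchange_big; apply: eq_bigr => s _ /=.
by rewrite {1}hw scaler_sumr; apply: eq_bigr => i _; rewrite scalerA.
Qed.
End OneLattice.

(** If some coordinate of d has order v, then d escapes X^(v + 1) times the lattice of the basis. *)
Lemma lattice_separates (V : vectType K) (d : V) :
  (forall L : V -> Prop, is_lattice L -> L d) -> d = 0.
Proof.
move=> h; pose e := vbasis {:V}; apply: contrapT => /eqP d0.
have [i ci] : exists i, coord e i d != 0.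
  apply: contrapT => hi; move/eqP: d0; apply.
  rewrite (coord_basis (vbasisP _) (memvf d)) big1 // => i _.
  by have [->|ci] := eqVneq (coord (vbasis {:V}) i d) 0;
    [rewrite scale0r|case: hi; exists i].
have [v [v0 _]] := order_exists ci.
pose x : K := lX ^ (v + 1); have x0 : x != 0 by rewrite expfz_neq0 ?lX_neq0.
pose e' := [tuple of map (fun u => x *: u) e].
have tE (j : 'I_(\dim {:V})) : tnth e' j = x *: e`_j by rewrite tnth_map (tnth_nth 0).
pose L (m : V) := exists c : 'I_(\dim {:V}) -> K,
  (forall i, is_power_series (c i)) /\ m = \sum_i c i *: tnth e' i.
have hL : is_lattice L.
  exists (\dim {:V}), e'; split=> //; apply/eqP; rewrite eqEsubv subvf /=.
  rewrite -{1}(span_basis (vbasisP {:V})); apply/span_subvP => u /(nthP 0)[j].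
  rewrite size_tuple => hj <-.
  rewrite -[(vbasis {:V})`_j](scalerK x0); apply: memvZ.
  by rewrite -(tE (Ordinal hj)) memv_span ?mem_tnth.
have [c [hc dE]] := h L hL.
have ec : coord e i d = x * c i.
  rewrite dE linear_sum (bigD1 i) //= big1 => [|j ji].
    rewrite tE !linearZ /= coord_free ?(basis_free (vbasisP _)) // eqxx.
    by rewrite addr0 mulr1 mulrC.
  rewrite tE !linearZ /= coord_free ?(basis_free (vbasisP _)) //.
  by rewrite (negbTE ji) !mulr0.
move/eqP: v0; apply; rewrite ec; have hx : ge LS (v + 1) x := @ge_lX k _.
have := ge_mul hx (hc i : ge LS 0 (c i)); rewrite addr0; apply; lia.
Qed.

(* The rows of U are the n generators of the lattice with determinant of minimal
   order; by Cramer's rule the other generators are integral over them. *)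
Lemma lattice_basis (V : vectType K) (L : V -> Prop) : is_lattice L ->
  exists U : 'M[K]_(\dim {:V}), [/\ U \in unitmx,
    forall i, L (uncrd (row i U)) &
    forall u, L u -> ge (MS k _ _) 0 (crd u *m invmx U)].
Proof.
move=> [N [v [sv hL]]]; set n := \dim {:V}.
pose M : 'M[K]_(N, n) := \matrix_i crd (tnth v i).
have fM : row_full M.
  rewrite -sub1mx; apply/row_subP => i.
  have : uncrd (row i 1%:M) \in <<v>>%VS by rewrite sv memvf.
  move=> /coord_span e; apply/submxP.
  exists (\row_j coord v j (uncrd (row i 1%:M))).
  rewrite mulmx_sum_row -[LHS]uncrdK e linear_sum; apply: eq_bigr => j _.
  by rewrite linearZ rowK (tnth_nth 0) /=; congr (_ *: _); rewrite mxE -e.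
pose f0 : {ffun 'I_n -> 'I_N} := [ffun i => fullrankfun fM i].
pose sub (f : {ffun 'I_n -> 'I_N}) := rowsub f M.
have s0 : \det (sub f0) != 0.
  have := fullrowsub_unit fM; rewrite unitmxE unitfE.
  have -> // : rowsub (fullrankfun fM) M = sub f0.
  have f0E i : f0 i = fullrankfun fM i by rewrite ffunE.
  by apply/matrixP => i j; rewrite /sub [LHS]mxE [RHS]mxE f0E.
have /choice[o ho] : forall x : K, exists w, x != 0 -> has_order x w.
  move=> x; have [->|/order_exists[w hw]] := eqVneq x 0; first by exists 0.
  by exists w.
have [f sf fmin] := @Order.TotalTheory.arg_minP _ int _ f0 (fun f => \det (sub f) != 0)
   (fun f => o (\det (sub f))) s0.
have uU : sub f \in unitmx by rewrite unitmxE unitfE.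
have rowV (j : 'I_N) : ge (MS k _ _) 0 (row j M *m invmx (sub f)).
  apply/ge_mxP => a i; rewrite [a]ord1 {a}.
  pose f' : {ffun 'I_n -> 'I_N} := [ffun b => if b == i then j else f b].
  have f'E b : f' b = if b == i then j else f b by rewrite ffunE.
  have e : (row j M *m invmx (sub f)) 0 i = (\det (sub f))^-1 * \det (sub f').
    rewrite /invmx uU -scalemxAr mxE; congr (_ * _).
    rewrite (expand_det_row _ i) mxE; apply: eq_bigr => b _.
    rewrite !mxE f'E eqxx; congr (_ * (_ * \det _)).
    by apply/matrixP => p q; rewrite !mxE f'E eq_sym (negbTE (neq_lift i p)).
  rewrite e; have [->|d0] := eqVneq (\det (sub f')) 0; first by rewrite mulr0; apply: ge0.
  have h1 := has_order_ge (has_orderV (ho _ sf)).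
  have h2 := has_order_ge (ho _ d0).
  by apply: (geW (ge_mul h1 h2)); have := fmin f' d0; lia.
exists (sub f); split=> //.
  move=> i; apply/hL; exists (fun j => (j == f i)%:R); split.
    by move=> j; exact: (ge_bool k (j == f i)).
  rewrite (bigD1 (f i)) //= eqxx scale1r big1 ?addr0 => [|j /negbTE ->]; last by rewrite scale0r.
  by rewrite -[RHS]crdK; congr uncrd; apply/rowP => j; rewrite !mxE.
move=> u /hL[c [hc ->]]; rewrite linear_sum mulmx_suml; apply: ge_sum => j _.
rewrite linearZ /= -scalemxAl; apply: ge_scale0; first exact: hc.
by have := rowV j; rewrite rowK.
Qed.

End Lattices.

(** * Coordinates on regular connections and on their twists *)

Section Regular.
Variables (k : closedFieldType) (k0 : [pchar k] =i pred0).
Local Notation K := (laurent k).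

(** In a basis of a stable lattice the matrix of the connection has no poles, so the normal form
    applies. *)
Lemma regular_coordinates (R : connection k) : is_regular R ->
  exists (A : 'M[k]_(\dim {:R})) (P : 'M[K]_(\dim {:R})),
    P \in unitmx /\ mtheta P + P *m conn_mx R = cmx A *m P.
Proof.
move=> [L [hL LD]]; have [U [uU LU Uge]] := lattice_basis hL.
have [B BE] : exists B, B = (mtheta U + U *m conn_mx R) *m invmx U by eexists.
have hB : ge (MS k _ _) 0 B.
  apply/ge_mxP => i j.
  have rE : row i B = crd (conn_D (uncrd (row i U))) *m invmx U.
    rewrite BE row_mul; congr (_ *m _); rewrite crd_D uncrdK.
    by rewrite linearD /= row_mul map_row.
  by have /ge_mxP/(_ 0 j) := Uge _ (LD _ (LU i)); rewrite -rE mxE.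
have [A [_ [H uH eH]]] := regular_normal_form k0 hB.
exists A, (H *m U); split; first by rewrite unitmx_mul uH uU.
have eU : mtheta U + U *m conn_mx R = B *m U by rewrite BE mulmxKV.
by rewrite mtheta_mul -addrA -[H *m U *m _]mulmxA -mulmxDr eU mulmxA -mulmxDl eH mulmxA.
Qed.

End Regular.

Section Fourier.
Variable k : fieldType.
Local Notation K := (laurent k).

Section Tensor.
Variables (f : K) (R : connection k).
Local Notation n := (\dim {:R}).
Local Notation TR := (tensor (rank1 f) R).

Lemma tensZl a (u : rank1 f) (w : R) : tens (a *: u) w = a *: tens u w.
Proof. by rewrite /tens !linearZ /= scalemxAl. Qed.
Lemma tensDr (u : rank1 f) (v w : R) : tens u (v + w) = tens u v + tens u w.
Proof. by rewrite /tens linearD /= mulmxDr. Qed.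
Lemma tensZr a (u : rank1 f) (w : R) : tens u (a *: w) = a *: tens u w.
Proof. by rewrite /tens linearZ /= scalemxAr. Qed.

Lemma dim_rank1 : \dim {:rank1 f} = 1%N.
Proof. by rewrite dimvf. Qed.

Lemma tens1_bij : bijective (tens (1 : rank1 f) : R -> TR).
Proof.
have [i0 hi0] : exists i0, crd (1 : rank1 f) 0 i0 != 0.
  apply: contrapT => h; have /eqP := oner_neq0 K; apply.
  rewrite -[LHS](crdK (V := rank1 f)) (_ : crd _ = 0) ?linear0 //.
  apply/rowP => i; rewrite [RHS]mxE; apply/eqP/negPn/negP => hi.
  by apply: h; exists i.
have one i : i = i0.
  apply: val_inj => /=; have := ltn_ord i; have := ltn_ord i0; have := dim_rank1.
  by move: (\dim _) (nat_of_ord i) (nat_of_ord i0) => d a b; lia.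
exists (fun M : TR => uncrd ((crd (1 : rank1 f) 0 i0)^-1 *: row i0 M)).
  move=> v; rewrite -[RHS]crdK; congr uncrd; rewrite /tens.
  move: (crd (1 : rank1 f)) (crd v) hi0 => u w hu.
  by apply/rowP => j; rewrite !mxE big_ord1 !mxE mulKf.
move=> M; rewrite /tens uncrdK; move: (crd (1 : rank1 f)) hi0 => u hu; apply/matrixP => i j; rewrite !mxE big_ord1 !mxE (one i).
by rewrite mulVKf.
Qed.

Lemma tens1_D (v : R) : conn_D (tens (1 : rank1 f) v : TR) =
  tens (1 : rank1 f) (f *: v + conn_D v).
Proof.
have D1 : @conn_D k (rank1 f) 1 = f *: 1 :> rank1 f.
  rewrite -[LHS]/(rank1_D f 1) /rank1_D theta1 add0r; exact: erefl.
transitivity (tens (@conn_D k (rank1 f) 1) v + tens (1 : rank1 f) (conn_D v)).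
  exact: (@tensor_DE k (rank1 f) R 1 v).
by rewrite D1 tensDr tensZr tensZl.
Qed.

Variables (A : 'M[k]_n) (P : 'M[K]_n).
Hypothesis (uP : P \in unitmx) (eP : mtheta P + P *m conn_mx R = cmx A *m P).

Definition frame (y : 'rV[K]_n) : TR := tens (1 : rank1 f) (uncrd (y *m P)).

Lemma frame_bij : bijective frame.
Proof.
apply: (bij_comp tens1_bij); exists (fun v => crd v *m invmx P) => w.
  by rewrite uncrdK mulmxK.
by rewrite mulmxKV // crdK.
Qed.

Lemma frameD : {morph frame : u v / u + v}.
Proof. by move=> u v; rewrite /frame mulmxDl linearD /= tensDr. Qed.

Lemma frameZ a y : frame (a *: y) = a *: frame y.
Proof. by rewrite /frame -scalemxAl linearZ /= tensZr. Qed.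

Lemma frame_D y : conn_D (frame y) = frame (mtheta y + f *: y + y *m cmx A).
Proof.
rewrite /frame tens1_D; congr (tens _ _).
rewrite -[LHS]crdK; congr uncrd; rewrite linearD linearZ /= crd_D !uncrdK.
rewrite -/(mtheta (y *m P)) mtheta_mul -[y *m P *m _]mulmxA -[_ + _ *m (_ *m _)]addrA.
rewrite -mulmxDr eP !mulmxDl -scalemxAl mulmxA.
by rewrite addrA [_ + mtheta y *m P]addrC.
Qed.

End Tensor.
End Fourier.

(** * The local Fourier transform *)

Section Ramified.
Variable k : fieldType.
Local Notation K := (laurent k).
Variables (r : nat) (r_gt0 : (0 < r)%N).
Local Notation expand := (expand r_gt0).

Lemma expand_lX : expand lX = lX ^ r%:Z :> K.
Proof.
apply: laurentP => n; have [q [j jr ->]] := divr_decomp r_gt0 n.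
rewrite expandE // lXzE; case: eqP => [->|/eqP j0].
  rewrite -[lX]expr1z lXzE addr0; congr (_%:R); congr nat_of_bool.
  by apply/eqP/eqP => [->|h]; [rewrite mul1r|nia].
rewrite (_ : _ == _ = false) //; apply/eqP => e.
by have [h|h] := leP q 0; nia.
Qed.

Lemma expand_lXV : expand lX^-1 = lX ^ (- r%:Z) :> K.
Proof.
have h : (lX ^ r%:Z : K) != 0 by rewrite expfz_neq0 ?lX_neq0.
apply: (mulfI h); rewrite -{1}expand_lX -expandM mulfV ?lX_neq0 // expand1.
by rewrite -expfzDr ?lX_neq0 // subrr.
Qed.

Lemma ge_expandl p (f : K) : ge LS p f -> ge LS (p * r%:Z) (expand f).
Proof.
move=> hf n; have [q [j jr ->]] := divr_decomp r_gt0 n => hn.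
rewrite cfLS expandE //; case: eqP => // j0.
by apply: (hf q); nia.
Qed.

Lemma expand_rpart (f : K) : f = \sum_(j < r) lX ^ j%:Z * expand (rpart r_gt0 j f).
Proof.
apply: (rpart_inj (r_gt0 := r_gt0)) => i.
have r0 : rpart r_gt0 i (0 : K) = 0 by apply: (morph0 (@rpartD k r r_gt0 i)).
rewrite (big_morph _ (@rpartD k r r_gt0 i) r0) (bigD1 i) //= big1 => [|j ji].
  rewrite addr0 mulrC rpart_expandM (_ : rpart _ _ (lX ^ _) = 1) ?mulr1 //.
  apply: laurentP => n; rewrite rpartE // lXzE loneE; congr (_%:R); congr nat_of_bool.
  by apply/eqP/eqP => h; nia.
rewrite mulrC rpart_expandM (_ : rpart _ _ (lX ^ _) = 0) ?mulr0 //.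
apply: laurentP => n; rewrite rpartE // lXzE lzeroE.
rewrite (_ : _ == _ = false) //; apply/eqP => e; move/eqP: ji; apply; apply: val_inj => /=.
have hi := ltn_ord i; have hj := ltn_ord j.
have [h|h] := leP 1 n; first by nia.
by have [h'|h'] := leP 0 n; [have n0 : n = 0 by [lia]; rewrite n0 in e; lia|nia].
Qed.

Lemma ge_rpart (q : int) (f : K) (j : 'I_r) : ge LS (q * r%:Z) f -> ge LS q (rpart r_gt0 j f).
Proof.
move=> h n hn; rewrite cfLS rpartE //; apply: h; have := ltn_ord j; nia.
Qed.

Lemma pushmod_scaleE (V : vectType K) (a : K) (v : pushmod r_gt0 V) :
  a *: v = expand a *: (v : V).
Proof. by []. Qed.

(** Splitting exponents modulo r gives the generators X^j e_b over the smaller field. This compares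
    the X-adic order of coordinates with lattices of the pushforward. *)
Lemma frame_absorbed n (V : vectType K) (Psi : 'rV[K]_n -> V)
    (L : pushmod r_gt0 V -> Prop) :
  {morph Psi : u v / u + v} -> (forall a y, Psi (a *: y) = a *: Psi y) -> is_lattice L ->
  exists N, forall y, ge (MS k 1 n) N y -> L (Psi y).
Proof.
move=> PD PZ hL.
pose w (jb : 'I_r * 'I_n) : pushmod r_gt0 V := lX ^ jb.1%:Z *: Psi (delta_mx 0 jb.2).
have [q hq] := lattice_absorbs hL w; exists (q%:Z * r%:Z) => y hy.
have P0 : Psi 0 = 0 by apply: morph0 PD.
pose c (jb : 'I_r * 'I_n) : K := rpart r_gt0 jb.1 (y 0 jb.2).
have -> : Psi y = \sum_jb c jb *: w jb :> pushmod r_gt0 V.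
  rewrite -(pair_bigA _ (fun j b => c (j, b) *: w (j, b))) /= exchange_big /=.
  rewrite {1}[y]row_sum_delta (big_morph _ PD P0); apply: eq_bigr => b _.
  rewrite PZ {1}[y 0 b](expand_rpart (y 0 b)) scaler_suml; apply: eq_bigr => j _.
  by rewrite pushmod_scaleE /w scalerA mulrC.
apply: hq => -[j b] /=; apply: ge_rpart.
by move/ge_mxP: hy => h; apply: (h 0 b).
Qed.
End Ramified.

(** * Uniqueness of the local Fourier transform *)

Section Uniqueness.
Variable k : fieldType.
Local Notation K := (laurent k).
Variables (M F N : connection k).

(* The comparison map commutes with Laurent polynomials; for a general series the
   continuity clauses put the error in every lattice. *)
Lemma local_fourier_unique : is_local_fourier M F -> is_local_fourier M N -> conn_iso F N.
Proof.
move=> [iF [[jF jFK iFK] linF PF DF cF]] [iN [[jN jNK iNK] linN PN DN cN]].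
have addN : {morph iN : u v / u + v}.
  by move=> u v; have := linN 1 u v; rewrite lconst1 !scale1r.
have addF : {morph iF : u v / u + v}.
  by move=> u v; have := linF 1 u v; rewrite lconst1 !scale1r.
have scN c u : iN (lconst c *: u) = lconst c *: iN u.
  by have := linN c u 0; rewrite (morph0 addN) !addr0.
have scF c u : iF (lconst c *: u) = lconst c *: iF u.
  by have := linF c u 0; rewrite (morph0 addF) !addr0.
pose h x := iN (jF x).
have hF u : h (iF u) = iN u by rewrite /h jFK.
have hD : {morph h : u v / u + v}.
  by move=> u v; rewrite -(iFK u) -(iFK v) -addF !hF addN.
have hc c x : h (lconst c *: x) = lconst c *: h x.
  by rewrite -(iFK x) -scF !hF scN.
have hV x : h (lX^-1 *: x) = lX^-1 *: h x.
  by rewrite -(iFK x) -PF !hF PN.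
have hX x : h (lX *: x) = lX *: h x.
  have e : lX^-1 *: (lX *: x) = x by rewrite scalerA mulVf ?scale1r ?lX_neq0.
  by rewrite -{2}e hV scalerA mulfV ?scale1r ?lX_neq0.
have hXz (i : int) x : h (lX ^ i *: x) = lX ^ i *: h x.
  case: i => i.
    elim: i => [|i IH]; first by rewrite expr0z !scale1r.
    by rewrite exprSz -!scalerA hX IH.
  rewrite NegzE -exprnN; elim: i.+1 => [|j IH]; first by rewrite expr0 invr1 !scale1r.
  by rewrite exprS invfM -!scalerA hV IH.
have hmono i c x : h (mono LS i c *: x) = mono LS i c *: h x.
  by rewrite monoLS -!scalerA hc hXz.
have hlin (f : K) x : h (f *: x) = f *: h x.
  apply/eqP; rewrite -subr_eq0; apply/eqP; apply: (can_inj iNK).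
  rewrite (_ : jN 0 = 0); last by apply: (can_inj jNK); rewrite iNK (morph0 addN).
  apply: lattice_separates => L hL.
  have [p1 h1] := cF (jF x) L hL; have [p2 h2] := cN (jF x) L hL.
  have [i hi] := ge_ex LS f.
  (* Enough terms for the tail f - f0 to have order at least p1 and p2: both continuity clauses then
     put its images in L, while f0 is a Laurent polynomial and commutes with h. *)
  pose n := absz ((maxn p1 p2)%:Z - i)%R.
  have := @ge_expand _ _ LS i f n hi; set f0 := \sum_(j < n) _ => hf1.
  have e0 : h (f0 *: x) = f0 *: h x.
    rewrite /f0 !scaler_suml (big_morph _ hD (morph0 hD)).
    by apply: eq_bigr => j _; rewrite hmono.
  have ef y : f *: y = (f - f0) *: y + f0 *: y by rewrite -scalerDl subrK.
  have ge_val (g : K) p : ge LS (i + n%:Z) g -> (p <= maxn p1 p2)%N -> val_ge p g.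
    by move=> hg hp l hl; apply: (hg l); lia.
  have m1 : L (jF ((f - f0) *: x)).
    by apply: (h1 (f - f0)); rewrite ?iFK //; apply: (ge_val _ _ hf1); lia.
  have m2 : L (jN ((f - f0) *: h x)).
    by apply: (h2 (f - f0)); rewrite ?iNK //; apply: (ge_val _ _ hf1); lia.
  have -> : jN (h (f *: x) - f *: h x) = jF ((f - f0) *: x) - jN ((f - f0) *: h x).
    apply: (can_inj jNK); rewrite iNK (morphB addN) iNK.
    rewrite -[iN (jF _)]/(h _) -[f in LHS](subrK f0) !scalerDl hD e0.
    by rewrite opprD addrACA subrr addr0.
  exact: latticeB.
have hl : linear h by move=> a u v; rewrite hD hlin.
pose H : {linear F -> N} := HB.pack h (GRing.isLinear.Build K F N *:%R h hl).
exists H; split.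
  by exists (fun y => iF (jN y)) => u; rewrite /= /h ?jFK ?iNK ?jNK ?iFK.
move=> x /=; rewrite -{1}(iFK x) -[x in RHS]iFK; move: (jF x) => u.
have dF : conn_D (iF u) = - (lX^-1 *: iF (lX^-1 *: u)).
  have /eqP := DF u; rewrite eqr_oppLR => /eqP ->.
  by rewrite scalerN opprK scalerA mulVf ?scale1r ?lX_neq0.
have dN : conn_D (iN u) = - (lX^-1 *: iN (lX^-1 *: u)).
  have /eqP := DN u; rewrite eqr_oppLR => /eqP ->.
  by rewrite scalerN opprK scalerA mulVf ?scale1r ?lX_neq0.
by rewrite hF dN dF (morphN hD) hV hF.
Qed.
End Uniqueness.

(** * Existence of the transform and conclusion *)

Lemma local_fourier_exists (k : closedFieldType) (k0 : [pchar k] =i pred0)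
    (r m : nat) (r_gt0 : (0 < r)%N) (m_gt0 : (0 < m)%N)
    (alpha phi beta : laurent k) (R : connection k) :
  has_order phi 1 -> lcomp (partial_t r alpha) phi + tvar k m = 0 ->
  lcomp alpha phi + lcomp (tvar k r) phi * tvar k m = beta -> is_regular R ->
  is_local_fourier
    (pushforward k0 r_gt0 (tensor (rank1 (theta alpha)) R))
    (pushforward k0 m_gt0
      (tensor (rank1 (theta beta + lconst ((r + m)%:R / 2%:R))) R)).
Proof.
move=> phi1 saddle betaE /(regular_coordinates k0)[A [P [uP eP]]].
have [g [gbij gD gc gge [gP gQ]]] :=
  stationary_phase_any k0 r_gt0 m_gt0 phi1 saddle betaE A.
set f2 := theta beta + _ in gQ *.
set TM := tensor (rank1 (theta alpha)) R; set TN := tensor (rank1 f2) R.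
set FM : _ -> TM := frame (theta alpha) P; set FN : _ -> TN := frame f2 P.
have [FM' FMK FM'K] : bijective FM := frame_bij _ uP.
have bN : bijective FN := frame_bij _ uP.
have FMD : {morph FM : u v / u + v} := @frameD _ _ _ P.
have FMZ a y : FM (a *: y) = a *: FM y := @frameZ _ _ _ P a y.
have FND : {morph FN : u v / u + v} := @frameD _ _ _ P.
have FNZ a y : FN (a *: y) = a *: FN y := @frameZ _ _ _ P a y.
have FM_D y : conn_D (FM y) = FM (mtheta y + theta alpha *: y + y *m cmx A) := frame_D _ eP y.
have FN_D y : conn_D (FN y) = FN (mtheta y + f2 *: y + y *m cmx A) := frame_D _ eP y.
pose M := pushforward k0 r_gt0 TM; pose N := pushforward k0 m_gt0 TN.
pose iota (u : M) : N := FN (g (FM' u)).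
have iotaE y : iota (FM y) = FN (g y) by rewrite /iota FMK.
have sM a (u : M) : a *: u = expand r_gt0 a *: (u : TM) by [].
have sN a (u : N) : a *: u = expand m_gt0 a *: (u : TN) by [].
exists iota; split.
- have bM : bijective FM' by exists FM.
  exact: (bij_comp bN (bij_comp gbij bM)).
- move=> c u v; rewrite -(FM'K u) -(FM'K v) sM sN !expand_const.
  have -> : (lconst c *: (FM (FM' u) : TM) + FM (FM' v) : M) = FM (lconst c *: FM' u + FM' v).
    by rewrite FMD FMZ.
  by rewrite !iotaE gD gc FND FNZ.
- move=> u; rewrite -(FM'K u); move: (FM' u) => y {u}.
  rewrite sM sN expand_lX expand_lXV.
  have -> : conn_D (FM y : M) = FM (lconst r%:R^-1 *: (mtheta y + theta alpha *: y + y *m cmx A)).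
    by rewrite FMZ -FM_D -[LHS]/(expand r_gt0 (lconst r%:R^-1) *: conn_D (FM y)) expand_const.
  by rewrite -FMZ !iotaE gP FNZ.
- move=> u; rewrite -(FM'K u); move: (FM' u) => y {u}.
  rewrite sM sN expand_lX expand_lXV -FMZ !iotaE -(morphN FND) gQ.
  have -> : conn_D (FN (g y) : N) = FN (lconst m%:R^-1 *: (mtheta (g y) + f2 *: g y + g y *m cmx A)).
    by rewrite FNZ -FN_D -[LHS]/(expand m_gt0 (lconst m%:R^-1) *: conn_D (FN (g y))) expand_const.
  by rewrite -FNZ.
move=> u L hL; have [q hq] := frame_absorbed FMD FMZ hL.
have [i hi] := ge_ex (MS k 1 _) (g (FM' u)).
(* If f has order at least p, then f(X^m) has order at least p m >= p; the coordinates of u'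
   therefore have order at least p + i + r >= q. *)
exists (absz (q - i - r%:Z)%R) => f u' hf.
rewrite -(FM'K u) -(FM'K u') sN !iotaE -FNZ => /(bij_inj bN) e.
apply: hq; have h1 : ge LS ((absz (q - i - r%:Z)%R)%:Z * m%:Z) (expand m_gt0 f).
  exact: ge_expandl.
have h2 := ge_scale h1 hi; rewrite -e in h2.
by apply: (geW (gge _ _ h2)); nia.
Qed.

Theorem theorem3 (k : closedFieldType) (k0 : [pchar k] =i pred0)
    (r s : nat) (r_gt0 : (0 < r)%N) (r_lt_s : (r < s)%N)
    (alpha : laurent k) (alpha_order : has_order alpha (- s%:Z)) :
  (exists Z : laurent k,
      has_order Z 1 /\
      lcomp (partial_t r alpha) Z + tvar k (s - r) = 0) /\
  (forall Z beta : laurent k,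
      has_order Z 1 ->
      lcomp (partial_t r alpha) Z + tvar k (s - r) = 0 ->
      lcomp alpha Z + lcomp (tvar k r) Z * tvar k (s - r) = beta ->
      has_order beta (- s%:Z) /\
      forall R : connection k, is_regular R ->
        let M := pushforward k0 r_gt0 (tensor (rank1 (theta alpha)) R) in
        let N := pushforward k0 (subn_pos r_lt_s)
          (tensor (rank1 (theta beta + lconst (s%:R / 2%:R))) R) in
        (exists F : connection k, is_local_fourier M F) /\
        (forall F : connection k, is_local_fourier M F -> conn_iso F N)).
Proof.
have m_gt0 := subn_pos r_lt_s; have sE : (r + (s - r))%N = s by rewrite subnKC // ltnW.
split.
  (* The first equation says that p(Z) = X^(-(s - r)), and p has order r - s. *)
  pose p := - partial_t r alpha.
  have hp : has_order p (- (s - r)%N%:Z).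
    have rk : r%:R != 0 :> k by apply: natr_neq0 => //; lia.
    have -> : p = lconst r%:R^-1 * (lX ^ r%:Z * theta alpha).
      rewrite /p /partial_t /tvar invrK -exprnP; move: (lX ^+ r) (lconst _) => x y.
      by ring.
    apply: has_order_const_mul; first by rewrite invr_eq0.
    have -> : - (s - r)%N%:Z = r%:Z + - s%:Z by lia.
    by apply: has_orderM; [apply: has_order_lX|apply: has_order_theta => //; lia].
  have [phi [phi1 hphi]] := exists_saddle k0 m_gt0 hp.
  exists phi; split=> //; rewrite tvarE -hphi /p (lcompN phi1).
  by rewrite subrr.
move=> Z beta Z1 saddle betaE; split.
  by have := beta_order k0 r_gt0 m_gt0 Z1 saddle betaE; rewrite sE.
move=> R hR M N.
have hN : is_local_fourier M N.
  have := local_fourier_exists k0 r_gt0 (subn_pos r_lt_s) Z1 saddle betaE hR.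
  by rewrite sE.
split; first by exists N.
by move=> F hF; apply: local_fourier_unique hF hN.
Qed.
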